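(* The constants $\alpha=\lim_{n\to\infty}Q(n)^{1/n}$, $\beta=\lim_{n\to\infty}M(n)^{1/n}$ and $\eta=\lim_{n\to\infty}m(n)^{1/n}$ satisfy \[1.572939<\alpha,\qquad 1.148192<\beta \ (\text{equivalently } 1.318345<\beta^2),\qquad 1.212500<\eta < 1.240904.\]
   Context: A set of positive integers is primitive if no element divides another element. $Q(n)$ is the number of primitive subsets of $\{1,\ldots,n\}$; $M(n)$ is the number of primitive subsets of $\{1,\ldots,n\}$ of maximum possible size $\lceil n/2\rceil$; $m(n)$ is the number of maximal primitive subsets of $\{1,\ldots,n\}$ (primitive subsets to which no further element of $\{1,\ldots,n\}$ can be added while keeping the set primitive). These three limits exist. *)

(* Defs.v *)
From mathcomp Require Import all_boot.
From mathcomp Require Import zify.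
From Stdlib Require Import Reals.
From Coquelicot Require Import Coquelicot.

Set Implicit Arguments.
Unset Strict Implicit.
Unset Printing Implicit Defensive.

Local Open Scope nat_scope.

(* Subsets of {1, ..., n} are the sets over 'I_n.+1 = {0, ..., n} that do not
   contain 0, so that the value of an ordinal is the integer it represents. *)
Definition interval1 (n : nat) : {set 'I_n.+1} := [set x : 'I_n.+1 | 0 < x].

Definition primitive (n : nat) (A : {set 'I_n.+1}) : bool :=
  [forall x : 'I_n.+1 in A, forall y : 'I_n.+1 in A, (x != y) ==> ~~ (x %| y)].

Definition primitive_subsets (n : nat) : {set {set 'I_n.+1}} :=
  [set A : {set 'I_n.+1} | (A \subset interval1 n) && primitive A].

Definition max_primitive_size (n : nat) : nat :=
  \max_(A in primitive_subsets n) #|A|.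

Definition primitive_count (n : nat) : nat := #|primitive_subsets n|.

(* See max_primitive_sizeE below: the maximum size is the ceiling of n / 2. *)
Definition maximum_primitive_count (n : nat) : nat :=
  #|[set A in primitive_subsets n | #|A| == max_primitive_size n]|.

Definition maximal_primitive_count (n : nat) : nat :=
  #|[set A in primitive_subsets n |
       [forall x : 'I_n.+1 in interval1 n :\: A, ~~ primitive (x |: A)]]|.

Lemma primitive_card_le (n : nat) (A : {set 'I_n.+1}) :
  A \in primitive_subsets n -> #|A| <= uphalf n.
Proof.
rewrite inE => /andP[/subsetP Apos /'forall_in_forall_inP Aprim].
pose f (i : 'I_n.+1) := (i`_2^')./2.
have fodd i : odd (i`_2^') by rewrite odd_2'nat part_pnat.
have fE i : (f i).*2.+1 = i`_2^' by rewrite -[RHS]odd_double_half fodd.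
have finj : {in A &, injective f}.
  move=> x y xA yA fxy; apply/eqP; apply: contraT => xy.
  have exy : x`_2^' = y`_2^' by rewrite -!fE fxy.
  have := Aprim _ xA _ yA; have := Aprim _ yA _ xA.
  rewrite eq_sym xy /= => nyx nxy.
  have gt0 z : z \in A -> 0 < (z : nat) by move/Apos; rewrite inE.
  have ex := partnC 2 (gt0 _ xA); have ey := partnC 2 (gt0 _ yA).
  rewrite -ex -ey exy !p_part in nxy nyx.
  case: (leqP (logn 2 x) (logn 2 y)) => h.
    by rewrite dvdn_mul ?dvdn_exp2l in nxy.
  by rewrite dvdn_mul ?dvdn_exp2l 1?ltnW in nyx.
rewrite -(size_iota 0 (uphalf n)) cardE -(size_map f).
apply: uniq_leq_size.
  rewrite map_inj_in_uniq ?enum_uniq // => x y.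
  by rewrite !mem_enum; apply: finj.
move=> k /mapP[x]; rewrite mem_enum mem_iota /= add0n => xA ->.
have x0 : 0 < (x : nat) by have := Apos _ xA; rewrite inE.
have := dvdn_leq x0 (dvdn_part 2^' x); rewrite -fE.
have := ltn_ord x; lia.
Qed.

Lemma max_primitive_sizeE (n : nat) : max_primitive_size n = uphalf n.
Proof.
apply/eqP; rewrite eqn_leq; apply/andP; split.
  by apply/bigmax_leqP => A; apply: primitive_card_le.
pose A : {set 'I_n.+1} := [set x : 'I_n.+1 | n./2 < x].
have AP : A \in primitive_subsets n.
  rewrite inE; apply/andP; split.
    by apply/subsetP => x; rewrite !inE; lia.
  apply/'forall_in_forall_inP => x; rewrite inE => hx y; rewrite inE => hy.
  apply/implyP => xy; apply/negP => /dvdnP[k yk].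
  have := ltn_ord y; have : (x : nat) <> y by move/ord_inj/eqP; apply/negP.
  case: k yk => [|[|k]]; nia.
apply: leq_trans (leq_bigmax_cond _ AP).
pose g (i : 'I_(uphalf n)) : 'I_n.+1 := inord (n./2 + i.+1).
have gE i : g i = n./2 + i.+1 :> nat.
  by rewrite inordK //; have := ltn_ord i; lia.
have ginj : injective g.
  by move=> i j /(congr1 val) /=; rewrite !gE => h; apply: ord_inj; lia.
rewrite -[leqLHS]card_ord -(card_imset _ ginj); apply/subset_leq_card/subsetP.
by move=> _ /imsetP[i _ ->]; rewrite inE gE; lia.
Qed.

Local Open Scope R_scope.

(* Rpower x y is exp (y * ln x), the usual power for x > 0; the three counts
   above are positive. The value at n = 0 does not affect limits. *)
Definition nth_root_seq (f : nat -> nat) (n : nat) : R :=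
  Rpower (INR (f n)) (/ INR n).

(* Main.v *)
(** Lower bounds for alpha and beta. A primitive set is the set of minimal elements of a set closed
    under multiplication by primes inside {1, ..., n}; similarly, a set of numbers at most n / 2
    closed under x -> 2 x and x -> p x / 2 (p an odd prime) yields, after adding (n / 2, n], a
    primitive set of maximum size: the least element of each chain x, 2 x, 4 x, ... So both counts
    are at least a number of closed sets. Adding the elements v in decreasing order multiplies this
    number by 1 + p(v), where p(v) is the proportion of closed sets above v that contain all the
    multiples demanded by v. By the four functions theorem p(v) can only decrease when the numbers
    above v are restricted to a closed set W of multiples of v / B; with W depending only on n / v
    and on gcd (v, L), the restricted proportion is a finite computation. Summing ln (1 + p(v)) over
    v bounds the growth rate.

    Bounds for eta. Call m high when n < 7 m, 5 m or 3 m, according to the coarseness used for its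
    class: numbers are grouped by their 30-rough part, their 6-rough part or their odd part as they
    get smaller. Comparable high numbers lie in the same class, so the classes can be treated
    independently: a maximal primitive set of high numbers extends to a maximal primitive set, and
    conversely a maximal primitive set is determined by its completion inside the classes. A class
    is the set of multiples b s of a base b by smooth numbers s <= n / b, so its contribution
    depends only on n / b and is again a finite computation; what remains below the last threshold
    contributes a negligible power of 2. *)
Require Import Defs.
From mathcomp Require Import all_boot zify.
From Stdlib Require Import NArith.

Set Implicit Arguments.
Unset Strict Implicit.
Unset Printing Implicit Defensive.

(** * Sums over families of sets *)

(** Everything numerical has to be settled for all n by finitely many integer computations. The
    range of n / v, or of n / b, is cut into windows that no critical product crosses, so that one
    count serves a whole window; and the conditions on v or b are periodic, so that each window
    contributes a rational density with a bounded error, which the n-th root removes. The counts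
    come from a sweep over the vertices whose states remember only vertices with neighbours still to
    come, and logarithms are fixed-point integers rounded in the safe direction.

    In the bounds for alpha and beta, the meaning of tests is proved, not the quality of a search:
    patterns, sweep orders and the best pattern for each window are proposed by unverified functions
    and tabulated data, and a proposal that fails its test counts for nothing. The four functions
    theorem permits this freedom, since any closed W gives a valid bound. *)

Section Families.
Variable T : finType.
Implicit Types (x : T) (A B F G N V W : {set T}).

Lemma sum_subset_setU1 x V (f : {set T} -> nat) : x \notin V ->
  \sum_(A : {set T} | A \subset x |: V) f A =
  \sum_(A : {set T} | A \subset V) f A + \sum_(A : {set T} | A \subset V) f (x |: A).
Proof.
move=> xV; rewrite (bigID (fun A : {set T} => x \in A)) /= addnC; congr (_ + _).
  apply: eq_bigl => A; apply/andP/idP => [[/subsetP AV xA]|/subsetP AV].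
    by apply/subsetP => y yA; case/setU1P: (AV y yA) => // yx; rewrite -yx yA in xA.
  split; first by apply/subsetP => y yA; rewrite in_setU1 AV ?orbT.
  by apply: contra xV; apply: AV.
rewrite (reindex_onto (fun A => x |: A) (fun A => A :\ x)) /=; last first.
  by move=> A /andP[_ xA]; rewrite setD1K.
apply: eq_bigl => A; rewrite setU11 andbT.
apply/andP/idP => [[/subsetP AV /eqP AE]|AV].
  apply/subsetP => y yA; have : y != x by move: yA; rewrite -AE !inE; case/andP.
  by have := AV y (setU1r x yA); rewrite in_setU1; case: (y == x).
split; first by rewrite setUS.
by apply/eqP; rewrite setU1K //; apply: contra xV; move/subsetP: AV; apply.
Qed.

(** One-element case of the four functions theorem. Put t = c1 * d0, which bounds both mixed
    products p = a0 * b1 and q = a1 * b0. Then (t - p) * (t - q) >= 0 and p * q <= t * (c0 * d1)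
    give t * (p + q) <= t * (t + c0 * d1); for t = 0 the mixed products vanish. *)
Lemma four_functions_point (a0 a1 b0 b1 c0 c1 d0 d1 : nat) :
  a0 * b0 <= c0 * d0 -> a0 * b1 <= c1 * d0 -> a1 * b0 <= c1 * d0 ->
  a1 * b1 <= c1 * d1 -> (a0 + a1) * (b0 + b1) <= (c0 + c1) * (d0 + d1).
Proof.
move=> h00 h01 h10 h11.
have [t0|t0] := posnP (c1 * d0).
  have : a0 * b1 = 0 by lia.
  have : a1 * b0 = 0 by lia.
  nia.
suff: a0 * b1 + a1 * b0 <= c1 * d0 + c0 * d1 by nia.
rewrite -(leq_pmul2l t0).
have : (a0 * b1) * (a1 * b0) <= (c1 * d0) * (c0 * d1).
  have := leq_mul h00 h11; nia.
nia.
Qed.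

(** The Ahlswede-Daykin inequality, by induction on an enumeration of [V]: summing out an element x
    replaces a by A |-> a A + a (x |: A), and [four_functions_point] keeps the hypothesis true for
    the merged functions. *)
Lemma four_functions V (a b c d : {set T} -> nat) :
  (forall A B, a A * b B <= c (A :|: B) * d (A :&: B)) ->
  (\sum_(A : {set T} | A \subset V) a A) * (\sum_(A : {set T} | A \subset V) b A) <=
  (\sum_(A : {set T} | A \subset V) c A) * (\sum_(A : {set T} | A \subset V) d A).
Proof.
move=> h.
(* Restricted to subsets of [V]: after merging, the hypothesis is only known for sets that avoid the
   elements already summed out. *)
have {h} : forall A B, A \subset V -> B \subset V -> a A * b B <= c (A :|: B) * d (A :&: B) by [].
rewrite -(set_enum V); move: (enum V) (enum_uniq V) => s.
elim: s a b c d => [|x s IH] a b c d /= us h.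
  have e0 f : \sum_(A : {set T} | A \subset [set:: [::]]) f A = f set0.
    by rewrite set_nil (big_pred1 set0) // => A; rewrite subset0.
  by rewrite !e0; have := h set0 set0 (sub0set _) (sub0set _); rewrite setU0 setI0.
case/andP: us => xs us.
have xV : x \notin [set:: s] by rewrite inE.
rewrite set_cons !sum_subset_setU1 // -!big_split /=.
apply: IH => // A B AV BV.
have xA : x \notin A by apply: contra xV; move/subsetP: AV; apply.
have xB : x \notin B by apply: contra xV; move/subsetP: BV; apply.
have AV' : A \subset [set:: x :: s] by rewrite set_cons (subset_trans AV) ?subsetU1.
have BV' : B \subset [set:: x :: s] by rewrite set_cons (subset_trans BV) ?subsetU1.
have xAV' : x |: A \subset [set:: x :: s] by rewrite set_cons setUS.
have xBV' : x |: B \subset [set:: x :: s] by rewrite set_cons setUS.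
apply: four_functions_point; first exact: h.
- have := h A (x |: B) AV' xBV'.
  rewrite setUCA; suff -> : A :&: (x |: B) = A :&: B by [].
  by apply/setP => y; rewrite !inE; case: eqP => // ->; rewrite (negPf xA).
- have := h (x |: A) B xAV' BV'.
  rewrite -setUA; suff -> : (x |: A) :&: B = A :&: B by [].
  by apply/setP => y; rewrite !inE; case: eqP => // ->; rewrite (negPf xB) !andbF.
- by have := h (x |: A) (x |: B) xAV' xBV'; rewrite -setUIr -setUUr.
Qed.

Definition numsub V (P : pred {set T}) : nat :=
  #|[set A : {set T} | (A \subset V) && P A]|.

Lemma numsubE V P : numsub V P = \sum_(A : {set T} | A \subset V) P A.
Proof.
by rewrite /numsub cardsE -sum1_card big_mkcondr; apply: eq_bigr => A _; case: (P A).
Qed.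

Lemma numsub_setU1 x V P : x \notin V ->
  numsub (x |: V) P = numsub V P + numsub V (fun A => P (x |: A)).
Proof. by move=> xV; rewrite !numsubE sum_subset_setU1. Qed.

Variable R : T -> {set T}.

Definition upset F := [forall x in F, R x \subset F].

Lemma upsetP F : reflect (forall x, x \in F -> R x \subset F) (upset F).
Proof. exact: forall_inP. Qed.

Lemma upsetU F G : upset F -> upset G -> upset (F :|: G).
Proof.
move=> /upsetP hF /upsetP hG; apply/upsetP => x /setUP[/hF|/hG] h.
  exact: subset_trans h (subsetUl _ _).
exact: subset_trans h (subsetUr _ _).
Qed.

Lemma upsetI F G : upset F -> upset G -> upset (F :&: G).
Proof.
move=> /upsetP hF /upsetP hG; apply/upsetP => x /setIP[/hF h /hG h'].
by rewrite subsetI h.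
Qed.

(* Under the uniform measure on the upsets of V, requiring N is positively correlated
   with forgetting everything outside the up-closed set W. *)
Lemma upset_local V W N : W \subset V ->
  numsub V upset * numsub W (fun G => upset G && (N \subset G)) <=
  numsub V (fun F => upset F && (N \subset F)) * numsub W upset.
Proof.
move=> WV.
have numW P : numsub W P = numsub V (fun A => (A \subset W) && P A).
  apply: eq_card => A; rewrite !inE; case AW : (A \subset W) => //=; last by rewrite andbF.
  by rewrite (subset_trans AW WV).
(* If A is an upset and B an upset inside W containing N, then A :|: B is an upset containing N and
   A :&: B is an upset inside W. *)
rewrite !numW !numsubE; apply: four_functions => A B.
case uA : (upset A) => //; case BW : (B \subset W) => //; case uB : (upset B) => //=.
case NB : (N \subset B) => //=.
by rewrite upsetU // (subset_trans NB (subsetUr _ _)) upsetI // (subset_trans (subsetIr _ _) BW).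
Qed.

(** Upsets of [x |: V] that avoid x are the upsets of V; an upset of V containing [R x] yields one
    that contains x. The gain is a factor of at least 1 + p(x), and [upset_local] bounds p(x) below
    by the proportion found in W. Denominators are cleared to stay in nat. *)
Lemma upset_ratio V W x : x \notin V -> W \subset V ->
  (forall y, y \in V -> x \notin R y) -> x \notin R x ->
  numsub V upset * (numsub W upset + numsub W (fun G => upset G && (R x \subset G))) <=
  numsub (x |: V) upset * numsub W upset.
Proof.
move=> xV WV hx hxx; rewrite numsub_setU1 // mulnDr mulnDl leq_add2l.
apply: leq_trans (upset_local (R x) WV) _; rewrite leq_mul2r; apply/orP; right.
apply: subset_leq_card; apply/subsetP => F; rewrite !inE => /andP[FV /andP[/upsetP uF RF]].
rewrite FV; apply/upsetP => y /setU1P[->|/uF]; first exact: subset_trans RF (subsetU1 _ _).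
by move/subset_trans; apply; apply: subsetU1.
Qed.

End Families.

(** * Counting bit strings accepted by an automaton *)

Fixpoint bits (n : nat) : seq bitseq :=
  if n is m.+1 then map (cons false) (bits m) ++ map (cons true) (bits m) else [:: [::]].

Lemma size_bits n bs : bs \in bits n -> size bs = n.
Proof.
elim: n bs => [|n IH] bs /=; first by rewrite inE => /eqP ->.
by rewrite mem_cat => /orP[] /mapP[b /IH <- ->].
Qed.

Lemma count_bitsS (P : pred bitseq) n :
  count P (bits n.+1) = count (P \o cons false) (bits n) + count (P \o cons true) (bits n).
Proof. by rewrite /= count_cat !count_map. Qed.

Lemma numsub_bits (T : finType) (s : seq T) (P : pred {set T}) : uniq s ->
  numsub [set:: s] P = count (fun bs => P [set:: mask bs s]) (bits (size s)).
Proof.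
elim: s P => [|x s IH] P /=.
  move=> _; rewrite numsubE set_nil (big_pred1 set0) => [|A]; last by rewrite subset0.
  by rewrite addn0.
case/andP=> xs us; rewrite set_cons numsub_setU1 ?inE // !IH // count_cat !count_map.
by congr (_ + _); apply: eq_count => bs; rewrite /= ?set_cons.
Qed.

Inductive digit := D0 | D1 | D2.

Definition digit_eqb (d e : digit) : bool :=
  match d, e with D0, D0 | D1, D1 | D2, D2 => true | _, _ => false end.

(** States are words over [digit], stored with their multiplicity; inserting a word twice adds the
    multiplicities, which is how equal states merge. *)
Inductive trie := Tip | Bin of N & trie & trie & trie.

Fixpoint trie_add (k : seq digit) (c : N) (t : trie) : trie :=
  match k, t with
  | [::], Tip => Bin c Tip Tip Tip
  | [::], Bin n a0 a1 a2 => Bin (N.add n c) a0 a1 a2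
  | D0 :: k', Tip => Bin N0 (trie_add k' c Tip) Tip Tip
  | D1 :: k', Tip => Bin N0 Tip (trie_add k' c Tip) Tip
  | D2 :: k', Tip => Bin N0 Tip Tip (trie_add k' c Tip)
  | D0 :: k', Bin n a0 a1 a2 => Bin n (trie_add k' c a0) a1 a2
  | D1 :: k', Bin n a0 a1 a2 => Bin n a0 (trie_add k' c a1) a2
  | D2 :: k', Bin n a0 a1 a2 => Bin n a0 a1 (trie_add k' c a2)
  end.

Definition cons_key (d : digit) (kc : seq digit * N) := (d :: kc.1, kc.2).

Fixpoint trie_seq (t : trie) : seq (seq digit * N) :=
  if t is Bin n a0 a1 a2 then
    let r := map (cons_key D0) (trie_seq a0) ++ map (cons_key D1) (trie_seq a1)
             ++ map (cons_key D2) (trie_seq a2) in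
    if n is N0 then r else ([::], n) :: r
  else [::].

Definition weight (g : seq digit -> nat) (s : seq (seq digit * N)) : nat :=
  sumn [seq N.to_nat kc.2 * g kc.1 | kc <- s].

Lemma weight_cat g s1 s2 : weight g (s1 ++ s2) = weight g s1 + weight g s2.
Proof. by rewrite /weight map_cat sumn_cat. Qed.

Lemma weight_consE g kc s : weight g (kc :: s) = N.to_nat kc.2 * g kc.1 + weight g s.
Proof. by []. Qed.

Lemma weight_cons_key g d s : weight g (map (cons_key d) s) = weight (g \o cons d) s.
Proof. by rewrite /weight -map_comp. Qed.

Lemma weight_Bin g n a0 a1 a2 : weight g (trie_seq (Bin n a0 a1 a2)) =
  N.to_nat n * g [::] + weight (g \o cons D0) (trie_seq a0)
  + weight (g \o cons D1) (trie_seq a1) + weight (g \o cons D2) (trie_seq a2).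
Proof.
rewrite -!weight_cons_key -!addnA -!weight_cat /=.
by case: n => [|p] //=.
Qed.

(** All that is needed of insertion. With [g] arbitrary, the trie never has to be described as a set
    of states. *)
Lemma weight_add g k c t :
  weight g (trie_seq (trie_add k c t)) = weight g (trie_seq t) + N.to_nat c * g k.
Proof.
elim: k g t => [|d k IH] g [|n a0 a1 a2].
- by rewrite [trie_add _ _ _]/= weight_Bin /weight /=; lia.
- by rewrite [trie_add _ _ _]/= !weight_Bin N2Nat.inj_add; nia.
- by case: d; rewrite [trie_add _ _ _]/= weight_Bin IH /weight /=; lia.
- by case: d; rewrite [trie_add _ _ _]/= !weight_Bin IH /=; lia.
Qed.

(* A layered automaton reading one bit per step; [dp] counts the accepted bit strings by
   merging equal states, [run] is its one-string semantics. *)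
Section Automaton.
Variable step : Type.
Variable trans : step -> bool -> seq digit -> option (seq digit).

Fixpoint run (ss : seq step) (k : seq digit) (bs : bitseq) : bool :=
  match ss, bs with
  | [::], [::] => true
  | st :: ss', b :: bs' => if trans st b k is Some k' then run ss' k' bs' else false
  | _, _ => false
  end.

Definition advance (st : step) (acc : trie) (kc : seq digit * N) : trie :=
  let acc0 := if trans st false kc.1 is Some k' then trie_add k' kc.2 acc else acc in
  if trans st true kc.1 is Some k' then trie_add k' kc.2 acc0 else acc0.

Fixpoint total (s : seq (seq digit * N)) : N :=
  if s is kc :: s' then N.add kc.2 (total s') else N0.

Fixpoint dp (ss : seq step) (t : trie) : N :=
  if ss is st :: ss' then dp ss' (foldl (advance st) Tip (trie_seq t))
  else total (trie_seq t).

Lemma run_consE st ss k b bs : run (st :: ss) k (b :: bs) =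
  if trans st b k is Some k' then run ss k' bs else false.
Proof. by []. Qed.

Definition accepted ss k := count (run ss k) (bits (size ss)).

Lemma accepted_cons st ss k : accepted (st :: ss) k =
  (if trans st false k is Some k' then accepted ss k' else 0) +
  (if trans st true k is Some k' then accepted ss k' else 0).
Proof.
rewrite /accepted count_bitsS.
have e b : count (run (st :: ss) k \o cons b) (bits (size ss)) =
    if trans st b k is Some k' then count (run ss k') (bits (size ss)) else 0.
  case E: (trans st b k) => [k'|]; first by apply: eq_count => bs /=; rewrite E.
  by rewrite -[RHS](count_pred0 (bits (size ss))); apply: eq_count => bs /=; rewrite E.
exact: congr2 (e false) (e true).
Qed.

(** Weighting a state by its number of accepted continuations gives an invariant of the layer step,
    because each state passes its multiplicity on to at most two successors. *)
Lemma weight_advance st ss acc s :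
  weight (accepted ss) (trie_seq (foldl (advance st) acc s)) =
  weight (accepted ss) (trie_seq acc) + weight (accepted (st :: ss)) s.
Proof.
elim: s acc => [|[k c] s IH] acc; first by rewrite addn0.
rewrite [foldl _ _ _]/= IH [weight _ (_ :: s)]weight_consE accepted_cons /advance /=.
case: (trans st false k) => [k0|]; case: (trans st true k) => [k1|]; rewrite ?weight_add; lia.
Qed.

Lemma dp_weight ss t : N.to_nat (dp ss t) = weight (accepted ss) (trie_seq t).
Proof.
elim: ss t => [|st ss IH] t; last by rewrite [dp _ _]/= IH weight_advance.
rewrite /=; elim: (trie_seq t) => [|[k c] s IHs] //=.
by rewrite N2Nat.inj_add IHs /weight /= /accepted /= muln1.
Qed.

Lemma dp_accepted ss : N.to_nat (dp ss (trie_add [::] 1%num Tip)) = accepted ss [::].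
Proof. by rewrite dp_weight weight_add /weight /= mul1n. Qed.

End Automaton.

(** * Upsets counted by a sweep over the vertices *)

Notation vertex := (N * seq N)%type.
Definition memN (a : N) (s : seq N) : bool := has (N.eqb a) s.
(** A vertex carries the list of labels that it demands, so [implies u v] means that choosing [u]
    forces [v]. *)
Definition implies (u v : vertex) : bool := memN v.1 u.2.
Definition linked (u v : vertex) : bool := implies u v || implies v u.

Lemma memNP a s : memN a s = (a \in s).
Proof. by elim: s => //= b s IH; rewrite inE -IH. Qed.

(** For each live vertex u, [tags] tells whether the new vertex demands u and whether u demands it;
    [keep] cuts the state, headed by the new vertex, down to the vertices still needed; [forced]
    forbids leaving the new vertex out. *)
Record cstep := CStep { forced : bool; tags : seq (bool * bool); keep : bitseq }.

Fixpoint check_one (ts : seq (bool * bool)) (k : seq digit) : bool :=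
  match ts, k with
  | t :: ts', d :: k' => (if t.1 then digit_eqb d D1 else true) && check_one ts' k'
  | _, _ => true
  end.

Fixpoint check_zero (ts : seq (bool * bool)) (k : seq digit) : bool :=
  match ts, k with
  | t :: ts', d :: k' => (if t.2 then digit_eqb d D0 else true) && check_zero ts' k'
  | _, _ => true
  end.

Definition ctrans (st : cstep) (b : bool) (k : seq digit) : option (seq digit) :=
  if b then
    if check_one (tags st) k then Some (mask (keep st) (D1 :: k)) else None
  else if forced st then None
  else if check_zero (tags st) k then Some (mask (keep st) (D0 :: k)) else None.

Lemma ctransE f ts kp b k : ctrans (CStep f ts kp) b k =
  if b then if check_one ts k then Some (mask kp (D1 :: k)) else None
  else if f then None
  else if check_zero ts k then Some (mask kp (D0 :: k)) else None.
Proof. by []. Qed.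

(* One more than the position in [s] of the last vertex satisfying [p], 0 if there is none. *)
Fixpoint last_pos (A : Type) (p : pred A) (s : seq A) : nat :=
  if s is w :: s' then
    if last_pos p s' is k.+1 then k.+2 else if p w then 1 else 0
  else 0.

(** Nothing beyond the first [c] entries of [s] satisfies [p]: a vertex with this counter may be
    forgotten after [c] more steps. *)
Fixpoint bounded (A : Type) (c : nat) (p : pred A) (s : seq A) : bool :=
  if c is c'.+1 then if s is _ :: s' then bounded c' p s' else true else ~~ has p s.

Lemma bounded_last (A : Type) (p : pred A) s : bounded (last_pos p s) p s.
Proof.
elim: s => //= w s IH; move: IH; case: (last_pos _ s) => [|k] //=.
by case E : (p w) => //=; rewrite E.
Qed.

(** The counter of a live vertex is the number of steps up to its last link; at 0 the vertex leaves
    the state. The length of a state is therefore the width of the sweep frontier, not the number of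
    vertices read. *)
Fixpoint csteps (must : N -> bool) (live : seq (vertex * nat)) (vs : seq vertex) : seq cstep :=
  if vs is v :: rest then
    let live' := (v, last_pos (linked v) rest) :: [seq (u.1, u.2.-1) | u <- live] in
    CStep (must v.1) [seq (implies v u.1, implies u.1 v) | u <- live]
          [seq 0 < u.2 | u <- live']
    :: csteps must [seq u <- live' | 0 < u.2] rest
  else [::].

Definition count_upsets (must : N -> bool) (vs : seq vertex) : N :=
  dp ctrans (csteps must [::] vs) (trie_add [::] 1%num Tip).

Section CountUpsets.
Variable must : N -> bool.
Variable bet : N -> bool.
Let dig (u : vertex) := if bet u.1 then D1 else D0.

Definition pair_ok (v u : vertex) :=
  (implies v u && bet v.1 ==> bet u.1) && (implies u v && bet u.1 ==> bet v.1).

Fixpoint all_ok (done vs : seq vertex) : bool :=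
  if vs is v :: rest then
    [&& must v.1 ==> bet v.1, all (pair_ok v) done & all_ok (v :: done) rest]
  else true.

Lemma pair_ok_unlinked v u : ~~ linked u v -> pair_ok v u.
Proof. by rewrite /pair_ok /linked negb_or => /andP[/negPf -> /negPf ->]. Qed.

(** A vertex without link to [vs] imposes no condition there, so the sweep may forget it. *)
Lemma all_ok_filter (p : pred vertex) done vs :
  (forall u, u \in done -> ~~ p u -> ~~ has (linked u) vs) ->
  all_ok done vs = all_ok (filter p done) vs.
Proof.
suff gen d1 : (forall u, u \in done -> ~~ p u -> ~~ has (linked u) vs) ->
  all_ok (d1 ++ done) vs = all_ok (d1 ++ filter p done) vs by exact: (gen [::]).
elim: vs d1 => //= v rest IH d1 h.
rewrite -!cat_cons IH; last by move=> u ud /(h u ud); rewrite negb_or => /andP[].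
rewrite !all_cat; congr [&& _, _ && _ & _].
elim: done h {IH} => //= u done IH h.
rewrite IH; last by move=> w wd; apply: h; rewrite inE wd orbT.
case pu : (p u) => //=; rewrite pair_ok_unlinked //.
by have := h u (mem_head _ _); rewrite pu negb_or => /(_ isT) /andP[].
Qed.

Lemma check_oneE v live : check_one [seq (implies v u.1, implies u.1 v) | u <- live]
    [seq dig u.1 | u <- live : seq (vertex * nat)] =
  all (fun u => implies v u ==> bet u.1) (map fst live).
Proof. by elim: live => //= u l ->; rewrite /dig; case: (implies v u.1); case: (bet u.1.1). Qed.

Lemma check_zeroE v live : check_zero [seq (implies v u.1, implies u.1 v) | u <- live]
    [seq dig u.1 | u <- live : seq (vertex * nat)] =
  all (fun u => implies u v ==> ~~ bet u.1) (map fst live).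
Proof. by elim: live => //= u l ->; rewrite /dig; case: (implies u.1 v); case: (bet u.1.1). Qed.

Lemma run_csteps live vs :
  (forall u, u \in live -> bounded u.2 (linked u.1) vs && (0 < u.2)) ->
  run ctrans (csteps must live vs) [seq dig u.1 | u <- live] [seq bet v.1 | v <- vs] =
  all_ok (map fst live) vs.
Proof.
elim: vs live => [//|v rest IH] live hl.
pose live' := (v, last_pos (linked v) rest) :: [seq (u.1, u.2.-1) | u <- live].
have -> : csteps must live (v :: rest) =
  CStep (must v.1) [seq (implies v u.1, implies u.1 v) | u <- live] [seq 0 < u.2 | u <- live']
  :: csteps must [seq u <- live' | 0 < u.2] rest by [].
have hl' u : u \in live' -> bounded u.2 (linked u.1) rest.
  rewrite /live' in_cons => /orP[/eqP ->|]; first exact: bounded_last.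
  move/mapP => -[[w [|c]] /hl /andP[hb hp] ->] //.
have digE : dig v :: [seq dig u.1 | u <- live] = [seq dig u.1 | u <- live'].
  by rewrite /= -map_comp.
have okE : all_ok (v :: map fst live) rest =
           run ctrans (csteps must [seq u <- live' | 0 < u.2] rest)
             [seq dig u.1 | u <- [seq u <- live' | 0 < u.2]] [seq bet u.1 | u <- rest].
  rewrite IH; last first.
    by move=> u; rewrite mem_filter => /andP[h0 /hl' ->].
  have -> : v :: map fst live = map fst live' by rewrite /= -map_comp; congr (_ :: _); apply: eq_map.
  clear IH hl digE; move: live' hl' => l.
  suff gen d1 : (forall u, u \in l -> bounded u.2 (linked u.1) rest) ->
    all_ok (d1 ++ map fst l) rest = all_ok (d1 ++ map fst [seq u <- l | 0 < u.2]) rest by exact: (gen [::]).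
  elim: l d1 => //= u l IHl d1 hu.
  have hl2 w : w \in l -> bounded w.2 (linked w.1) rest by move=> wl; apply: hu; rewrite inE wl orbT.
  case: posnP => u0 /=; last first.
    by rewrite -!cat_rcons; apply: IHl.
  rewrite -IHl //.
  have nb : ~~ has (linked u.1) rest by have := hu u (mem_head _ _); rewrite u0.
  (* Vertices may recur in the list, so all copies of [u.1] are removed on both sides, which leaves
     equal lists. *)
  rewrite (all_ok_filter (p := fun w => w != u.1)); last first.
    by move=> w _; rewrite negbK => /eqP ->.
  rewrite [in RHS](all_ok_filter (p := fun w => w != u.1)); last first.
    by move=> w _; rewrite negbK => /eqP ->.
  by rewrite !filter_cat /= eqxx.
have maskE : mask [seq 0 < u.2 | u <- live'] (dig v :: [seq dig u.1 | u <- live]) =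
             [seq dig u.1 | u <- [seq u <- live' | 0 < u.2]].
  by rewrite digE -map_mask filter_mask.
have -> : all_ok (map fst live) (v :: rest) =
  [&& must v.1 ==> bet v.1, all (pair_ok v) (map fst live) & all_ok (v :: map fst live) rest] by [].
rewrite okE map_cons run_consE ctransE.
have pairE : all (pair_ok v) (map fst live) =
  if bet v.1 then all (fun u => implies v u ==> bet u.1) (map fst live)
  else all (fun u => implies u v ==> ~~ bet u.1) (map fst live).
  case bv : (bet v.1); apply: eq_all => u; rewrite /pair_ok bv ?andbT ?implybT ?andbF ?andbT //=.
  by case: (implies u v); case: (bet u.1).
rewrite pairE; case bv : (bet v.1).
  rewrite check_oneE implybT andTb; case: all => //.
  by have d1 : dig v = D1 by [rewrite /dig bv]; move: maskE; rewrite d1 => ->.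
rewrite implybF; case: (must v.1) => //.
rewrite check_zeroE andTb; case: all => //.
by have d0 : dig v = D0 by [rewrite /dig bv]; move: maskE; rewrite d0 => ->.
Qed.

Lemma all_okE done vs : all_ok done vs =
  all (fun v => must v.1 ==> bet v.1) vs &&
  all (fun v => all (pair_ok v) done) vs && pairwise (fun u v => pair_ok v u) vs.
Proof.
elim: vs done => //= v vs IH done; rewrite IH /=.
have -> : all (fun w => pair_ok w v && all (pair_ok w) done) vs =
          all (fun w => pair_ok w v) vs && all (fun w => all (pair_ok w) done) vs.
  by rewrite -all_predI.
by case: (must v.1 ==> bet v.1); case: (all (pair_ok v) done); case: (all (fun w => pair_ok w v) vs);
  rewrite ?andbF //= ?andbT.
Qed.

End CountUpsets.

Definition model_upset (must : N -> bool) (vs : seq vertex) (F : seq N) : bool :=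
  all (fun v => (must v.1 ==> (v.1 \in F)) &&
                ((v.1 \in F) ==> all (fun u => implies v u ==> (u.1 \in F)) vs)) vs.

Lemma map_mem_mask (U : eqType) (s : seq U) bs : uniq s -> size bs = size s ->
  [seq a \in mask bs s | a <- s] = bs.
Proof.
elim: s bs => [|a s IH] [|b bs] //= /andP[ns us] [sb].
have nm : a \notin mask bs s by apply: contra ns; apply: mem_mask.
congr (_ :: _); first by case: b; rewrite ?mem_head // (negPf nm).
rewrite -[RHS](IH bs) //; apply/eq_in_map => c cs; case: b => //.
by rewrite inE; case: eqP => // ca; rewrite -ca cs in ns.
Qed.

(** The sweep tests each pair once, when its later vertex is read. Since [pair_ok] is symmetric in
    its two vertices and holds on the diagonal, this amounts to testing all pairs, which is
    [model_upset]. *)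
Lemma count_upsetsE must vs : uniq (map fst vs) ->
  N.to_nat (count_upsets must vs) =
  count (fun bs => model_upset must vs (mask bs (map fst vs))) (bits (size vs)).
Proof.
move=> us; rewrite /count_upsets dp_accepted /accepted.
have -> : size (csteps must [::] vs) = size vs.
  by elim: vs {us} [::] => //= v vs IH live; rewrite IH.
apply: eq_in_count => bs /size_bits sbs.
pose bet (a : N) := a \in mask bs (map fst vs).
have betE : [seq bet v.1 | v <- vs] = bs.
  by rewrite (map_comp bet fst) map_mem_mask // size_map.
rewrite -{1}betE.
rewrite (@run_csteps must bet [::] vs) //.
rewrite all_okE /= /model_upset.
have -> : all (fun _ => true) vs by apply/allP.
rewrite andbT.
apply/andP/allP => [[/allP hm hp] v vin|h].
  rewrite hm //=; apply/implyP => vF; apply/allP => u uin; apply/implyP => vu.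
  have pair_sym : symmetric (fun a b => pair_ok bet b a) by move=> a b; rewrite /pair_ok andbC.
  have pair_refl : reflexive (fun a b => pair_ok bet b a).
    by move=> a; rewrite /pair_ok; case: (implies _ _); case: (bet _).
  have : pair_ok bet v u.
    by move: hp; rewrite pairwise_all2rel // => /allrelP; apply.
  by rewrite /pair_ok vu (vF : bet v.1) => /andP[].
split; first by apply/allP => v /h /andP[].
apply/(pairwiseP (0%num, [::])) => i j ilt jlt ij.
have /h /andP[_ hi] := mem_nth (0%num, [::]) ilt.
have /h /andP[_ hj] := mem_nth (0%num, [::]) jlt.
rewrite /pair_ok; apply/andP; split; apply/implyP => /andP[im b].
  by have /allP /(_ _ (mem_nth _ ilt)) /implyP := implyP hj b; apply.
by have /allP /(_ _ (mem_nth _ jlt)) /implyP := implyP hi b; apply.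
Qed.

(** * Upward closed sets along multiplication patterns *)

(** An element a demands k * a / [divisor] for each k in [mults], as long as k * a stays within the
    bound; [mult_bound] is the limit below which the list of multipliers is complete. *)
Record system := System { divisor : N; mults : seq N; mult_bound : N }.

(** Everything is read in units u with v = [base] * u: [elems] are the members of W, and [reach]
    plays the role of n. *)
Record pattern := Pattern { base : N; reach : N; elems : seq N }.

Definition ups (S : system) (X a : N) : seq N :=
  [seq N.div (N.mul k a) (divisor S) | k <- mults S & N.leb (N.mul k a) X].

Definition closed_at (S : system) (X : N) (W : seq N) (a : N) : bool :=
  all (fun k => if N.leb (N.mul k a) X then
                  N.eqb (N.modulo (N.mul k a) (divisor S)) 0
                  && memN (N.div (N.mul k a) (divisor S)) W
                else true) (mults S).

Fixpoint uniqN (s : seq N) : bool :=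
  if s is a :: s' then ~~ memN a s' && uniqN s' else true.

Definition pattern_ok (S : system) (p : pattern) : bool :=
  [&& N.ltb 0 (base p), uniqN (elems p),
      all (fun a => N.ltb (base p) a && N.leb (N.mul (divisor S) a) (reach p)) (elems p)
    & all (closed_at S (reach p) (elems p)) (base p :: elems p)].

Definition vertices (S : system) (p : pattern) : seq vertex :=
  [seq (a, ups S (reach p) a) | a <- elems p].

Definition denom (S : system) (p : pattern) : N :=
  count_upsets (fun _ => false) (vertices S p).
Definition numer (S : system) (p : pattern) : N :=
  let U := ups S (reach p) (base p) in count_upsets (memN^~ U) (vertices S p).

(** No product lies strictly between [reach] and [h], so the same demands hold, and the same counts
    serve, whenever [reach] * u <= n < [h] * u. *)
Definition exceeds (S : system) (p : pattern) (h : N) : bool :=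
  all (fun a => all (fun k => N.leb (N.mul k a) (reach p) || N.leb h (N.mul k a)) (mults S))
      (base p :: elems p).

Lemma uniqNE s : uniqN s = uniq s.
Proof. by elim: s => //= a s ->; rewrite memNP. Qed.

Section Concrete.
Variables (S : system) (isK : pred nat).
Hypothesis multsP : forall k : N, (k < mult_bound S)%num -> isK (N.to_nat k) = (k \in mults S).
Hypothesis divisor_gt0 : (0 < divisor S)%num.
Hypothesis divisor_lt : forall k, isK k -> N.to_nat (divisor S) < k.

Section Fixed.
Variable n : nat.
Let d := N.to_nat (divisor S).

(* If d does not divide k x then x demands 0, which [above] never contains. *)
Definition succs (x : 'I_n.+1) : {set 'I_n.+1} :=
  [set y : 'I_n.+1 | [exists k : 'I_n.+1,
     [&& isK k, k * x <= n & (y == (if d %| k * x then (k * x) %/ d else 0) :> nat)]]].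

Definition above (v : nat) : {set 'I_n.+1} := [set x : 'I_n.+1 | (v < x) && (d * x <= n)].

Lemma succs_gt (x y : 'I_n.+1) : 0 < x -> x <= y -> x \notin succs y.
Proof.
move=> x0 xy; rewrite inE negb_exists; apply/forallP => k; apply/negP => /and3P[/divisor_lt dk _].
case: ifP => [/dvdnP[q e] /eqP xE|_ /eqP]; last by lia.
have d0 : 0 < d by rewrite /d; lia.
move: xE; rewrite e mulnK // => xE; rewrite -/d in dk.
have : k * x <= k * y by rewrite leq_mul2l xy orbT.
have : d * x < k * x by rewrite ltn_mul2r x0 dk.
by rewrite e -xE [x * d]mulnC; lia.
Qed.

Variables (p : pattern) (u : nat).
Hypothesis p_ok : pattern_ok S p.
Hypothesis u_gt0 : 0 < u.
Hypothesis reach_le : N.to_nat (reach p) * u <= n.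
Variable h : N.
Hypothesis h_exceeds : exceeds S p h.
Hypothesis h_gt : n < N.to_nat h * u.
Hypothesis bound_gt : n < N.to_nat (mult_bound S) * (N.to_nat (base p) * u).

Let f (a : N) : 'I_n.+1 := inord (N.to_nat a * u).

Lemma base_gt0 : 0 < N.to_nat (base p).
Proof. by case/and4P: p_ok => /N.ltb_spec0 ? *; lia. Qed.

Lemma elems_bounds a : a \in elems p ->
  N.to_nat (base p) < N.to_nat a /\ d * N.to_nat a <= N.to_nat (reach p).
Proof.
case/and4P: p_ok => _ _ /allP h1 _ /h1 /andP[/N.ltb_spec0 ? /N.leb_spec0 h2].
by split; [lia | rewrite /d; lia].
Qed.

Lemma closedP a k : a \in base p :: elems p -> k \in mults S ->
  (k * a <= reach p)%num ->
  d %| N.to_nat k * N.to_nat a /\ ((k * a) / divisor S)%num \in elems p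
  /\ N.to_nat ((k * a) / divisor S) * d = N.to_nat k * N.to_nat a.
Proof.
case/and4P: p_ok => _ _ _ /allP h1 /h1 /allP h2 /h2.
case: N.leb_spec0 => // _ /andP[/N.eqb_spec e m] _; rewrite memNP in m.
have := N.div_mod (k * a) (divisor S) ltac:(lia).
rewrite e N.add_0_r => e2.
have e3 : N.to_nat ((k * a) / divisor S) * d = N.to_nat k * N.to_nat a.
  by rewrite /d; move: e2; set q := (_ / _)%num; nia.
by split; first by rewrite -e3 dvdn_mull.
Qed.

Lemma d_gt0 : 0 < d. Proof. by rewrite /d; lia. Qed.

Lemma fE a : a \in elems p -> f a = N.to_nat a * u :> nat.
Proof.
move=> /elems_bounds[_ h2]; rewrite /f inordK // ltnS.
apply: leq_trans reach_le; rewrite leq_mul2r; apply/orP; right.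
by apply: leq_trans h2; rewrite leq_pmull // d_gt0.
Qed.

Lemma f_inj : {in elems p &, injective f}.
Proof.
move=> a b ha hb /(congr1 val) /=; rewrite !fE // => /eqP.
by rewrite eqn_pmul2r // => /eqP; apply: N2Nat.inj.
Qed.

Lemma mem_map_f (F : seq N) a : {subset F <= elems p} -> a \in elems p ->
  (f a \in map f F) = (a \in F).
Proof.
move=> FW aW; apply/mapP/idP => [[b bF e]|aF]; last by exists a.
by rewrite (f_inj aW (FW _ bF) e).
Qed.

(** For [reach] * u <= n < [h] * u the test k * a * u <= n is the test k * a <= [reach], and
    [bound_gt] keeps every k that can occur among the listed multipliers. So multiplication by u
    carries demands to demands. *)
Lemma succs_map (x : 'I_n.+1) a : a \in base p :: elems p -> x = N.to_nat a * u :> nat ->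
  succs x = [set:: map f (ups S (reach p) a)].
Proof.
move=> aW xE; have ba : N.to_nat (base p) <= N.to_nat a.
  by move: aW; rewrite inE => /orP[/eqP -> //|/elems_bounds[/ltnW]].
have hk k : k \in mults S -> (N.to_nat k * x <= n) = (N.leb (k * a) (reach p)).
  move=> kK; rewrite xE; case: N.leb_spec0 => [le|gt].
    apply: leq_trans reach_le; rewrite mulnA leq_mul2r; apply/orP; right; nia.
  move/allP: h_exceeds => /(_ _ aW) /allP /(_ _ kK).
  case: N.leb_spec0 => // _ /= /N.leb_spec0 h2; apply/negbTE; rewrite -ltnNge.
  apply: leq_trans h_gt _; rewrite mulnA leq_mul2r; apply/orP; right; nia.
apply/setP => y; rewrite !inE; apply/existsP/mapP.
  case=> k /and3P[kK kx /eqP yE].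
  have kb : (N.of_nat k < mult_bound S)%num.
    have : k * (N.to_nat a * u) < N.to_nat (mult_bound S) * (N.to_nat a * u).
      rewrite -xE; apply: leq_ltn_trans kx _; apply: leq_trans bound_gt _.
      by rewrite xE leq_mul2l leq_mul2r ba !orbT.
    rewrite ltn_mul2r => /andP[_]; lia.
  have kM : N.of_nat k \in mults S by rewrite -multsP // Nat2N.id.
  have le : N.leb (N.of_nat k * a) (reach p) by rewrite -hk // Nat2N.id.
  have [dv [m e]] := closedP aW kM (elimT (N.leb_spec0 _ _) le).
  exists ((N.of_nat k * a) / divisor S)%num.
    by apply/mapP; exists (N.of_nat k) => //; rewrite mem_filter le.
  apply: val_inj; rewrite /= fE // yE xE.
  rewrite Nat2N.id in dv e; rewrite mulnA dvdn_mulr // -e mulnAC mulnK //; exact: d_gt0.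
case=> b /mapP[k]; rewrite mem_filter => /andP[le kM] -> ->.
have [dv [m e]] := closedP aW kM (elimT (N.leb_spec0 _ _) le).
have kx : N.to_nat k * x <= n by rewrite hk.
have x_gt0 : 0 < x by rewrite xE muln_gt0 u_gt0 andbT (leq_trans base_gt0).
have kn : N.to_nat k < n.+1 by rewrite ltnS; apply: leq_trans kx; rewrite leq_pmulr.
exists (Ordinal kn); rewrite /= kx fE // xE mulnA dvdn_mulr // -e mulnAC mulnK ?d_gt0 // eqxx !andbT.
rewrite multsP //.
have : N.to_nat k * (N.to_nat a * u) < N.to_nat (mult_bound S) * (N.to_nat a * u).
  rewrite -xE; apply: leq_ltn_trans kx _; apply: leq_trans bound_gt _.
  by rewrite xE leq_mul2l leq_mul2r ba !orbT.
rewrite ltn_mul2r => /andP[_]; lia.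
Qed.

Lemma model_upsetE (must : N -> bool) F : {subset F <= elems p} ->
  (forall a, must a -> a \in elems p) ->
  model_upset must (vertices S p) F =
  upset succs [set:: map f F] && all (fun a => must a ==> (a \in F)) (elems p).
Proof.
move=> FW mW; rewrite /model_upset.
have allv (P : vertex -> bool) : all P (vertices S p) =
    all (fun a => P (a, ups S (reach p) a)) (elems p) by rewrite all_map.
rewrite allv; under eq_all => a do rewrite allv /=.
apply/allP/andP => [hall|[/upsetP hu /allP hm] a aW].
  split; last by apply/allP => a /hall /andP[].
  apply/upsetP => x; rewrite inE => /mapP[a aF ->].
  have aW := FW _ aF.
  rewrite (succs_map (a := a)) ?inE ?aW ?orbT ?fE //.
  apply/subsetP => y; rewrite !inE => /mapP[b bU ->].
  have bW : b \in elems p.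
    case/mapP: bU => k; rewrite mem_filter => /andP[/N.leb_spec0 le kM] ->.
    by have [_ []] := @closedP a k ltac:(by rewrite inE aW orbT) kM le.
  rewrite mem_map_f //.
  have /andP[_ /implyP /(_ aF) /allP /(_ b bW) /implyP] := hall a aW.
  by apply; rewrite /implies memNP.
apply/andP; split; first exact: hm.
apply/implyP => aF; apply/allP => b bW; apply/implyP; rewrite /implies memNP /= => bU.
have := hu (f a); rewrite inE map_f // => /(_ isT).
rewrite (succs_map (a := a)) ?inE ?aW ?orbT ?fE // => /subsetP /(_ (f b)).
by rewrite !inE map_f // => /(_ isT); rewrite mem_map_f.
Qed.

(** [upset_ratio] for the element [base] * u and W = u * [elems]: by the correspondence of demands,
    the two numbers of upsets of W are the machine counts [denom] and [numer]. *)
Lemma pattern_ratio : d * (N.to_nat (base p) * u) <= n ->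
  numsub (above (N.to_nat (base p) * u)) (upset succs) *
    (N.to_nat (denom S p) + N.to_nat (numer S p)) <=
  numsub (above (N.to_nat (base p) * u).-1) (upset succs) * N.to_nat (denom S p).
Proof.
move=> vn; set v := N.to_nat (base p) * u.
have v_gt0 : 0 < v by rewrite muln_gt0 base_gt0.
have vlt : v < n.+1 by rewrite ltnS; apply: leq_trans vn; rewrite leq_pmull // d_gt0.
pose x : 'I_n.+1 := Ordinal vlt.
have uW : uniq (elems p) by case/and4P: p_ok => _; rewrite uniqNE.
have aboveE : above v.-1 = x |: above v.
  apply/setP => y; rewrite !inE -val_eqE /=.
  have -> : (v.-1 < y) = (y == v :> nat) || (v < y) by lia.
  by case: eqP => [->|] //=; rewrite -/v in vn; rewrite vn.
pose W := [set:: map f (elems p)].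
have uf : uniq (map f (elems p)) by rewrite map_inj_in_uniq //; exact: f_inj.
have maskW bs : {subset mask bs (elems p) <= elems p} by move=> a; apply: mem_mask.
have sv : size (vertices S p) = size (map f (elems p)) by rewrite !size_map.
have fstv : map fst (vertices S p) = elems p by rewrite -map_comp map_id.
have denE : N.to_nat (denom S p) = numsub W (upset succs).
  rewrite /denom count_upsetsE ?fstv // numsub_bits // sv.
  apply: eq_count => bs; rewrite model_upsetE // -map_mask.
  by rewrite (_ : all _ _ = true) ?andbT //; apply/allP.
have bW : base p \in base p :: elems p by rewrite mem_head.
have succx : succs x = [set:: map f (ups S (reach p) (base p))].
  by apply: succs_map.
have upsW a : a \in ups S (reach p) (base p) -> a \in elems p.
  case/mapP=> k; rewrite mem_filter => /andP[/N.leb_spec0 le kM] ->.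
  by have [_ []] := closedP bW kM le.
have numE : N.to_nat (numer S p) = numsub W (fun G => upset succs G && (succs x \subset G)).
  rewrite /numer count_upsetsE ?fstv // numsub_bits // sv.
  apply: eq_count => bs; rewrite model_upsetE //; last by move=> a; rewrite memNP; apply: upsW.
  rewrite -map_mask; congr (_ && _); rewrite succx.
  apply/allP/subsetP => [h1 y|h1 a aW].
    rewrite !inE => /mapP[a aU ->]; rewrite map_f //.
    by have := h1 a (upsW a aU); rewrite memNP aU.
  rewrite memNP; apply/implyP => aU.
  by have := h1 (f a); rewrite !inE map_f // => /(_ isT); rewrite mem_map_f.
rewrite denE numE aboveE; apply: upset_ratio.
- by rewrite !inE ltnn.
- apply/subsetP => y; rewrite !inE => /mapP[a aW ->].
  have [h1 h2] := elems_bounds aW.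
  rewrite fE // ltn_pmul2r // h1 /= mulnA.
  by apply: leq_trans reach_le; rewrite leq_mul2r h2 orbT.
- by move=> y; rewrite inE => /andP[vy _]; apply: succs_gt => //; apply: ltnW.
- exact: succs_gt.
Qed.
End Fixed.
End Concrete.

Fixpoint range (a : N) (n : nat) : seq N :=
  if n is m.+1 then a :: range (N.succ a) m else [::].

Lemma rangeE a n : range (N.of_nat a) n = [seq N.of_nat v | v <- iota a n].
Proof. by elim: n a => //= n IH a; rewrite -IH Nat2N.inj_succ. Qed.

Lemma mem_range (a n k : N) : (a <= k)%num -> (k < a + n)%num -> k \in range a (N.to_nat n).
Proof.
move=> ak kn; rewrite -[a]N2Nat.id rangeE; apply/mapP; exists (N.to_nat k); last by rewrite N2Nat.id.
by rewrite mem_iota; lia.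
Qed.

Lemma multsP_range S (isK : pred nat) :
  all (fun k => isK (N.to_nat k) == (k \in mults S)) (range 0 (N.to_nat (mult_bound S))) ->
  forall k : N, (k < mult_bound S)%num -> isK (N.to_nat k) = (k \in mults S).
Proof. by move=> /allP h k kb; apply/eqP/h/mem_range; lia. Qed.

Definition num_above (S : system) (isK : pred nat) (n v : nat) : nat :=
  numsub (@above S n v) (upset (@succs S isK n)).

Lemma num_above_gt0 S isK n v : 0 < num_above S isK n v.
Proof.
rewrite card_gt0; apply/set0Pn; exists set0; rewrite inE sub0set.
by apply/upsetP => x; rewrite inE.
Qed.

(** The list is complete below 29, so it describes the demands of every v with n / v < 29; smaller v
    are not credited. *)
Definition prime_system := System 1 [:: 2; 3; 5; 7; 11; 13; 17; 19; 23]%num 29.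

Lemma prime_systemP (k : N) : (k < mult_bound prime_system)%num ->
  prime (N.to_nat k) = (k \in mults prime_system).
Proof.
by move: k; apply: multsP_range; vm_compute.
Qed.

(** * Primitive sets from sets closed under prime multiples *)

Section Primitive.
Variable n : nat.
Let T := 'I_n.+1.
Implicit Types (x y z : T) (F : {set T}).

Definition minimals F : {set T} := [set x in F | [forall y in F, (y %| x) ==> (y == x)]].

Lemma minimal_below F z : F \subset interval1 n -> z \in F ->
  exists2 x, x \in minimals F & x %| z.
Proof.
move=> /subsetP F0; elim/ltn_ind: {z}(z : nat) {-2}z (erefl (z : nat)) => m IH z zm zF.
case mz : (z \in minimals F); first by exists z.
move: mz; rewrite inE zF /= => /negbT; rewrite negb_forall_in => /exists_inP[y yF].
rewrite negb_imply => /andP[yz nyz].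
have z0 : 0 < z by have := F0 z zF; rewrite inE.
have ylt : y < m by rewrite -zm ltn_neqAle dvdn_leq // andbT; exact: nyz.
by have [x xm xy] := IH y ylt y erefl yF; exists x => //; apply: dvdn_trans yz.
Qed.

Lemma minimals_primitive F : primitive (minimals F).
Proof.
apply/forall_inP => x; rewrite inE => /andP[xF _]; apply/forall_inP => y.
rewrite inE => /andP[_ /forall_inP /(_ x xF) /implyP h].
by apply/implyP => xy; apply: contra xy.
Qed.

(** Prime factors of m are applied one at a time; all intermediate products divide m * x and so stay
    at most n. *)
Lemma prime_upset_mul F x m y : F \subset interval1 n ->
  upset (@succs prime_system prime n) F ->
  x \in F -> 0 < m -> y = m * x :> nat -> y \in F.
Proof.
move=> /subsetP F0 /upsetP uF; elim/ltn_ind: m x y => m IH x y xF m0 yE.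
have [m1|m1] := leqP m 1.
  by rewrite (_ : y = x) //; apply: val_inj; rewrite /= yE; nia.
have x0 : 0 < x by have := F0 x xF; rewrite inE.
have pp := pdiv_prime m1; set p := pdiv m in pp; have p2 := prime_gt1 pp.
have mE : m = m %/ p * p by rewrite divnK // pdiv_dvd.
have yn : y <= n by rewrite -ltnS.
have pxn : p * x <= n by apply: leq_trans yn; rewrite yE leq_mul2r dvdn_leq ?orbT // pdiv_dvd.
have pn : p < n.+1 by rewrite ltnS; apply: leq_trans pxn; rewrite leq_pmulr.
pose z : T := inord (p * x).
have zE : z = p * x :> nat by rewrite inordK.
apply: (IH (m %/ p) _ z) => //.
- by rewrite ltn_Pdiv.
- have /subsetP := uF x xF; apply; rewrite inE; apply/existsP.
  by exists (Ordinal pn); rewrite /= pp pxn dvd1n divn1 zE /=.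
- by move: m0; rewrite {1}mE; case: (m %/ p).
- by rewrite yE zE mulnA -mE.
Qed.

(** [minimals] is injective on upsets, since an upset consists of all multiples up to n of its
    minimal elements. *)
Lemma upsets_le_primitive : num_above prime_system prime n 0 <= primitive_count n.
Proof.
rewrite /num_above /numsub /primitive_count.
have sub F : F \subset @above prime_system n 0 -> F \subset interval1 n.
  by move/subset_trans; apply; apply/subsetP => x; rewrite !inE => /andP[].
rewrite -(@card_in_imset _ _ minimals); last first.
  move=> F G; rewrite !inE => /andP[/sub F0 uF] /andP[/sub G0 uG] eFG.
  have key (A B : {set T}) : A \subset interval1 n -> upset (@succs prime_system prime n) B ->
      B \subset interval1 n -> minimals A = minimals B -> A \subset B.
    move=> A0 uB B0 e; apply/subsetP => z zA.
    have [x xm /dvdnP[m zE]] := minimal_below A0 zA.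
    have xB : x \in B by move: xm; rewrite e inE => /andP[].
    have m0 : 0 < m by have := subsetP A0 z zA; rewrite inE zE; case: (m).
    exact: prime_upset_mul uB xB m0 zE.
  by apply/eqP; rewrite eqEsubset (key F G) // (key G F).
apply: subset_leq_card; apply/subsetP => _ /imsetP[F + ->].
rewrite !inE => /andP[/sub F0 _]; rewrite minimals_primitive andbT.
by apply: subset_trans F0; apply/subsetP => x; rewrite inE => /andP[].
Qed.

(** * Primitive sets of maximum size from sets closed under halved multiples *)

Definition halving (k : nat) : bool := (k == 4) || odd k && prime k.
(** The multiplier 4 is doubling, and an odd prime p sends x to p * x / 2. An odd x with p * x <= n
    has no such image and is excluded, by demanding 0. *)
Definition halving_system := System 2 [:: 4; 3; 5; 7; 11; 13; 17; 19; 23]%num 29.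

Lemma halving_systemP (k : N) : (k < mult_bound halving_system)%num ->
  halving (N.to_nat k) = (k \in mults halving_system).
Proof.
by move: k; apply: multsP_range; vm_compute.
Qed.

Section Halving.
Variable F : {set T}.
Hypothesis F_above : F \subset @above halving_system n 0.
Hypothesis uF : upset (@succs halving_system halving n) F.

Definition filled := F :|: [set x : T | n < 2 * x].
Definition tops := [set x in filled | odd x || (inord x./2 \notin filled)].

Lemma F_bounds x : x \in F -> 0 < x /\ 2 * x <= n.
Proof. by move/(subsetP F_above); rewrite inE => /andP[]. Qed.

Lemma filled_gt0 x : x \in filled -> 0 < x.
Proof. by rewrite !inE => /orP[/F_bounds[]|]; lia. Qed.

Lemma filled_double x y : x \in filled -> y = 2 * x :> nat -> y \in filled.
Proof.
rewrite !inE => /orP[xF|h] yE; last by rewrite yE; apply/orP; right; lia.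
have [x0 xn] := F_bounds xF.
have [h|h] := leqP (4 * x) n; last by rewrite yE; apply/orP; right; lia.
apply/orP; left; have /subsetP := elimT (upsetP _ _) uF x xF; apply.
rewrite inE; apply/existsP; have n4 : 4 < n.+1 by lia.
exists (Ordinal n4); rewrite /= h yE.
have -> : 2 %| 4 * x by rewrite dvdn_mulr.
by rewrite (_ : 4 * x = 2 * x * 2) ?mulnK ?eqxx //; lia.
Qed.

Lemma filled_double_iter j x y : x \in filled -> y = 2 ^ j * x :> nat -> y \in filled.
Proof.
elim: j y => [|j IH] y xG yE; first by rewrite (_ : y = x) //; apply: val_inj; rewrite /= yE mul1n.
have yn : y <= n by rewrite -ltnS.
have zn : 2 ^ j * x < n.+1 by rewrite ltnS; apply: leq_trans yn; rewrite yE expnS; nia.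
apply: (@filled_double (Ordinal zn)); first exact: IH.
by rewrite yE expnS mulnA.
Qed.

(** Since p >= 3, the bound p * x <= n puts x at most n / 2, hence in F. If x were odd it would
    demand 0; so x is even and p * x / 2 is demanded. *)
Lemma filled_odd_prime p x : x \in filled -> prime p -> odd p -> p * x <= n ->
  ~~ odd x /\ forall y, 2 * y = p * x -> y \in filled.
Proof.
move=> xG pp op pxn; have p3 : 2 < p by have := prime_gt1 pp; case: p op {pp pxn} => [|[|[]]].
have x0 := filled_gt0 xG.
have xF : x \in F by move: xG; rewrite !inE => /orP[//|]; nia.
have pn : p < n.+1 by rewrite ltnS; apply: leq_trans pxn; rewrite leq_pmulr.
have inR y : y = (if 2 %| p * x then (p * x) %/ 2 else 0) :> nat -> y \in F.
  move=> yE; have /subsetP := elimT (upsetP _ _) uF x xF; apply.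
  rewrite inE; apply/existsP; exists (Ordinal pn).
  by rewrite /halving /= op pp orbT pxn /= -yE eqxx.
split.
  apply/negP => ox; have := inR ord0; rewrite dvdn2 oddM op ox /= => /(_ erefl) /F_bounds[].
  by rewrite ltnn.
move=> y yE; rewrite inE inR // -yE dvdn_mulr // mulKn //.
Qed.

(** One prime p of m at a time: p * x / 2 is filled, hence so is its double p * x, and the induction
    applies to p * x with m / p. *)
Lemma filled_odd m x y : x \in filled -> odd m -> 1 < m -> m * x <= n ->
  ~~ odd x /\ (2 * y = m * x -> y \in filled).
Proof.
elim/ltn_ind: m x => m IH x xG om m1 mxn.
have m0 : 0 < m by apply: ltnW.
have pp := pdiv_prime m1; set p := pdiv m in pp.
have mE : m = m %/ p * p by rewrite divnK // pdiv_dvd.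
have op : odd p by move: om; rewrite {1}mE oddM => /andP[].
have om' : odd (m %/ p) by move: om; rewrite {1}mE oddM => /andP[].
have pxn : p * x <= n by apply: leq_trans mxn; rewrite leq_mul2r dvdn_leq ?orbT // pdiv_dvd.
have [ex hp] := filled_odd_prime xG pp op pxn.
split => // yE.
have [m'1|m'1] := leqP (m %/ p) 1.
  apply: hp; rewrite yE; have : 0 < m %/ p by case: (m %/ p) om'.
  by move=> h; rewrite mE (_ : m %/ p = 1) ?mul1n //; lia.
have hn : p * x./2 < n.+1 by rewrite ltnS; apply: leq_trans pxn; rewrite leq_mul2l; apply/orP; right; lia.
have xE : x = 2 * x./2 :> nat by lia.
have hG : Ordinal hn \in filled by apply: hp; rewrite /= [in RHS]xE; lia.
have zn : p * x < n.+1 by rewrite ltnS.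
have zG : Ordinal zn \in filled by apply: filled_double hG _; rewrite /= [in LHS]xE; lia.
have [] := IH (m %/ p) _ (Ordinal zn) zG om' m'1.
- by rewrite ltn_Pdiv // prime_gt1.
- by rewrite /= mulnA -mE.
by move=> _; apply; rewrite /= mulnA -mE.
Qed.

Lemma tops_filled x : x \in tops -> x \in filled.
Proof. by rewrite inE => /andP[]. Qed.

Lemma tops_half x y : y \in tops -> y = 2 * x :> nat -> x \notin filled.
Proof.
rewrite inE => /andP[_ h] yE; move: h.
rewrite {1}yE mul2n odd_double /= (_ : inord y./2 = x) //.
by apply: val_inj; rewrite /= inordK yE mul2n doubleK // ltn_ord.
Qed.

(** Let y = m * x be a proper multiple, both in [tops], and m = 2 ^ j * m' with m' odd. If m' = 1,
    then y / 2 = 2 ^ (j - 1) * x; otherwise y / 2 = 2 ^ j * (m' * x / 2). In both cases y / 2 is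
    filled, so y is not the least of its chain. *)
Lemma tops_primitive : primitive tops.
Proof.
apply/forall_inP => x xt; apply/forall_inP => y yt; apply/implyP => xy.
apply/negP => /dvdnP[m yE].
have x0 := filled_gt0 (tops_filled xt); have y0 := filled_gt0 (tops_filled yt).
have m0 : 0 < m by case: m yE y0 => // ->.
have m1 : m != 1 by apply: contra xy => /eqP m1; rewrite -val_eqE /= yE m1 mul1n.
have mE : 2 ^ logn 2 m * m`_2^' = m by rewrite -p_part partnC.
have om : odd m`_2^' by rewrite odd_2'nat part_pnat.
have yn : y <= n by rewrite -ltnS.
have [m'1|m'1] := leqP m`_2^' 1.
  have m'E : m`_2^' = 1 by case: (m`_2^') om m'1 => [|[]].
  case j : (logn 2 m) mE => [|j']; rewrite m'E muln1 => mE; first by rewrite -mE in m1.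
  have zn : 2 ^ j' * x < n.+1 by rewrite ltnS; apply: leq_trans yn; rewrite yE -mE expnS; nia.
  have zG : Ordinal zn \in filled by apply: filled_double_iter (tops_filled xt) _.
  have := @tops_half (Ordinal zn) y yt; rewrite zG yE -mE expnS mulnA => /(_ erefl).
  by [].
have m'x : m`_2^' * x <= n by apply: leq_trans yn; rewrite yE -{2}mE; have := expn_gt0 2 (logn 2 m); nia.
have [ex _] := @filled_odd _ x x (tops_filled xt) om m'1 m'x.
have zn : m`_2^' * x./2 < n.+1 by rewrite ltnS; apply: leq_trans m'x; rewrite leq_mul2l; apply/orP; right; lia.
have xE : x = 2 * x./2 :> nat by lia.
have zG : Ordinal zn \in filled.
  by have [_] := @filled_odd _ x (Ordinal zn) (tops_filled xt) om m'1 m'x; apply; rewrite /= [in RHS]xE; lia.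
have yE2 : y = 2 * (2 ^ logn 2 m * (m`_2^' * x./2)) :> nat.
  by rewrite [2 ^ _ * _]mulnA mE yE [in LHS]xE; lia.
have wn : 2 ^ logn 2 m * (m`_2^' * x./2) < n.+1 by lia.
have wG : Ordinal wn \in filled by apply: filled_double_iter zG _.
by have := @tops_half (Ordinal wn) y yt yE2; rewrite wG.
Qed.

Lemma descend x : x \in filled -> exists a j, a \in tops /\ x = 2 ^ j * a :> nat.
Proof.
elim/ltn_ind: {x}(x : nat) {-2}x (erefl (x : nat)) => m IH x xm xG.
case xt : (x \in tops); first by exists x, 0; rewrite mul1n.
move: xt; rewrite inE xG /= => /negbT; rewrite negb_or negbK => /andP[ex hG].
have x0 := filled_gt0 xG.
have hE : (inord x./2 : T) = x./2 :> nat by rewrite inordK //; have := ltn_ord x; lia.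
have [|a [j [at_ e]]] := IH x./2 _ (inord x./2) hE hG; first by rewrite -xm; lia.
by exists a, j.+1; split => //; rewrite expnS -mulnA -e hE; lia.
Qed.

(** The chain of each odd o <= n has a member in (n / 2, n], which is filled; descending from it
    gives a top with odd part o, and there are [uphalf n] such o. *)
Lemma card_tops : uphalf n <= #|tops|.
Proof.
pose g (i : 'I_(uphalf n)) : T := inord i.*2.+1.
have gE i : g i = i.*2.+1 :> nat by rewrite inordK //; have := ltn_ord i; lia.
have ginj : injective g by move=> i j /(congr1 val) /=; rewrite !gE => h; apply: ord_inj; lia.
pose f (x : T) : T := inord x`_2^'.
apply: leq_trans (leq_imset_card f (mem tops)).
rewrite -[leqLHS]card_ord -(card_imset _ ginj); apply/subset_leq_card/subsetP.
move=> _ /imsetP[i _ ->]; set o := g i.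
have oo : odd o by rewrite gE /= odd_double.
have o0 : 0 < o by case: (nat_of_ord o) oo.
have on : o <= n by rewrite -ltnS.
have [j /andP[j1 j2]] : exists j, (2 ^ j * o <= n) && (n < 2 * (2 ^ j * o)).
  exists (trunc_log 2 (n %/ o)).
  have := trunc_log_bounds (isT : 1 < 2) (_ : 0 < n %/ o).
  rewrite divn_gt0 // on => /(_ isT) /andP[h1 h2].
  by rewrite -leq_divRL // h1 mulnA -expnS -ltn_divLR.
have xn : 2 ^ j * o < n.+1 by rewrite ltnS.
have [a [k [at_ e]]] : exists a k, a \in tops /\ Ordinal xn = 2 ^ k * a :> nat.
  by apply: descend; rewrite !inE j2 orbT.
apply/imsetP; exists a => //; apply: val_inj; rewrite /f /= inordK.
  have := congr1 (partn^~ 2^') e; have a0 := filled_gt0 (tops_filled at_).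
  rewrite /= !partnM ?expn_gt0 //.
  have part1 m : (2 ^ m)`_2^' = 1 by apply: part_p'nat; rewrite pnatNK pnatX pnat_id.
  rewrite !part1 !mul1n => <-; rewrite part_pnat_id // -odd_2'nat //.
rewrite ltnS; apply: leq_trans (dvdn_leq _ (dvdn_part _ _)) _; last by rewrite -ltnS.
exact: filled_gt0 (tops_filled at_).
Qed.

Lemma tops_maximum : tops \in [set A in primitive_subsets n | #|A| == max_primitive_size n].
Proof.
have tp : tops \in primitive_subsets n.
  rewrite inE tops_primitive andbT; apply/subsetP => x /tops_filled /filled_gt0.
  by rewrite inE.
rewrite inE tp /= max_primitive_sizeE eqn_leq card_tops andbT.
exact: primitive_card_le.
Qed.

End Halving.

(** Doubling recovers [filled F] from [tops F], and F is the part of [filled F] up to n / 2. *)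
Lemma tops_sub (F G : {set T}) : F \subset @above halving_system n 0 ->
  G \subset @above halving_system n 0 -> upset (@succs halving_system halving n) F ->
  upset (@succs halving_system halving n) G -> tops F = tops G -> F \subset G.
Proof.
move=> F0 G0 uF uG e; apply/subsetP => x xF.
have [a [j [at_ xE]]] : exists a j, a \in tops F /\ x = 2 ^ j * a :> nat.
  by apply: descend => //; rewrite inE xF.
rewrite e in at_.
have : x \in filled G by apply: (filled_double_iter G0 uG (tops_filled at_) xE).
by rewrite !inE => /orP[//|]; have [] := F_bounds F0 xF; lia.
Qed.

Lemma upsets_le_maximum : num_above halving_system halving n 0 <= maximum_primitive_count n.
Proof.
rewrite /num_above /numsub /maximum_primitive_count.
rewrite -(@card_in_imset _ _ tops); last first.
  move=> F G; rewrite !inE => /andP[F0 uF] /andP[G0 uG] e.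
  by apply/eqP; rewrite eqEsubset (tops_sub F0 G0 uF uG e) (tops_sub G0 F0 uG uF (esym e)).
apply: subset_leq_card; apply/subsetP => _ /imsetP[F + ->].
by rewrite inE => /andP[F0 uF]; apply: tops_maximum.
Qed.

End Primitive.

(** * Counting maximal independent sets *)

(** [dlow] exempts the vertex from being dominated, [dtags] marks its live neighbours, and [dkeep]
    cuts the state as in the sweep for upsets. *)
Record dstep := DStep { dlow : bool; dtags : bitseq; dkeep : bitseq }.

Fixpoint hit (ts : bitseq) (k : seq digit) : bool :=
  match ts, k with
  | t :: ts', d :: k' => t && digit_eqb d D1 || hit ts' k'
  | _, _ => false
  end.

Fixpoint settle (ts : bitseq) (k : seq digit) : seq digit :=
  match ts, k with
  | t :: ts', d :: k' => (if t && digit_eqb d D2 then D0 else d) :: settle ts' k'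
  | _, _ => k
  end.

(** A vertex that leaves the state in D2 can no longer be dominated, so the string is rejected. *)
Fixpoint discard (kp : bitseq) (k : seq digit) : option (seq digit) :=
  match kp, k with
  | b :: kp', d :: k' =>
    if b then omap (cons d) (discard kp' k')
    else if digit_eqb d D2 then None else discard kp' k'
  | _, _ => Some [::]
  end.

(* In a state, D1 marks a chosen vertex, D2 one that still has to be dominated. *)
Definition dtrans (st : dstep) (b : bool) (k : seq digit) : option (seq digit) :=
  let h := hit (dtags st) k in
  if b then if h then None else discard (dkeep st) (D1 :: settle (dtags st) k)
  else discard (dkeep st) ((if h || dlow st then D0 else D2) :: k).

Section Dominating.
Variables (adj : rel N) (low : pred N).

Fixpoint dsteps (live : seq (N * nat)) (vs : seq N) : seq dstep :=
  if vs is v :: rest then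
    let live' := (v, last_pos (adj v) rest) :: [seq (u.1, u.2.-1) | u <- live] in
    DStep (low v) [seq adj v u.1 | u <- live] [seq 0 < u.2 | u <- live']
    :: dsteps [seq u <- live' | 0 < u.2] rest
  else [::].

Definition count_dominating (vs : seq N) : N :=
  dp dtrans (dsteps [::] vs) (trie_add [::] 1%num Tip).

Hypothesis adjC : symmetric adj.

Section Run.
Variable bet : pred N.

Definition dominated (all : seq N) (u : N) : bool :=
  [|| bet u, low u | has (fun w => adj u w && bet w) all].

Let dig (done : seq N) (u : N) : digit :=
  if bet u then D1 else if dominated done u then D0 else D2.

Fixpoint free (done vs : seq N) : bool :=
  if vs is v :: rest then
    (bet v ==> ~~ has (fun w => adj v w && bet w) done) && free (v :: done) rest
  else true.

Lemma hitE v done (live : seq (N * nat)) :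
  hit [seq adj v u.1 | u <- live] [seq dig done u.1 | u <- live] =
  has (fun w => adj v w && bet w) (map fst live).
Proof.
elim: live => //= u l ->; congr (_ && _ || _).
by rewrite /dig; case: (bet u.1) => //; case: dominated.
Qed.

Lemma settleE v done (live : seq (N * nat)) : bet v ->
  settle [seq adj v u.1 | u <- live] [seq dig done u.1 | u <- live] =
  [seq dig (v :: done) u.1 | u <- live].
Proof.
move=> bv; elim: live => //= u l ->; congr (_ :: _).
rewrite /dig /dominated /= bv andbT [adj u.1 v]adjC.
by case: (bet u.1); case: (adj v u.1); case: (low u.1); case: (has _ done).
Qed.

Lemma discardE done (live : seq (N * nat)) :
  discard [seq 0 < u.2 | u <- live] [seq dig done u.1 | u <- live] =
  if all (fun u => (u.2 == 0) ==> dominated done u.1) live then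
    Some [seq dig done u.1 | u <- [seq u <- live | 0 < u.2]]
  else None.
Proof.
elim: live => //= u l IH; case: posnP => u0 /=; last first.
  by rewrite IH; case: all.
rewrite IH {1}/dig; case bu : (bet u.1) => /=.
  by rewrite /dominated bu.
by case: dominated.
Qed.

Lemma dominated_unlinked done rest u : ~~ has (adj u) rest ->
  dominated (done ++ rest) u = dominated done u.
Proof.
move=> h; have e : has (fun w => adj u w && bet w) rest = false.
  by apply/negbTE; apply: contra h => /hasP[w wr /andP[uw _]]; apply/hasP; exists w.
by rewrite /dominated has_cat e orbF.
Qed.

Lemma dominated_perm s1 s2 u : s1 =i s2 -> dominated s1 u = dominated s2 u.
Proof. by move=> e; rewrite /dominated (eq_has_r e). Qed.

(** As in [run_csteps], with one more condition: [u.2 <= size vs] makes every live vertex leave the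
    state before the end, and leaving is when domination is checked. *)
Lemma run_dsteps (done : seq N) (live : seq (N * nat)) (vs : seq N) :
  {subset map fst live <= done} ->
  (forall u, u \in live -> [&& bounded u.2 (adj u.1) vs, 0 < u.2 & u.2 <= size vs]) ->
  (forall u, u \in done -> u \notin map fst live -> ~~ has (adj u) vs) ->
  run dtrans (dsteps live vs) [seq dig done u.1 | u <- live] [seq bet v | v <- vs] =
  free done vs && all (dominated (done ++ vs)) (map fst live ++ vs).
Proof.
elim: vs done live => [|v rest IH] done live sub hl hd.
  by case: live hl {sub hd} => // u l /(_ u (mem_head _ _)) /and3P[_]; case: (u.2).
pose live' := (v, last_pos (adj v) rest) :: [seq (u.1, u.2.-1) | u <- live].
have hl' u : u \in live' -> bounded u.2 (adj u.1) rest && (u.2 <= size rest).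
  rewrite /live' in_cons => /orP[/eqP ->|].
    rewrite bounded_last /=; elim: (rest) => //= w r; case: (last_pos _ r) => // _.
    by case: (adj v w).
  by case/mapP=> -[w [|c]] /hl /and3P[] //= hb _ hs ->; rewrite /= hb.
have livE : map fst live' = v :: map fst live by rewrite /= -map_comp; congr (_ :: _); apply: eq_map.
have -> : dsteps live (v :: rest) =
  DStep (low v) [seq adj v u.1 | u <- live] [seq 0 < u.2 | u <- live']
  :: dsteps [seq u <- live' | 0 < u.2] rest by [].
have dtransE b k : dtrans (DStep (low v) [seq adj v u.1 | u <- live] [seq 0 < u.2 | u <- live']) b k =
  if b then if hit [seq adj v u.1 | u <- live] k then None
    else discard [seq 0 < u.2 | u <- live'] (D1 :: settle [seq adj v u.1 | u <- live] k)
  else discard [seq 0 < u.2 | u <- live']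
    ((if hit [seq adj v u.1 | u <- live] k || low v then D0 else D2) :: k) by [].
rewrite map_cons run_consE dtransE hitE.
have hasE : has (fun w => adj v w && bet w) (map fst live) = has (fun w => adj v w && bet w) done.
  apply/hasP/hasP => -[w wl /andP[vw bw]]; exists w; rewrite ?vw ?bw //; first exact: sub.
  apply: contraT => nw; have := hd w wl nw.
  by rewrite /= negb_or adjC vw.
rewrite hasE.
have stateE : ~~ (bet v && has (fun w => adj v w && bet w) done) ->
  (if bet v then D1 :: settle [seq adj v u.1 | u <- live] [seq dig done u.1 | u <- live]
   else (if has (fun w => adj v w && bet w) done || low v then D0 else D2)
        :: [seq dig done u.1 | u <- live]) = [seq dig (v :: done) u.1 | u <- live'].
  move=> hb; rewrite /= -map_comp; case bv : (bet v) hb => /= hb.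
    by rewrite settleE // {2}/dig bv.
  rewrite {2}/dig /dominated /= bv andbF /= orbC; congr (_ :: _).
  by apply: eq_map => u; rewrite /dig /dominated /= bv andbF.
have freeE : free done (v :: rest) =
  (bet v ==> ~~ has (fun w => adj v w && bet w) done) && free (v :: done) rest by [].
rewrite freeE.
case hb : (bet v && has (fun w => adj v w && bet w) done).
  by case/andP: hb => -> ->.
have -> : (bet v ==> ~~ has (fun w => adj v w && bet w) done) by case: (bet v) hb => //= ->.
have {stateE} := stateE (negbT hb).
set cur := (if bet v then _ else _) => curE.
have -> : (if bet v then if has (fun w => adj v w && bet w) done then None
    else discard [seq 0 < u.2 | u <- live']
      (D1 :: settle [seq adj v u.1 | u <- live] [seq dig done u.1 | u <- live])
    else discard [seq 0 < u.2 | u <- live']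
    ((if has (fun w => adj v w && bet w) done || low v then D0 else D2)
      :: [seq dig done u.1 | u <- live])) = discard [seq 0 < u.2 | u <- live'] cur.
  by rewrite /cur; case: (bet v) hb => //= ->.
rewrite curE discardE andTb.
have -> : all (dominated (done ++ v :: rest)) (map fst live ++ v :: rest) =
          all (dominated ((v :: done) ++ rest)) (map fst live' ++ rest).
  rewrite livE (eq_all (a2 := dominated ((v :: done) ++ rest))); last first.
    by move=> u; apply: dominated_perm => w; rewrite !(inE, mem_cat) /= orbCA.
  by rewrite !all_cat /= andbCA andbA.
have allE : all (dominated ((v :: done) ++ rest)) (map fst live') =
    all (fun u => (u.2 == 0) ==> dominated (v :: done) u.1) live' &&
    all (dominated ((v :: done) ++ rest)) (map fst [seq u <- live' | 0 < u.2]).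
  elim: (live') hl' => // u l IHl hu.
  rewrite /= IHl; last by move=> w wl; apply: hu; rewrite inE wl orbT.
  case: posnP => u0 /=; last by rewrite andbCA.
  rewrite andbA; congr (_ && _ && _); apply: (@dominated_unlinked (v :: done)).
  by have := hu u (mem_head _ _); rewrite u0 andbT.
rewrite !all_cat allE.
case: (all (fun u => (u.2 == 0) ==> dominated (v :: done) u.1) live'); last by rewrite /= andbF.
rewrite andTb (IH (v :: done) [seq u <- live' | 0 < u.2]) ?all_cat //.
- move=> w /mapP[u]; rewrite mem_filter => /andP[_ ul] ->.
  have : u.1 \in map fst live' by apply: map_f.
  by rewrite livE !inE => /orP[->//|/sub ->]; rewrite orbT.
- by move=> u; rewrite mem_filter => /andP[-> /hl' /andP[-> ->]].
move=> u ud nu.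
have [ul|ul] := boolP (u \in map fst live').
  have /mapP[w wl uw] := ul.
  have w0 : w.2 = 0.
    apply/eqP; rewrite -leqn0 leqNgt; apply: contra nu => w0.
    by apply/mapP; exists w => //; rewrite mem_filter w0.
  by have /andP[] := hl' w wl; rewrite w0 uw.
move: ul; rewrite livE inE negb_or => /andP[uv ul].
move: ud; rewrite inE (negPf uv) /= => ud.
by have := hd u ud ul; rewrite /= negb_or => /andP[].
Qed.

End Run.

Definition independent (F : seq N) : bool := all (fun u => all (fun w => ~~ adj u w) F) F.

Hypothesis adjI : irreflexive adj.

Lemma count_dominatingE vs : uniq vs ->
  N.to_nat (count_dominating vs) =
  count (fun bs => let F := mask bs vs in
    independent F && all (fun u => [|| u \in F, low u | has (adj u) F]) vs)
  (bits (size vs)).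
Proof.
move=> us; rewrite /count_dominating dp_accepted /accepted.
have -> : size (dsteps [::] vs) = size vs.
  by elim: vs {us} [::] => //= v vs IH live; rewrite IH.
apply: eq_in_count => bs /size_bits sbs /=.
pose bet (a : N) := a \in mask bs vs.
have betE : [seq bet v | v <- vs] = bs by rewrite map_mem_mask.
rewrite -{1}betE (@run_dsteps bet [::] [::]) //=.
congr (_ && _).
  have freeE done s : {subset s <= vs} -> uniq s -> free bet done s =
     all (fun v => bet v ==> ~~ has (fun w => adj v w && bet w) done) s
     && pairwise (fun w v => bet v ==> ~~ (adj v w && bet w)) s.
    elim: s done => //= v s IH done sv /andP[_ us'].
    rewrite IH //; last by move=> w ws; apply: sv; rewrite inE ws orbT.
    have -> : all (fun v0 => bet v0 ==> ~~ (adj v0 v && bet v || has (fun w => adj v0 w && bet w) done)) s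
      = all (fun w => bet w ==> ~~ (adj w v && bet v)) s &&
        all (fun v0 => bet v0 ==> ~~ has (fun w => adj v0 w && bet w) done) s.
      by rewrite -all_predI; apply: eq_all => w /=; rewrite negb_or; case: (bet w).
    by rewrite !andbA; congr (_ && _); rewrite -!andbA; congr (_ && _); rewrite andbC.
  rewrite freeE // [X in X && _](_ : _ = true) ?andTb; last first.
    by apply/allP => v _; rewrite /= implybT.
  have rsym : symmetric (fun w v => bet v ==> ~~ (adj v w && bet w)).
    by move=> a b; rewrite /= adjC; case: (bet a); case: (bet b); case: (adj a b).
  have rrefl : reflexive (fun w v => bet v ==> ~~ (adj v w && bet w)).
    by move=> a; rewrite adjI implybT.
  rewrite pairwise_all2rel //; apply/allrelP/allP => [h u uF|h a b av bv].
    apply/allP => w wF; have := h w u (mem_mask wF) (mem_mask uF).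
    by rewrite /bet uF wF andbT.
  apply/implyP => bb; rewrite negb_and -implybE; apply/implyP => ab.
  apply/negP => ba; have /allP /(_ a ba) := h b bb.
  by rewrite ab.
apply: eq_in_all => u uv; rewrite /dominated /bet; congr [|| _, _ | _].
apply/hasP/hasP => [[w wv /andP[uw wF]]|[w wF uw]]; exists w => //.
  exact: mem_mask wF.
by rewrite uw.
Qed.

End Dominating.

(** * Maximal stable sets: restriction, relaxation, disjoint unions *)

Section Maximal.
Variable T : finType.
Implicit Types (r : rel T) (low : pred T) (A U V X : {set T}).

Definition stable r A : bool := [forall x in A, forall y in A, ~~ r x y].

Definition covered r low U A : bool :=
  [forall x in U, [|| x \in A, low x | [exists y in A, r x y]]].

(** For [low = pred0] these are the maximal stable subsets of [U]; in general low elements may stay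
    outside without a neighbour in the set. *)
Definition maximal_count r low U : nat :=
  numsub U (fun A => stable r A && covered r low U A).

Lemma stableP r A : reflect (forall x y, x \in A -> y \in A -> ~~ r x y) (stable r A).
Proof.
apply: (iffP 'forall_in_forall_inP) => h; first by move=> x y xA yA; apply: h.
by move=> x xA y yA; apply: h.
Qed.

Lemma coveredP r low U A :
  reflect (forall x, x \in U -> x \notin A -> ~~ low x -> exists2 y, y \in A & r x y)
          (covered r low U A).
Proof.
apply: (iffP forall_inP) => h x xU.
  by move=> xA lx; have := h x xU; rewrite (negPf xA) (negPf lx) => /exists_inP.
case xA : (x \in A) => //; case lx : (low x) => //=.
by apply/exists_inP; apply: h; rewrite ?xA ?lx.
Qed.

Lemma leq_numsub V V' (P P' : pred {set T}) (f : {set T} -> {set T}) :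
  (forall A : {set T}, A \subset V -> P A -> f A \subset V' /\ P' (f A)) ->
  (forall A B : {set T}, A \subset V -> P A -> B \subset V -> P B -> f A = f B -> A = B) ->
  numsub V P <= numsub V' P'.
Proof.
move=> h inj; rewrite /numsub -(card_in_imset (f := f)); last first.
  by move=> A B; rewrite !inE => /andP[AV PA] /andP[BV PB]; apply: inj.
apply/subset_leq_card/subsetP => B /imsetP[A]; rewrite inE => /andP[AV PA] ->.
by rewrite inE; have [-> ->] := h A AV PA.
Qed.

Lemma stable_extension r A X : symmetric r -> irreflexive r -> stable r A ->
  exists B : {set T}, [/\ A \subset B, B \subset A :|: X, stable r B & covered r pred0 X B].
Proof.
move=> rC rI sA.
have [B /maxsetP[/andP[sB BX] maxB] AB] := @maxset_exists _
  (fun B : {set T} => stable r B && (B \subset A :|: X)) A (introT andP (conj sA (subsetUl A X))).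
exists B; split => //; apply/coveredP => x xX xB _; apply/exists_inP.
apply: contraT => /exists_inPn h.
have /setP/(_ x) : x |: B = B.
  apply: maxB; last exact: subsetUr.
  apply/andP; split; last by rewrite subUset BX sub1set inE xX orbT.
  apply/stableP => y z /setU1P[->|yB] /setU1P[->|zB]; rewrite ?rI //.
  - exact: h.
  - by rewrite rC; apply: h.
  by move/stableP: sB; apply.
by rewrite setU11 (negPf xB).
Qed.

(** Each maximal stable subset of U is extended to one of V. Extending is injective, since the trace
    on U is the original set: any further element of U has a neighbour there. *)
Lemma maximal_count_mono r U V : symmetric r -> irreflexive r -> U \subset V ->
  maximal_count r pred0 U <= maximal_count r pred0 V.
Proof.
move=> rC rI UV.
pose good (A B : {set T}) := [&& A \subset B, B \subset V, stable r B & covered r pred0 V B].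
pose f (A : {set T}) := odflt A [pick B | good A B].
have fP (A : {set T}) : A \subset U -> stable r A && covered r pred0 U A -> good A (f A).
  move=> AU /andP[sA _]; rewrite /f; case: pickP => //= no.
  have [B [AB BV sB cB]] := stable_extension V rC rI sA.
  have := no B; rewrite /good AB sB cB andbT.
  by rewrite (subset_trans BV) // subUset subxx (subset_trans AU).
have fU (A : {set T}) : A \subset U -> stable r A && covered r pred0 U A -> f A :&: U = A.
  move=> AU sA; have /and4P[/subsetP AB _ /stableP sB _] := fP A AU sA.
  apply/setP => x; rewrite inE; apply/andP/idP => [[xB xU]|xA]; last first.
    by split; [apply: AB | move/subsetP: AU; apply].
  case/andP: sA => _ /coveredP cA; apply: contraT => xA.
  by have [y yA] := cA x xU xA isT; rewrite (negPf (sB x y xB (AB y yA))).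
apply: (leq_numsub (f := f)) => [A AU PA|A B AU PA BU PB e].
  by have /and4P[_ -> -> ->] := fP A AU PA.
by rewrite -(fU A AU PA) e fU.
Qed.

(* Complete a maximal r-stable set by non-low vertices to a maximal r'-stable one: the low part
   is unchanged and determines which of the non-low vertices were added. *)
Lemma maximal_count_relax r r' low V : symmetric r -> symmetric r' -> irreflexive r ->
  subrel r' r ->
  (forall x y, x \in V -> y \in V -> ~~ low x -> ~~ low y -> r x y -> r' x y) ->
  maximal_count r pred0 V <= maximal_count r' low V.
Proof.
move=> rC rC' rI sub high.
pose X := [set x in V | ~~ low x].
have rI' : irreflexive r' by move=> x; apply/negbTE/negP => /sub; rewrite rI.
pose good (A B : {set T}) := [&& A \subset B, B \subset A :|: X, stable r' B & covered r' pred0 X B].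
pose f (A : {set T}) := odflt A [pick B | good A B].
have fP (A : {set T}) : stable r A -> good A (f A).
  move=> sA; rewrite /f; case: pickP => //= no.
  have sA' : stable r' A.
    apply/stableP => x y xA yA; apply/negP => /sub.
    by move/stableP: sA => /(_ x y xA yA) /negPf ->.
  have [B [AB BV sB cB]] := stable_extension X rC' rI' sA'.
  by have := no B; rewrite /good AB BV sB cB.
have lowE (A : {set T}) x : A \subset V -> stable r A -> x \notin X -> (x \in A) = (x \in f A).
  move=> AV sA xX; have /and4P[/subsetP AB /subsetP BA _ _] := fP A sA.
  by apply/idP/idP => [/AB //|/BA]; rewrite inE (negPf xX) orbF.
(* A non-low x of [f A] lies in A exactly when it has no [r]-neighbour among the low elements of
   [f A]: if x is not in A, it has a neighbour in A, and a non-low one would be an [r']-neighbour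
   inside the [r']-stable set [f A]. *)
have highE (A : {set T}) x : A \subset V -> stable r A && covered r pred0 V A -> x \in X ->
    (x \in A) = (x \in f A) && [forall y in f A, (y \notin X) ==> ~~ r x y].
  move=> AV /andP[sA cA] xX; have /and4P[/subsetP AB /subsetP BA sB _] := fP A sA.
  have /andP[xV xl] : (x \in V) && ~~ low x by rewrite inE in xX.
  apply/idP/andP => [xA|[xB /forall_inP h]].
    split; first exact: AB.
    apply/forall_inP => y yB; apply/implyP => yX.
    by apply: (stableP _ _ sA) => //; rewrite (lowE A).
  apply: contraT => xA; move/coveredP: cA => /(_ x xV xA isT) [y yA rxy].
  have := h y (AB y yA); case yX : (y \in X); last by rewrite rxy.
  have yl : ~~ low y by move: yX; rewrite inE => /andP[].
  have := high x y xV (subsetP AV y yA) xl yl rxy.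
  by move/stableP: sB => /(_ x y xB (AB y yA)) /negPf ->.
apply: (leq_numsub (f := f)) => [A AV /andP[sA cA]|A B AV PA BV PB e].
  have /and4P[AB BA -> /coveredP cB] := fP A sA; rewrite andTb; split.
    apply: subset_trans BA _; rewrite subUset AV; apply/subsetP => x; rewrite inE => /andP[//].
  by apply/coveredP => x xV xB xl; apply: cB; rewrite ?inE ?xV.
apply/setP => x; case xX : (x \in X); first by rewrite (highE A) // (highE B) // e.
by rewrite (lowE A) ?(lowE B) ?xX ?e //; [case/andP: PB | case/andP: PA].
Qed.

Lemma numsub_mul U V (P Q R : pred {set T}) : [disjoint U & V] ->
  (forall A B : {set T}, A \subset U -> B \subset V -> R (A :|: B) = P A && Q B) ->
  numsub (U :|: V) R = numsub U P * numsub V Q.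
Proof.
move=> dUV h; rewrite /numsub -cardsX.
rewrite -[RHS](card_in_imset (f := fun p : {set T} * {set T} => p.1 :|: p.2)); last first.
  move=> [A B] [A' B']; rewrite !inE /= => /andP[/andP[AU _] /andP[BV _]].
  case/andP=> /andP[AU' _] /andP[BV' _] e.
  have cut (C D : {set T}) : C \subset U -> D \subset V -> (C :|: D) :&: U = C /\ (C :|: D) :&: V = D.
    move=> CU DV; split; rewrite setIUl.
      rewrite (setIidPl CU) (_ : D :&: U = set0) ?setU0 //; apply/eqP.
      by rewrite setI_eq0 disjoint_sym (disjointWr DV).
    rewrite (setIidPl DV) (_ : C :&: V = set0) ?set0U //; apply/eqP.
    by rewrite setI_eq0 (disjointWl CU).
  have [e1 e2] := cut A B AU BV; have [e3 e4] := cut A' B' AU' BV'.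
  by rewrite e in e1 e2; rewrite -e1 -e2 e3 e4.
apply: eq_card => C; rewrite inE; apply/andP/imsetP => [[CU RC]|[[A B]]].
  have CE : (C :&: U) :|: (C :&: V) = C by rewrite -setIUr; apply/setIidPl.
  exists (C :&: U, C :&: V) => //.
  by rewrite !inE /= !subsetIr -h ?CE ?subsetIr.
rewrite !inE /= => /andP[/andP[AU PA] /andP[BV QB]] ->.
by rewrite setUSS // h // PA QB.
Qed.

Lemma maximal_countU r low U V : symmetric r -> [disjoint U & V] ->
  (forall x y, x \in U -> y \in V -> ~~ r x y) ->
  maximal_count r low (U :|: V) = maximal_count r low U * maximal_count r low V.
Proof.
move=> rC dUV no; apply: numsub_mul => // A B /subsetP AU /subsetP BV.
have noC x y : x \in V -> y \in U -> ~~ r x y by move=> xV yU; rewrite rC no.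
have dx x : x \in U -> x \in V -> False.
  by move=> xU xV; move: dUV; rewrite -setI_eq0 => /eqP/setP/(_ x); rewrite !inE xU xV.
apply/andP/andP => [[/stableP s /coveredP c]|[/andP[/stableP sA /coveredP cA] /andP[/stableP sB /coveredP cB]]].
  split; apply/andP; split.
  - by apply/stableP => x y xA yA; apply: s; rewrite inE ?xA ?yA.
  - apply/coveredP => x xU xA xl; have [|||y] := c x; rewrite ?inE ?xU ?negb_or ?xA //=.
      by apply/negP => /BV; apply: dx.
    by case/orP => [|/BV yV rxy]; [exists y | rewrite (negPf (no x y xU yV)) in rxy].
  - by apply/stableP => x y xA yA; apply: s; rewrite inE ?xA ?yA orbT.
  apply/coveredP => x xV xB xl; have [|||y] := c x; rewrite ?inE ?xV ?orbT ?negb_or ?xB ?andbT //=.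
    by apply/negP => /AU /dx; apply.
  by case/orP => [/AU yU rxy|]; [rewrite (negPf (noC x y xV yU)) in rxy | exists y].
split.
  apply/stableP => x y; rewrite !inE => /orP[xA|xB] /orP[yA|yB]; first exact: sA.
  - by apply: no; [apply: AU | apply: BV].
  - by apply: noC; [apply: BV | apply: AU].
  exact: sB.
apply/coveredP => x; rewrite !inE negb_or => /orP[xU|xV] /andP[xA xB] xl.
  by have [y yA rxy] := cA x xU xA xl; exists y; rewrite ?inE ?yA.
by have [y yB rxy] := cB x xV xB xl; exists y; rewrite ?inE ?yB ?orbT.
Qed.

Lemma eq_maximal_count r r' low low' U : {in U &, r =2 r'} -> {in U, low =1 low'} ->
  maximal_count r low U = maximal_count r' low' U.
Proof.
move=> er el; apply: eq_card => A; rewrite !inE; case AU : (A \subset U) => //=.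
move/subsetP: AU => AU; congr (_ && _).
  apply/stableP/stableP => h x y xA yA; first by rewrite -er ?AU // h.
  by rewrite er ?AU // h.
apply: eq_forallb => x; case xU : (x \in U) => //=; rewrite el //.
congr [|| _, _ | _]; apply: eq_existsb => y; case yA : (y \in A) => //=.
by rewrite er // AU.
Qed.

Lemma maximal_count0 r low : maximal_count r low set0 = 1.
Proof.
rewrite /maximal_count numsubE (eq_bigl (pred1 set0)) ?big_pred1_eq; last first.
  by move=> A; rewrite subset0.
suff -> : stable r set0 && covered r low set0 set0 by [].
by apply/andP; split; [apply/stableP | apply/coveredP] => x; rewrite inE.
Qed.

Lemma maximal_count_gt0 r low U : symmetric r -> irreflexive r -> 0 < maximal_count r low U.
Proof.
move=> rC rI; have s0 : stable r set0 by apply/stableP => x y; rewrite inE.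
have [B [_ BU sB /coveredP cB]] := stable_extension U rC rI s0.
rewrite card_gt0; apply/set0Pn; exists B; rewrite inE sB; rewrite set0U in BU.
by rewrite BU; apply/coveredP => x xU xB _; apply: cB.
Qed.

Lemma maximal_count_le r low U : maximal_count r low U <= 2 ^ #|U|.
Proof.
rewrite -card_powerset; apply/subset_leq_card/subsetP => A.
by rewrite !inE => /andP[].
Qed.

Lemma maximal_count_dominating (adj : rel N) (lowN : pred N) (s : seq N) (f : N -> T) r low :
  uniq s -> {in s &, injective f} -> symmetric adj -> irreflexive adj ->
  (forall a b, a \in s -> b \in s -> r (f a) (f b) = adj a b) ->
  (forall a, a \in s -> low (f a) = lowN a) ->
  maximal_count r low [set:: map f s] = N.to_nat (count_dominating adj lowN s).
Proof.
move=> us fI aC aI er el; rewrite count_dominatingE // /maximal_count numsub_bits; last first.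
  by rewrite map_inj_in_uniq.
rewrite size_map; apply: eq_in_count => bs /size_bits sbs.
have ms a : a \in mask bs s -> a \in s by apply: mem_mask.
have memE a : a \in s -> (f a \in [set:: mask bs (map f s)]) = (a \in mask bs s).
  move=> sa; rewrite inE -map_mask; apply/mapP/idP => [[b bm /fI ->//]|am]; last by exists a.
    exact: ms.
have memI x : x \in [set:: mask bs (map f s)] -> exists2 a, a \in mask bs s & x = f a.
  by rewrite inE -map_mask => /mapP.
congr (_ && _).
  apply/stableP/allP => [h a am|h _ _ /memI[a am ->] /memI[b bm ->]].
    by apply/allP => b bm; rewrite -er ?ms //; apply: h; rewrite memE ?ms.
  by rewrite er ?ms //; have /allP := h a am; apply.
apply/forall_inP/allP => [h a sa|h x].
  have := h (f a); rewrite inE map_f // memE // el // => /(_ isT).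
  case: (a \in mask bs s) => //=; case: (lowN a) => //= /exists_inP[y /memI[b bm ->]].
  by move/ms: (bm) => sb; rewrite er // => ab; apply/hasP; exists b.
rewrite inE => /mapP[a sa ->]; have := h a sa; rewrite memE // el //.
case: (a \in mask bs s) => //=; case: (lowN a) => //= /hasP[b bm ab].
by apply/exists_inP; exists (f b); rewrite ?memE ?er // ms.
Qed.

End Maximal.

(** * Classes of comparable elements *)

Definition rough (M m : nat) : nat := m`_(\pi(M)^').
Definition smooth (M s : nat) : bool := \pi(M).-nat s.

Lemma roughM M a b : 0 < a -> 0 < b -> rough M (a * b) = rough M a * rough M b.
Proof. exact: partnM. Qed.

Lemma rough_smooth M s : smooth M s -> rough M s = 1.
Proof. by move=> h; apply: part_p'nat; rewrite pnatNK. Qed.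

Lemma rough_coprime M b : 0 < M -> 0 < b -> coprime M b -> rough M b = b.
Proof. by move=> M0 b0; rewrite coprime_pi' // => h; apply: part_pnat_id. Qed.

Lemma coprime_rough M m : 0 < M -> coprime M (rough M m).
Proof. by move=> M0; rewrite coprime_pi' ?part_gt0 // part_pnat. Qed.

Lemma rough_gt0 M m : 0 < rough M m.
Proof. exact: part_gt0. Qed.

Lemma smooth_dvd M M' s : 0 < M' -> M %| M' -> smooth M s -> smooth M' s.
Proof. by move=> M0 MM'; apply: sub_in_pnat => p _; apply: pi_of_dvd. Qed.

Lemma smooth_gt0 M s : smooth M s -> 0 < s.
Proof. by case/andP. Qed.

Lemma rough_rough M M' m : 0 < M' -> M %| M' -> 0 < m ->
  rough M' (rough M m) = rough M' m.
Proof.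
move=> M0 MM' m0; rewrite -[in RHS](partnC \pi(M) m0) -/(rough M m) roughM ?part_gt0 //.
rewrite (@rough_smooth M' m`_\pi(M)) ?mul1n //.
by apply: smooth_dvd M0 MM' _; apply: part_pnat.
Qed.

Lemma rough_leq M M' m : 0 < M' -> M %| M' -> 0 < m -> rough M' m <= rough M m.
Proof.
move=> M0 MM' m0; rewrite -(rough_rough M0 MM' m0).
by apply: dvdn_leq; rewrite ?rough_gt0 // dvdn_part.
Qed.

Lemma rough_dvd M m : 0 < m -> exists2 s, smooth M s & m = rough M m * s.
Proof.
move=> m0; exists m`_\pi(M); first exact: part_pnat.
by rewrite mulnC partnC.
Qed.

Definition moduli (i : nat) : nat := nth 1 [:: 30; 6; 2] i.
(** The least prime not dividing the modulus, so that all smaller positive integers are smooth. The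
    default 1 makes no number up to n high on the last level. *)
Definition factor (i : nat) : nat := nth 1 [:: 7; 5; 3] i.

Lemma moduli_gt0 i : 0 < moduli i.
Proof. by case: i => [|[|[|i]]] //; rewrite /moduli nth_default. Qed.

Lemma moduli_dvd i j : j <= i -> moduli i %| moduli j.
Proof.
case: i j => [|[|[|i]]] [|[|[|j]]] //; rewrite /moduli ?[nth _ _ _.+3]nth_default //.
Qed.

Lemma smooth_factor i a : 0 < a -> a < factor i -> smooth (moduli i) a.
Proof.
by case: i => [|[|[|i]]]; rewrite /factor ?[nth _ _ _.+3]nth_default //;
  do 7 (case: a => [|a] //).
Qed.

Lemma to_nat_pow (M : N) k : N.to_nat (M ^ N.of_nat k) = N.to_nat M ^ k.
Proof.
elim: k => [//|k IH].
by rewrite Nat2N.inj_succ N.pow_succ_r' N2Nat.inj_mul IH expnS.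
Qed.

Section Levels.
(* Beyond the thresholds the class of m is coarsened: an element m with n < T5 * rough 30 m sits
   in the class of its 30-rough part, and so on; the remaining elements form the class 0. *)
Variables (n T5 T3 T2 : nat).
Definition threshold (i : nat) : nat := nth 0 [:: T5; T3; T2] i.

Definition lev (m : nat) : nat :=
  if n < T5 * rough 30 m then 0 else
  if n < T3 * rough 6 m then 1 else
  if n < T2 * rough 2 m then 2 else 3.

Definition key (m : nat) : nat := if lev m < 3 then rough (moduli (lev m)) m else 0.
Definition high (m : nat) : bool := n < factor (lev m) * m.

(** Reading off the level of x stops at [lev x], so only the rough parts up to that index matter. *)
Lemma lev_eq x y : (forall j, j < 3 -> j <= lev x -> rough (moduli j) y = rough (moduli j) x) ->
  lev y = lev x.
Proof.
move=> h; rewrite /lev in h *.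
have r0 : rough 30 y = rough 30 x by apply: (h 0).
rewrite r0; move: h; case: (n < T5 * _) => // h.
have r1 : rough 6 y = rough 6 x by apply: (h 1) => //; do ?case: ifP.
rewrite r1; move: h; case: (n < T3 * _) => // h.
have r2 : rough 2 y = rough 2 x by apply: (h 2) => //; case: ifP.
by rewrite r2.
Qed.

Lemma lev_lt m : lev m < 3 -> n < threshold (lev m) * rough (moduli (lev m)) m.
Proof.
rewrite /lev; case: ifP => // h0; case: ifP => // h1; case: ifP => //.
Qed.

Lemma lev_mul b s : 0 < b -> lev b < 3 -> smooth (moduli (lev b)) s -> lev (b * s) = lev b.
Proof.
move=> b0 lb ss; apply: lev_eq => j _ jl.
rewrite roughM ?(smooth_gt0 ss) // (@rough_smooth _ s) ?muln1 //.
exact: smooth_dvd (moduli_gt0 j) (moduli_dvd jl) ss.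
Qed.

Lemma lev_rough x : 0 < x -> lev x < 3 -> lev (rough (moduli (lev x)) x) = lev x.
Proof.
move=> x0 lx; apply: lev_eq => j _ jl.
exact: rough_rough (moduli_gt0 j) (moduli_dvd jl) x0.
Qed.

Lemma keyE b x : 0 < b -> 0 < x -> (key x == b) =
  [&& lev b < 3, coprime (moduli (lev b)) b, b %| x & smooth (moduli (lev b)) (x %/ b)].
Proof.
move=> b0 x0; apply/eqP/and4P => [kb|[lb cb /dvdnP[s xE] ss]].
  have lx : lev x < 3 by move: kb; rewrite /key; case: ifP => // _ b0'; rewrite -b0' in b0.
  have bE : b = rough (moduli (lev x)) x by rewrite -kb /key lx.
  have lE : lev b = lev x by rewrite bE lev_rough.
  have [s ss xE] := rough_dvd (moduli (lev x)) x0.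
  rewrite -bE in xE; rewrite lE; split => //.
  - by rewrite bE coprime_rough // moduli_gt0.
  - by rewrite xE dvdn_mulr.
  by rewrite xE mulKn // -xE.
move: ss x0; rewrite xE mulnK // mulnC => ss x0.
rewrite /key lev_mul // lb roughM ?(smooth_gt0 ss) // (rough_smooth ss) muln1.
by rewrite rough_coprime // moduli_gt0.
Qed.

(** From y = a * x <= n < [factor] * x comes a < [factor], so a is smooth and changes neither the
    level nor the rough part. *)
Lemma high_key x y : 0 < x -> x %| y -> 0 < y <= n -> high x -> key y = key x.
Proof.
move=> x0 /dvdnP[a yE] /andP[y0 yn] hx.
have lx : lev x < 3.
  rewrite ltnNge; apply: contraL hx => lx; rewrite /high /factor nth_default // mul1n -leqNgt.
  by apply: leq_trans yn; rewrite yE leq_pmull //; case: a yE y0 => // ->.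
have a0 : 0 < a by case: a yE y0 => // ->.
have aq : a < factor (lev x).
  by rewrite -(ltn_pmul2r x0) -yE; apply: leq_ltn_trans yn hx.
have sa := smooth_factor a0 aq.
have yx : y = x * a by rewrite yE mulnC.
by rewrite /key yx lev_mul // lx roughM // (rough_smooth sa) muln1.
Qed.

Lemma lev0 b : 0 < b ->
  (lev b == 0) && coprime 30 b = coprime 30 b && (n < T5 * b).
Proof.
move=> b0; rewrite andbC; case cb : (coprime 30 b) => //=.
by rewrite /lev (@rough_coprime 30) //; do ?case: ifP.
Qed.

Lemma rough_drop M p b : 0 < M -> prime p -> coprime M b -> 0 < b ->
  b = rough (p * M) b * b`_p.
Proof.
move=> M0 pp cb b0; have e := rough_coprime M0 b0 cb.
rewrite -{1}(partnC p b0) mulnC; congr (_ * _); rewrite -{1}e /rough -partnI.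
apply: eq_partn => q; rewrite !inE (_ : primes (p * M) =i p :: primes M); last first.
  by move=> q'; rewrite (primesM _ (prime_gt0 pp) M0) (primes_prime pp) !inE.
by rewrite in_cons negb_or andbC.
Qed.

(** For b coprime to 6 only its power of 5 separates b from its 30-rough part, so missing the finest
    classes becomes a condition on the 5-part of b. *)
Lemma lev1 b : 0 < b ->
  (lev b == 1) && coprime 6 b = [&& coprime 6 b, T5 * b <= n * b`_5 & n < T3 * b].
Proof.
move=> b0; rewrite andbC; case cb : (coprime 6 b) => //=.
have -> : (T5 * b <= n * b`_5) = ~~ (n < T5 * rough 30 b).
  by rewrite {1}(@rough_drop 6 5 b) // mulnA leq_pmul2r ?part_gt0 // -leqNgt.
rewrite /lev (@rough_coprime 6) //.
by case: (n < T5 * _); case: (n < T3 * b); case: (n < T2 * _).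
Qed.

(** By T5 <= T3, missing the second threshold implies missing the first, so only the 3-part of b
    matters. *)
Lemma lev2 b : 0 < b -> T5 <= T3 ->
  (lev b == 2) && coprime 2 b = [&& coprime 2 b, T3 * b <= n * b`_3 & n < T2 * b].
Proof.
move=> b0 T53; rewrite andbC; case cb : (coprime 2 b) => //=.
have -> : (T3 * b <= n * b`_3) = ~~ (n < T3 * rough 6 b).
  by rewrite {1}(@rough_drop 2 3 b) // mulnA leq_pmul2r ?part_gt0 // -leqNgt.
have r : T5 * rough 30 b <= T3 * rough 6 b by rewrite leq_mul // rough_leq.
have r53 : n < T5 * rough 30 b -> n < T3 * rough 6 b by move/leq_trans; apply.
rewrite /lev (@rough_coprime 2) //; case: (n < T5 * _) r53 => [->|_] //.
by case: (n < T3 * _); case: (n < T2 * b).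
Qed.

Local Notation T := 'I_n.+1.

Definition comparable (x y : T) : bool := (x != y) && ((x %| y) || (y %| x)).
Definition class_comparable (x y : T) : bool := comparable x y && (key x == key y).
Definition block (b : nat) : {set T} := [set x : T | (0 < x) && (key x == b)].
Definition low (x : T) : bool := ~~ high x.
Definition high_set : {set T} := [set x : T | (0 < x) && high x].

Definition class_lower (b : nat) : nat :=
  maximal_count class_comparable pred0 (high_set :&: block b).
Definition class_upper (b : nat) : nat := maximal_count class_comparable low (block b).

Lemma comparableC : symmetric comparable.
Proof. by move=> x y; rewrite /comparable eq_sym orbC. Qed.
Lemma comparableI : irreflexive comparable.
Proof. by move=> x; rewrite /comparable eqxx. Qed.
Lemma class_comparableC : symmetric class_comparable.
Proof. by move=> x y; rewrite /class_comparable comparableC eq_sym. Qed.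

Lemma class_comparableI : irreflexive class_comparable.
Proof. by move=> x; rewrite /class_comparable comparableI. Qed.

Lemma class_lower_gt0 b : 0 < class_lower b.
Proof. by apply: maximal_count_gt0; [exact: class_comparableC | exact: class_comparableI]. Qed.
Lemma class_upper_gt0 b : 0 < class_upper b.
Proof. by apply: maximal_count_gt0; [exact: class_comparableC | exact: class_comparableI]. Qed.

Lemma high_comparable (x y : T) : 0 < x -> 0 < y -> high x -> high y ->
  comparable x y -> class_comparable x y.
Proof.
move=> x0 y0 hx hy cxy; rewrite /class_comparable cxy /=.
have xn : x <= n by rewrite -ltnS. have yn : y <= n by rewrite -ltnS.
case/andP: cxy => _ /orP[xy|yx]; last by rewrite (high_key y0 yx) // x0.
by rewrite eq_sym (high_key x0 xy) // y0.
Qed.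

Lemma maximal_primitive_countE :
  maximal_primitive_count n = maximal_count comparable pred0 (interval1 n).
Proof.
apply: eq_card => A; rewrite !inE -andbA; case AV : (A \subset interval1 n) => //=.
have stE : primitive A = stable comparable A.
  apply/'forall_in_forall_inP/stableP => [h x y xA yA|h x xA y yA].
    rewrite /comparable; case: (eqVneq x y) => //= xy; have := h x xA y yA; have := h y yA x xA.
    by rewrite eq_sym xy /= => /negPf -> /negPf ->.
  apply/implyP => xy; have := h x y xA yA.
  by rewrite /comparable xy /= negb_or => /andP[].
rewrite stE; case sA : (stable comparable A) => //=.
apply/forall_inP/coveredP => h x; last first.
  rewrite inE => /andP[xA xV]; have [y yA cxy] := h x xV xA isT.
  apply/negP => /'forall_in_forall_inP p; move: cxy; rewrite /comparable.
  case/andP=> xy; have xX := setU11 x A; have yX := setU1r x yA.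
  have := p x xX y yX; have := p y yX x xX; rewrite eq_sym xy /= => /negPf -> /negPf ->.
  by [].
move=> xV xA _; have := h x; rewrite inE xA xV => /(_ isT) np.
apply/exists_inP; apply: contraT => /exists_inPn no; case/negP: np.
apply/'forall_in_forall_inP => y /setU1P[->|yA] z /setU1P[->|zA]; rewrite ?eqxx //.
- by apply/implyP => xz; have := no z zA; rewrite /comparable xz negb_or => /andP[].
- by apply/implyP => xy; have := no y yA; rewrite /comparable eq_sym xy negb_or => /andP[].
apply/implyP => yz; move/stableP: sA => /(_ y z yA zA).
by rewrite /comparable yz negb_or => /andP[].
Qed.

Lemma maximal_count_blocks lw (U : {set T}) : U \subset interval1 n ->
  maximal_count class_comparable lw U =
  \prod_(0 <= b < n.+1) maximal_count class_comparable lw (U :&: block b).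
Proof.
move=> /subsetP UV.
have gen k : maximal_count class_comparable lw [set x in U | key x < k] =
    \prod_(0 <= b < k) maximal_count class_comparable lw (U :&: block b).
  elim: k => [|k IH].
    rewrite big_geq // (_ : [set x in U | _] = set0) ?maximal_count0 //.
    by apply/setP => x; rewrite !inE ltn0 andbF.
  rewrite big_nat_recr //= -IH -maximal_countU; first 1 last.
  - exact: class_comparableC.
  - rewrite -setI_eq0; apply/eqP/setP => x; rewrite !inE; apply/negP => /andP[/andP[_ h]].
    by case/and3P => _ _ /eqP e; rewrite e ltnn in h.
  - move=> x y; rewrite !inE => /andP[_ h] /and3P[_ _ /eqP e].
    by rewrite /class_comparable negb_and e [_ == k]ltn_eqF // orbT.
  congr maximal_count; apply/setP => x; rewrite !inE ltnS leq_eqVlt orbC.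
  case xU : (x \in U) => //=; congr (_ || _).
  by have := UV x xU; rewrite inE => ->.
rewrite -gen; congr maximal_count; apply/setP => x; rewrite !inE.
case xU : (x \in U) => //=; apply/esym; rewrite ltnS.
have := UV x xU; rewrite inE => x0; rewrite /key; case: ifP => // _.
by apply: leq_trans (_ : x <= n); [apply: dvdn_leq; rewrite // dvdn_part | rewrite -ltnS].
Qed.

Lemma maximal_primitive_count_ge :
  \prod_(0 <= b < n.+1) class_lower b <= maximal_primitive_count n.
Proof.
rewrite /class_lower; have HV : high_set \subset interval1 n by apply/subsetP => x; rewrite !inE => /andP[].
rewrite -maximal_count_blocks // maximal_primitive_countE.
apply: leq_trans (maximal_count_mono comparableC comparableI HV).
rewrite leq_eqVlt; apply/orP; left; apply/eqP/eq_maximal_count => // x y.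
rewrite !inE => /andP[x0 hx] /andP[y0 hy]; rewrite /class_comparable.
case cxy : (comparable x y) => //=.
by have := high_comparable x0 y0 hx hy cxy; rewrite /class_comparable cxy.
Qed.

Lemma maximal_primitive_count_le :
  maximal_primitive_count n <= \prod_(0 <= b < n.+1) class_upper b.
Proof.
rewrite maximal_primitive_countE.
apply: leq_trans (@maximal_count_relax _ _ class_comparable low _ comparableC class_comparableC
  comparableI _ _) _.
- by move=> x y /andP[].
- move=> x y; rewrite !inE /low !negbK => x0 y0 hx hy; exact: high_comparable.
rewrite maximal_count_blocks // leq_eqVlt; apply/orP; left; apply/eqP/eq_bigr => b _.
by congr maximal_count; apply/setIidPr/subsetP => x; rewrite !inE => /andP[].
Qed.

Definition divides (a b : N) : bool := N.eqb (N.modulo b a) 0.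
Definition adjacent (a b : N) : bool := ~~ N.eqb a b && (divides a b || divides b a).
(** Here t stands for n / b and q for [factor]: the class of b consists of the b * s with s <= t,
    and b * s is low when q * s <= t. *)
Definition upper_count (q : N) (S : seq N) (t : N) : N :=
  count_dominating adjacent (fun s => N.leb (q * s) t) [seq s <- S | N.leb s t].
Definition lower_count (q : N) (S : seq N) (t : N) : N :=
  count_dominating adjacent (fun _ => false) [seq s <- S | N.leb s t && N.ltb t (q * s)].

Lemma adjacentC : symmetric adjacent.
Proof. by move=> a b; rewrite /adjacent N.eqb_sym orbC. Qed.
Lemma adjacentI : irreflexive adjacent.
Proof. by move=> a; rewrite /adjacent N.eqb_refl. Qed.

Lemma dividesE a b : a != 0%num -> divides a b = (N.to_nat a %| N.to_nat b).
Proof.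
move=> /eqP a0; rewrite /divides; apply/N.eqb_spec/dvdnP => [/N.Lcm0.mod_divide [k ->]|[k e]].
  by exists (N.to_nat k); lia.
by apply/N.Lcm0.mod_divide; exists (N.of_nat k); lia.
Qed.

Section Block.
Variables (b : nat) (lo hi q : N) (S : seq N).
Hypotheses (b_gt0 : 0 < b) (lev_b : lev b < 3) (coprime_b : coprime (moduli (lev b)) b).
Hypothesis qE : N.to_nat q = factor (lev b).
Hypothesis uniqS : uniq S.
Hypothesis memS : forall s : N, 0 < N.to_nat s < threshold (lev b) ->
  (s \in S) = smooth (moduli (lev b)) (N.to_nat s).
Hypothesis posS : 0%num \notin S.
Hypothesis windowS : forall s, s \in S ->
  (N.leb s lo || N.leb hi s) && (N.leb (q * s) lo || N.leb hi (q * s)).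
Hypothesis window_b : N.to_nat lo <= n %/ b < N.to_nat hi.

Let point (s : N) : T := inord (b * N.to_nat s).

Let leq_lo s : s \in S -> N.leb s lo = (b * N.to_nat s <= n).
Proof.
move=> /windowS /andP[h _]; have /andP[h1 h2] := window_b.
rewrite mulnC -leq_divRL //; apply/N.leb_spec0/idP => h3; first by lia.
by case/orP: h => /N.leb_spec0 //; lia.
Qed.

Let low_lo s : s \in S -> N.leb (q * s) lo = (N.to_nat q * (b * N.to_nat s) <= n).
Proof.
move=> /windowS /andP[_ h]; have /andP[h1 h2] := window_b.
rewrite mulnCA mulnC -leq_divRL //.
have -> : N.to_nat q * N.to_nat s = N.to_nat (q * s) by rewrite N2Nat.inj_mul.
apply/N.leb_spec0/idP => h3; first by lia.
by case/orP: h => /N.leb_spec0 //; lia.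
Qed.

Let pos_S s : s \in S -> 0 < N.to_nat s.
Proof. by move=> sS; case: s sS => [|p _]; [rewrite (negPf posS) | lia]. Qed.

Let pointE s : s \in S -> N.leb s lo -> point s = b * N.to_nat s :> nat.
Proof. by move=> sS; rewrite leq_lo // => h; rewrite /point inordK. Qed.

Let smoothS s : s \in S -> N.leb s lo -> smooth (moduli (lev b)) (N.to_nat s).
Proof.
move=> sS sl; rewrite -memS // pos_S //= ; have := lev_lt lev_b.
rewrite rough_coprime ?moduli_gt0 // => h; rewrite -(ltn_pmul2r b_gt0).
by apply: leq_ltn_trans h; rewrite mulnC -leq_lo.
Qed.

Let key_point s : s \in S -> N.leb s lo -> key (point s) = b.
Proof.
move=> sS sl; apply/eqP; rewrite pointE // keyE ?muln_gt0 ?b_gt0 ?pos_S //.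
by rewrite lev_b coprime_b dvdn_mulr // mulKn //; apply: smoothS.
Qed.

Let lev_point s : s \in S -> N.leb s lo -> lev (point s) = lev b.
Proof. by move=> sS sl; rewrite pointE // lev_mul //; apply: smoothS. Qed.

Let low_point s : s \in S -> N.leb s lo -> low (point s) = N.leb (q * s) lo.
Proof.
by move=> sS sl; rewrite /low /high lev_point // pointE // -qE -leqNgt low_lo.
Qed.

Let blockE : block b = [set:: [seq point s | s <- [seq s <- S | N.leb s lo]]].
Proof.
apply/setP => x; rewrite !inE; apply/andP/mapP => [[x0 kx]|[s]]; last first.
  rewrite mem_filter => /andP[sl sS] ->; rewrite key_point // eqxx; split => //.
  by rewrite pointE // muln_gt0 b_gt0 pos_S.
have := kx; rewrite keyE // => /and4P[_ _ /dvdnP[s xE]]; rewrite xE mulnK // => ss.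
have sn : s * b <= n by rewrite -xE -ltnS.
have s0 := smooth_gt0 ss.
have sS : N.of_nat s \in S.
  rewrite memS Nat2N.id // s0 /=; have := lev_lt lev_b.
  by rewrite rough_coprime ?moduli_gt0 // => h; rewrite -(ltn_pmul2r b_gt0); apply: leq_ltn_trans h.
have sl : N.leb (N.of_nat s) lo by rewrite leq_lo // Nat2N.id mulnC.
exists (N.of_nat s); first by rewrite mem_filter sl.
by apply: val_inj; rewrite /= pointE // Nat2N.id mulnC xE.
Qed.

Let point_inj : {in [seq s <- S | N.leb s lo] &, injective point}.
Proof.
move=> s s'; rewrite !mem_filter => /andP[sl sS] /andP[sl' sS'] /(congr1 val) /=.
rewrite !pointE // => /eqP; rewrite eqn_pmul2l // => /eqP; exact: N2Nat.inj.
Qed.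

Let comparable_point s s' : s \in [seq s <- S | N.leb s lo] -> s' \in [seq s <- S | N.leb s lo] ->
  class_comparable (point s) (point s') = adjacent s s'.
Proof.
move=> sF sF'; have pE : (point s == point s') = (s == s') by apply/eqP/eqP => [/point_inj ->|->].
move: sF sF'; rewrite !mem_filter => /andP[sl sS] /andP[sl' sS'].
rewrite /class_comparable !key_point // eqxx andbT /comparable pE !pointE // /adjacent.
have nz u : u \in S -> u != 0%num by move=> uS; apply: contraNneq posS => <-.
by rewrite !dividesE ?nz // !dvdn_pmul2l.
Qed.

(** By [windowS] every s and every q * s is at most [lo] or at least [hi]; replacing n / b by [lo]
    thus changes neither the members of the class nor which of them are low. *)
Lemma block_upper :
  class_upper b = N.to_nat (upper_count q S lo).
Proof.
rewrite /class_upper blockE; apply: maximal_count_dominating adjacentC adjacentI _ _.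
- exact: filter_uniq.
- exact: point_inj.
- exact: comparable_point.
by move=> s; rewrite mem_filter => /andP[sl sS]; apply: low_point.
Qed.

Lemma block_lower :
  class_lower b = N.to_nat (lower_count q S lo).
Proof.
rewrite /class_lower.
have -> : high_set :&: block b =
    [set:: [seq point s | s <- [seq s <- S | N.leb s lo && N.ltb lo (q * s)]]].
  apply/setP => x; rewrite in_setI blockE !inE.
  apply/andP/mapP => [[/andP[x0 hx] /mapP[s]]|[s]].
    rewrite mem_filter => /andP[sl sS] xE; exists s => //; rewrite mem_filter sl sS andbT /=.
    have := low_point sS sl; rewrite /low -xE hx /=.
    by case: N.ltb_spec0 => // h; case: N.leb_spec0 => //; lia.
  rewrite mem_filter => /andP[/andP[sl ql] sS] ->; split; last first.
    by apply: map_f; rewrite mem_filter sl.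
  have := low_point sS sl; rewrite /low pointE // muln_gt0 b_gt0 pos_S //=.
  case: (high _) => //; case: N.leb_spec0 => //.
  by move/N.ltb_spec0: ql; lia.
have sub s : s \in [seq s <- S | N.leb s lo && N.ltb lo (q * s)] -> s \in [seq s <- S | N.leb s lo].
  by rewrite !mem_filter => /andP[/andP[-> _] ->].
apply: maximal_count_dominating adjacentC adjacentI _ _.
- exact: filter_uniq.
- by move=> s s' /sub sF /sub sF'; apply: point_inj.
- by move=> s s' /sub sF /sub sF'; apply: comparable_point.
by [].
Qed.
End Block.

Lemma class_trivial (b : nat) : 0 < b ->
  ~~ ((lev b < 3) && coprime (moduli (lev b)) b) -> class_upper b = 1 /\ class_lower b = 1.
Proof.
move=> b0 h; have b_set0 : block b = set0.
  apply/setP => x; rewrite !inE; apply/negbTE; apply: contra h => /andP[x0].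
  by rewrite keyE // => /and4P[-> ->].
by rewrite /class_upper /class_lower b_set0 setI0 !maximal_count0.
Qed.

Lemma class_lower_tail : class_lower 0 = 1.
Proof.
rewrite /class_lower (_ : _ :&: _ = set0) ?maximal_count0 //; apply/setP => x; rewrite !inE.
apply/negbTE/negP => /andP[/andP[x0 hx] /andP[_]]; rewrite /key; case: ifP => [_|/negbT].
  by rewrite eqn0Ngt rough_gt0.
rewrite -leqNgt => lx; move: hx; rewrite /high /factor nth_default // mul1n ltnNge.
by rewrite -ltnS ltn_ord.
Qed.

End Levels.

(** With k the exponent of p in b, the inequality holds for k >= j because n >= lo * b, and fails
    for k < j because n < hi * b. On a window, a level condition is thus a divisibility. *)
Lemma leq_part_window n b p j Tp lo hi : prime p -> 0 < b ->
  Tp <= p ^ j * lo -> (forall i, j = i.+1 -> p ^ i * hi <= Tp) -> lo <= n %/ b < hi ->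
  (Tp * b <= n * b`_p) = (p ^ j %| b).
Proof.
move=> pp b0 hlo hhi /andP[]; rewrite leq_divRL // ltn_divLR // => nlo nhi.
rewrite pfactor_dvdn // p_part; case: leqP => h; case: (leqP j (logn p b)) => // jb.
  case: j hlo hhi jb => // j _ /(_ j erefl) hhi; rewrite ltnS => jb.
  suff : n * p ^ logn p b < Tp * b by rewrite ltnNge h.
  apply: leq_ltn_trans (_ : n * p ^ j < _); first by rewrite leq_mul2l leq_exp2l ?prime_gt1 // jb orbT.
  apply: leq_trans (_ : hi * b * p ^ j <= _); first by rewrite ltn_pmul2r // expn_gt0 prime_gt0.
  by rewrite mulnAC [hi * _]mulnC leq_mul2r hhi orbT.
suff : Tp * b <= n * p ^ logn p b by rewrite leqNgt h.
apply: leq_trans (_ : p ^ j * lo * b <= _); first by rewrite leq_mul2r hlo orbT.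
by rewrite -mulnA mulnC leq_mul // leq_exp2l ?prime_gt1.
Qed.

(** An s below 2 ^ k has all exponents below k, so smoothness can be tested by one divisibility. *)
Lemma divides_pow (M s : N) k : 0 < N.to_nat M -> 0 < N.to_nat s -> (s < 2 ^ N.of_nat k)%num ->
  divides s (M ^ N.of_nat k) = smooth (N.to_nat M) (N.to_nat s).
Proof.
move=> M0 s0 sk; rewrite dividesE; last by apply/eqP => e; rewrite e in s0.
rewrite to_nat_pow; set m := N.to_nat M in M0 *; set t := N.to_nat s in s0 *.
have tk : t < 2 ^ k by rewrite -(to_nat_pow 2) /t; lia.
apply/idP/idP => h.
  apply/andP; split => //; apply/allP => p; rewrite mem_primes => /and3P[pp _ pt].
  have := dvdn_trans pt h; rewrite Euclid_dvdX // => /andP[pm _].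
  by rewrite !inE mem_primes pp M0.
apply/dvdn_partP => // p; rewrite mem_primes => /and3P[pp _ pt].
have pm : p %| m.
  by case/andP: h => _ /allP /(_ p); rewrite mem_primes pp s0 pt !inE mem_primes => /(_ isT) /and3P[].
rewrite p_part; apply: dvdn_trans (dvdn_exp2r k pm); apply: dvdn_exp2l.
rewrite -ltnS -(ltn_exp2l _ _ (isT : 1 < 2)).
apply: leq_ltn_trans (leq_trans tk _); last by rewrite leq_exp2l.
apply: leq_trans (_ : p ^ logn p t <= _); first by case: (logn p t) => // l; rewrite leq_exp2r ?prime_gt1.
by apply: dvdn_leq; rewrite // pfactor_dvdn.
Qed.

(** Write x = 2 ^ c * w with c the exponent of 2 capped at A. For c = A, w <= n / 2 ^ A is clear;
    for c < A, w is the odd part, which lying in class 0 bounds by n / 2 ^ A. Counting the pairs (c,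
    w) bounds the size of the class, and all its subsets are allowed for. *)
Lemma class_upper_tail n T5 T3 A :
  class_upper n T5 T3 (2 ^ A) 0 <= 2 ^ (A.+1 * (n %/ 2 ^ A).+1).
Proof.
apply: leq_trans (maximal_count_le _ _ _) _; rewrite leq_exp2l //.
set d := n %/ 2 ^ A.
pose cut (x : 'I_n.+1) : nat := minn (logn 2 x) A.
pose f (x : 'I_n.+1) : 'I_A.+1 * 'I_d.+1 := (inord (cut x), inord (x %/ 2 ^ cut x)).
have cutP x : cut x < A.+1 by rewrite ltnS geq_minr.
have fP x : x \in block n T5 T3 (2 ^ A) 0 -> x %/ 2 ^ cut x < d.+1.
  rewrite inE => /andP[x0]; rewrite /key; case: ifP => [_|]; first by rewrite eqn0Ngt rough_gt0.
  rewrite /lev; case: ifP => // _; case: ifP => // _; case: ifP => // /negbT; rewrite -leqNgt => h _ _.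
  rewrite ltnS /cut; case: (leqP A (logn 2 x)) => hA.
    by rewrite /d leq_div2r // -ltnS.
  rewrite /d leq_divRL ?expn_gt0 // mulnC; apply: leq_trans h; rewrite leq_mul2l; apply/orP; right.
  have e := partnC 2 x0; rewrite p_part in e; rewrite -{1}e mulKn ?expn_gt0 //.
  by apply/eq_leq/eq_partn => p; rewrite !inE /=.
have -> : A.+1 * d.+1 = #|{: 'I_A.+1 * 'I_d.+1}| by rewrite card_prod !card_ord.
rewrite -(card_in_imset (f := f)); first exact: max_card.
move=> x y xb yb [/(congr1 val) /= e1 /(congr1 val) /=]; rewrite !inordK ?fP // in e1 *.
move=> e2; apply: val_inj => /=.
have dv (z : 'I_n.+1) : 2 ^ cut z %| z.
  have [->|z0] := posnP z; first exact: dvdn0.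
  by rewrite pfactor_dvdn // geq_minl.
by rewrite -(divnK (dv x)) -(divnK (dv y)) e2 e1.
Qed.

From Stdlib Require Import ZArith Reals Lra.
From Coquelicot Require Import Coquelicot.

(** * Logarithms in fixed-point arithmetic *)

Local Open Scope R_scope.

(** The Taylor polynomial of degree 13 of ln ((1 + z) / (1 - z)). *)
Definition atanh7 (z : R) : R :=
  2 * (z + z^3/3 + z^5/5 + z^7/7 + z^9/9 + z^11/11 + z^13/13).

(** The derivative is the tail of the geometric series of 2 / (1 - x^2), from x^14 on. *)
Lemma atanh7_derive x : -1 < x < 1 ->
  is_derive (fun t => ln (1 + t) - ln (1 - t) - atanh7 t) x (2 * x^14 / (1 - x^2)).
Proof.
move=> hx; rewrite /atanh7; auto_derive; first by repeat split; lra.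
field; repeat split; nra.
Qed.

Lemma atanh7_le z : 0 <= z < 1 -> atanh7 z <= ln ((1 + z) / (1 - z)).
Proof.
move=> hz; rewrite ln_div; try lra.
set f := fun t => ln (1 + t) - ln (1 - t) - atanh7 t.
have f0 : f 0 = 0 by rewrite /f /atanh7 Rplus_0_r Rminus_0_r ln_1; lra.
suff : f 0 <= f z by rewrite f0 /f; lra.
have [z0|z0] := Req_dec z 0; first by rewrite z0; apply: Rle_refl.
have [||c [e hc]] := MVT_cor2 f (fun x => 2 * x^14 / (1 - x^2)) 0 z.
- lra.
- by move=> c hc; apply/is_derive_Reals/atanh7_derive; lra.
suff : 0 <= f z - f 0 by lra.
rewrite e; apply: Rmult_le_pos; last lra.
apply: Rdiv_le_0_compat; last nra.
by apply: Rmult_le_pos; [lra | apply: pow_le; lra].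
Qed.

(* Fixed-point arithmetic with 15 decimals. *)
Definition unit_ : N := 1000000000000000%num.
Global Opaque unit_.
Definition fmul (x y : N) : N := N.div (N.mul x y) unit_.

Definition fatanh (z : N) : N :=
  let w := fmul z z in
  let z3 := fmul z w in let z5 := fmul z3 w in let z7 := fmul z5 w in
  let z9 := fmul z7 w in let z11 := fmul z9 w in let z13 := fmul z11 w in
  N.mul 2 (z + N.div z3 3 + N.div z5 5 + N.div z7 7 + N.div z9 9 + N.div z11 11 + N.div z13 13)%num.

(* Every division rounds down, so this is a lower bound for ln (1 + a / b). *)
Definition fln1p (a b : N) : N := fatanh (N.div (N.mul unit_ a) (2 * b + a)).

Notation NR x := (INR (N.to_nat x)).
Notation SR := (NR unit_).

Lemma NR_add a b : NR (a + b)%num = NR a + NR b.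
Proof. by rewrite N2Nat.inj_add plus_INR. Qed.
Lemma NR_mul a b : NR (a * b)%num = NR a * NR b.
Proof. by rewrite N2Nat.inj_mul mult_INR. Qed.
Lemma NR_pos a : 0 <= NR a.
Proof. exact: pos_INR. Qed.
Lemma NR_gt0 a : (a <> 0)%num -> 0 < NR a.
Proof. by move=> h; apply: lt_0_INR; lia. Qed.
Lemma NR_div a b : NR (a / b)%num * NR b <= NR a.
Proof.
rewrite -NR_mul; apply: le_INR; have [->|b0] := N.eq_dec b 0; first by rewrite N.mul_0_r; lia.
have := N.Div0.mul_div_le a b; rewrite N.mul_comm; lia.
Qed.
Lemma NR_div_le a b : (b <> 0)%num -> NR (a / b)%num <= NR a / NR b.
Proof.
move=> b0; have hb := NR_gt0 b0; apply: (Rmult_le_reg_r (NR b)) => //.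
by rewrite /Rdiv Rmult_assoc Rinv_l ?Rmult_1_r; [exact: NR_div | lra].
Qed.
Lemma SR_gt0 : 0 < SR. Proof. exact: NR_gt0. Qed.

Lemma fmul_le x y a b : NR x <= SR * a -> NR y <= SR * b -> NR (fmul x y) <= SR * (a * b).
Proof.
move=> hx hy; have s0 := SR_gt0; rewrite /fmul.
apply: Rle_trans (NR_div_le _ _) _ => //; rewrite NR_mul.
apply: (Rmult_le_reg_r SR) => //; rewrite /Rdiv Rmult_assoc Rinv_l; last lra.
rewrite Rmult_1_r.
apply: Rle_trans (Rmult_le_compat _ _ _ _ _ _ hx hy) _; try exact: NR_pos.
by apply: Req_le; ring.
Qed.

Lemma fatanh_le z r : NR z <= SR * r -> NR (fatanh z) <= SR * atanh7 r.
Proof.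
move=> hz; rewrite /fatanh; set w := fmul z z; set z3 := fmul z w; set z5 := fmul z3 w.
set z7 := fmul z5 w; set z9 := fmul z7 w; set z11 := fmul z9 w; set z13 := fmul z11 w.
have hw : NR w <= SR * (r * r) by apply: fmul_le.
have h3 : NR z3 <= SR * (r * (r * r)) by apply: fmul_le.
have h5 : NR z5 <= SR * (r * (r * r) * (r * r)) by apply: fmul_le.
have h7 : NR z7 <= SR * (r * (r * r) * (r * r) * (r * r)) by apply: fmul_le.
have h9 : NR z9 <= SR * (r * (r * r) * (r * r) * (r * r) * (r * r)) by apply: fmul_le.
have h11 : NR z11 <= SR * (r * (r * r) * (r * r) * (r * r) * (r * r) * (r * r)) by apply: fmul_le.
have h13 : NR z13 <= SR * (r * (r * r) * (r * r) * (r * r) * (r * r) * (r * r) * (r * r))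
  by apply: fmul_le.
have dv q b x : NR q <= SR * x -> (b <> 0)%num -> NR (q / b)%num <= SR * x / NR b.
  move=> hq b0; apply: Rle_trans (NR_div_le _ b0) _.
  by apply: Rmult_le_compat_r hq; apply/Rlt_le/Rinv_0_lt_compat/NR_gt0.
rewrite NR_mul !NR_add /atanh7.
have e : NR 2 = 2 by rewrite /=; lra.
have := dv _ 3%num _ h3 ltac:(lia); have := dv _ 5%num _ h5 ltac:(lia).
have := dv _ 7%num _ h7 ltac:(lia); have := dv _ 9%num _ h9 ltac:(lia).
have := dv _ 11%num _ h11 ltac:(lia); have := dv _ 13%num _ h13 ltac:(lia).
rewrite e (_ : NR 3 = 3); last by rewrite /=; lra.
rewrite (_ : NR 5 = 5); last by rewrite /=; lra.
rewrite (_ : NR 7 = 7); last by rewrite /=; lra.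
rewrite (_ : NR 9 = 9); last by rewrite /=; lra.
rewrite (_ : NR 11 = 11); last by rewrite /=; lra.
rewrite (_ : NR 13 = 13); last by rewrite /=; lra.
move=> *; have -> : r^3 = r * (r * r) by ring.
have -> : r^5 = r * (r * r) * (r * r) by ring.
have -> : r^7 = r * (r * r) * (r * r) * (r * r) by ring.
have -> : r^9 = r * (r * r) * (r * r) * (r * r) * (r * r) by ring.
have -> : r^11 = r * (r * r) * (r * r) * (r * r) * (r * r) * (r * r) by ring.
have -> : r^13 = r * (r * r) * (r * r) * (r * r) * (r * r) * (r * r) * (r * r) by ring.
lra.
Qed.

Lemma fln1p_le a b : (b <> 0)%num -> NR (fln1p a b) <= SR * ln (1 + NR a / NR b).
Proof.
move=> b0; have hb := NR_gt0 b0; have ha := NR_pos a.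
have h2 : NR (2 * b + a)%num = 2 * NR b + NR a by rewrite NR_add NR_mul; congr (_ * _ + _); rewrite /=; lra.
have hz : 0 <= NR a / (2 * NR b + NR a) < 1.
  split; first by apply: Rdiv_le_0_compat; lra.
  by apply: (Rmult_lt_reg_r (2 * NR b + NR a)); [lra | rewrite /Rdiv Rmult_assoc Rinv_l; lra].
(* With z = a / (2 * b + a), (1 + z) / (1 - z) = 1 + a / b. *)
apply: Rle_trans (fatanh_le (r := NR a / (2 * NR b + NR a)) _) _.
  apply: Rle_trans (NR_div_le _ _) _; first by lia.
  by rewrite NR_mul h2; apply: Req_le; field; lra.
apply: Rmult_le_compat_l; first exact: Rlt_le SR_gt0.
apply: Rle_trans (atanh7_le hz) _; apply: Req_le; congr ln.
by field; lra.
Qed.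

(** * Linear growth rates *)

Local Open Scope nat_scope.
Local Notation iota := seq.iota.

Lemma INR_addn a b : INR (a + b) = (INR a + INR b)%R.
Proof. exact: plus_INR. Qed.
Lemma INR_muln a b : INR (a * b) = (INR a * INR b)%R.
Proof. exact: mult_INR. Qed.
Lemma INR_leq a b : a <= b -> (INR a <= INR b)%R.
Proof. by move/leP; apply: le_INR. Qed.

Section Periodic.
Variables (P : pred nat) (L : nat).
Hypothesis L_gt0 : 0 < L.
Hypothesis periodP : forall v, P (v + L) = P v.
Let c := count P (iota 0 L).
Let cnt m := count P (iota 0 m).

Lemma count_period m : cnt (L + m) = c + cnt m.
Proof.
rewrite /cnt iotaD count_cat add0n; congr (_ + _).
rewrite -[L in iota L m]addn0 iotaDl count_map; apply: eq_count => v.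
by rewrite /= addnC periodP.
Qed.

Lemma count_bounds m : c * m <= L * cnt m + c * L /\ L * cnt m <= c * m + c * L.
Proof.
have [q [r [mE rL]]] : exists q r, m = q * L + r /\ r < L.
  by exists (m %/ L), (m %% L); rewrite -divn_eq ltn_mod.
have cntE : cnt m = q * c + cnt r.
  rewrite mE; elim: (q) => [|k IH]; first by rewrite !mul0n.
  by rewrite mulSn -addnA count_period IH mulSn addnA.
have cr : cnt r <= c by rewrite /c -(subnKC (ltnW rL)) iotaD count_cat leq_addr.
rewrite cntE mE; have := leq_mul (leqnn c) (ltnW rL); have := leq_mul (leqnn L) cr.
by split; nia.
Qed.

Lemma count_window a b n : a <= b -> b <= n ->
  let k := count (fun v => P v && (a < v <= b)) (iota 1 n) in
  c * (b - a) <= L * k + 2 * c * L /\ L * k <= c * (b - a) + 2 * c * L.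
Proof.
move=> ab bn k.
have kE : cnt a.+1 + k = cnt b.+1.
  rewrite /cnt -[b.+1](subnKC (_ : a.+1 <= b.+1)) // iotaD count_cat; congr (_ + _).
  rewrite /k -(subnKC (leq_trans ab bn)) iotaD count_cat.
  rewrite -(subnKC (leq_sub2r a bn)) iotaD count_cat.
  have -> : count (fun v => P v && (a < v <= b)) (iota 1 a) = 0.
    apply/eqP; rewrite -leqn0 leqNgt -has_count; apply/hasPn => v.
    by rewrite mem_iota => h; apply/negP => /andP[_]; lia.
  have -> : count (fun v => P v && (a < v <= b)) (iota (1 + a + (b - a)) (n - a - (b - a))) = 0.
    apply/eqP; rewrite -leqn0 leqNgt -has_count; apply/hasPn => v.
    by rewrite mem_iota => h; apply/negP => /andP[_]; lia.
  rewrite add0n addn0 add1n subSS add0n.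
  by apply: eq_in_count => v; rewrite mem_iota => h; case: (P v) => //=; lia.
have [h1 h2] := count_bounds b.+1; have [h3 h4] := count_bounds a.+1.
by split; nia.
Qed.
End Periodic.

(** A bounded error is allowed, as it disappears in the limit of n-th roots. *)
Definition lower_rate (f : nat -> nat) (s : R) :=
  exists C : R, forall n, (s * INR n - C <= INR (f n))%R.

Lemma lower_rate0 f : lower_rate f 0.
Proof. by exists 0%R => n; have := pos_INR (f n); lra. Qed.

Lemma lower_rateD f g s t : lower_rate f s -> lower_rate g t ->
  lower_rate (fun n => f n + g n) (s + t).
Proof.
move=> [C hC] [D hD]; exists (C + D)%R => n.
by rewrite INR_addn; have := hC n; have := hD n; lra.
Qed.

Lemma eq_lower_rate f g s : f =1 g -> lower_rate f s -> lower_rate g s.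
Proof. by move=> fg [C hC]; exists C => n; rewrite -fg. Qed.

Lemma lower_rate_le f g s t : (forall n, f n <= g n) -> (t <= s)%R ->
  lower_rate f s -> lower_rate g t.
Proof.
move=> fg ts [C hC]; exists C => n; have := hC n; have := INR_leq (fg n).
have := Rmult_le_compat_r _ _ _ (pos_INR n) ts; lra.
Qed.

Definition upper_rate (f : nat -> nat) (s : R) :=
  exists C : R, forall n, (INR (f n) <= s * INR n + C)%R.

Lemma upper_rateD f g s t : upper_rate f s -> upper_rate g t ->
  upper_rate (fun n => f n + g n) (s + t).
Proof.
move=> [C hC] [D hD]; exists (C + D)%R => n.
by rewrite INR_addn; have := hC n; have := hD n; lra.
Qed.

Lemma eq_upper_rate f g s : f =1 g -> upper_rate f s -> upper_rate g s.
Proof. by move=> fg [C hC]; exists C => n; rewrite -fg. Qed.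

Lemma upper_rate_le f g s t : (forall n, g n <= f n) -> (s <= t)%R ->
  upper_rate f s -> upper_rate g t.
Proof.
move=> fg st [C hC]; exists C => n; have := hC n; have := INR_leq (fg n).
have := Rmult_le_compat_r _ _ _ (pos_INR n) st; lra.
Qed.

(* v counts when nD/v lies in [lo, hi). *)
Lemma rate_window (P : pred nat) (L D lo hi : nat) :
  0 < L -> (forall v, P (v + L) = P v) -> D <= lo -> 0 < D -> lo < hi ->
  let f n := count (fun v => P v && (lo * v <= n * D < hi * v)) (iota 1 n) in
  let s := (INR (count P (iota 0 L)) * INR D * INR (hi - lo) / (INR L * INR lo * INR hi))%R in
  lower_rate f s /\ upper_rate f s.
Proof.
move=> L0 perP Dlo D0 lohi f s; set c := count P _ in s *.
have lo0 : 0 < lo by apply: leq_trans Dlo.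
have hi0 : 0 < hi by apply: ltn_trans lohi.
suff h n : (s * INR n - 3 * INR c <= INR (f n) <= s * INR n + 3 * INR c)%R.
  by split; exists (3 * INR c)%R => n; case: (h n).
(* v lies in the window exactly when a < v <= b; [D <= lo] ensures b <= n. *)
pose a := (n * D) %/ hi; pose b := (n * D) %/ lo.
have ab : a <= b by apply: leq_div2l => //; apply: ltnW.
have bn : b <= n by rewrite -(mulnK n D0); apply: leq_trans (leq_div2l _ _ Dlo) _ => //.
have fE : f n = count (fun v => P v && (a < v <= b)) (iota 1 n).
  apply: eq_count => v; congr (_ && _); rewrite /a /b ltn_divLR // leq_divRL //.
  by rewrite andbC [v * hi]mulnC [v * lo]mulnC.
have := count_window L0 perP ab bn; rewrite -/c -fE; move: (f n) => k {fE} [hk hk'].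
have clh : c * lo * hi <= c * L * lo * hi by nia.
have a1 : a * hi <= n * D by apply: leq_trunc_div.
have a2 : n * D < a * hi + hi by rewrite -mulSnr ltn_ceil.
have b1 : b * lo <= n * D by apply: leq_trunc_div.
have b2 : n * D < b * lo + lo by rewrite -mulSnr ltn_ceil.
have h : c * D * n * (hi - lo) <= lo * hi * (L * k) + 3 * c * (L * lo * hi).
  have h3 : (n * D) * (hi - lo) <= lo * hi * (b - a) + lo * hi.
    by clear -a1 b2 ab lohi; nia.
  have := leq_mul (leqnn c) h3; have := leq_mul (leqnn (lo * hi)) hk.
  clear -clh; nia.
have h' : lo * hi * (L * k) <= c * D * n * (hi - lo) + 3 * c * (L * lo * hi).
  have h3 : lo * hi * (b - a) <= (n * D) * (hi - lo) + lo * hi.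
    by clear -a2 b1 ab lohi; nia.
  have := leq_mul (leqnn c) h3; have := leq_mul (leqnn (lo * hi)) hk'.
  clear -clh; nia.
have lR : (0 < INR lo)%R by apply: lt_0_INR; lia.
have hR : (0 < INR hi)%R by apply: lt_0_INR; lia.
have LR : (0 < INR L)%R by apply: lt_0_INR; lia.
have p0 : (0 < INR L * INR lo * INR hi)%R.
  by apply: Rmult_lt_0_compat => //; apply: Rmult_lt_0_compat.
have := INR_leq h; have := INR_leq h'; rewrite !INR_addn !INR_muln.
rewrite (_ : INR 3 = 3%R) => [r' r|]; last by rewrite /=; lra.
have sE : (s * INR n * (INR L * INR lo * INR hi) = INR c * INR D * INR n * INR (hi - lo))%R.
  by rewrite /s; field; lra.
split; apply: (Rmult_le_reg_r (INR L * INR lo * INR hi)) => //.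
  by rewrite Rmult_minus_distr_r sE; lra.
by rewrite Rmult_plus_distr_r sE; lra.
Qed.

(** * Scoring tables of patterns *)

Record info := Info
  { valid : bool; ibase : N; ireach : N; ilimit : N; ilog : N }.

(** The largest h accepted by [exceeds], capped by [mult_bound] * [base]. *)
Definition limit (S : system) (p : pattern) : N :=
  foldr (fun a m => foldr (fun k m => let c := N.mul k a in
    if N.leb c (reach p) then m else N.min c m) m (mults S))
    (N.mul (mult_bound S) (base p)) (base p :: elems p).

Definition analyse (S : system) (p : pattern) : info :=
  let h := limit S p in
  let dn := denom S p in
  Info [&& pattern_ok S p, exceeds S p h, N.leb (N.mul (divisor S) (base p)) (reach p)
        & ~~ N.eqb dn 0]
       (base p) (reach p) h (fln1p (numer S p) dn).

Fixpoint closure (S : system) (X : N) (fuel : nat) (todo done : seq N) : seq N :=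
  match fuel, todo with
  | f.+1, a :: rest => if memN a done then closure S X f rest done
                       else closure S X f (ups S X a ++ rest) (a :: done)
  | _, _ => done
  end.

Fixpoint valuation (fuel : nat) (p a : N) : N :=
  if fuel is f.+1 then
    if N.eqb (N.modulo a p) 0 then N.succ (valuation f p (N.div a p)) else N0
  else N0.

(* Sweeping the elements by increasing exponents, large primes first, keeps the number of
   automaton states small. *)
Definition sweep_key (a : N) : N :=
  foldl (fun k p => N.add (N.mul 16 k) (valuation 12 p a)) N0 [:: 23; 19; 17; 13; 11; 7; 5; 2; 3]%num.

Definition arrange (s : seq N) : seq N :=
  map snd (sort (fun x y => N.leb x.1 y.1) [seq (sweep_key a, a) | a <- s]).

(** 3000 is mere fuel. Nothing is proved about the search: a list that is not closed is rejected by
    [pattern_ok]. *)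
Definition grow (S : system) (x : N * N * seq N) : pattern :=
  Pattern x.1.1 x.1.2 (arrange (closure S x.1.2 3000 (ups S x.1.2 x.1.1 ++ x.2) [::])).

(* A level deals with the v whose quotient n / v has integral part [floor]; a seed
   (base, reach, generators) describes the smallest pattern containing the generators. *)
Record level := Level { floor : N; modulus : N; denominator : N; seeds : seq (N * N * seq N) }.

Definition patterns (S : system) (lv : level) : seq pattern := map (grow S) (seeds lv).

(** The hypotheses of [pattern_ratio] for all v with gcd g and lo <= D * n / v < hi, where D is the
    denominator. The two tests on [floor] make the levels disjoint in v. *)
Definition applies (S : system) (lv : level) (g : N) (q : info) (lo hi : N) : bool :=
  [&& valid q, N.eqb (N.modulo g (ibase q)) 0,
      N.leb (N.mul (ireach q) (denominator lv)) (N.mul (ibase q) lo),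
      N.leb (N.mul (ibase q) hi) (N.mul (ilimit q) (denominator lv)),
      N.leb (N.mul (floor lv) (denominator lv)) lo,
      N.leb hi (N.mul (N.succ (floor lv)) (denominator lv))
    & N.leb hi (N.mul (mult_bound S) (denominator lv))].

Definition residues (L : N) : seq N := [seq N.gcd r L | r <- range 0 (N.to_nat L)].

(* Of the patterns usable for gcd (v, modulus) = g, pick the best on each range of n / v:
   (hi, i) means pattern i up to denominator * n / v = hi. *)
Definition plan (S : system) (lv : level) (infos : seq info) (g : N) : seq (N * nat) :=
  let lo0 := N.mul (floor lv) (denominator lv) in
  let hi0 := N.mul (N.min (N.succ (floor lv)) (mult_bound S)) (denominator lv) in
  let cands := [seq (N.max lo0 (N.div (ireach x.1 * denominator lv + ibase x.1 - 1) (ibase x.1)),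
                     N.min hi0 (N.div (ilimit x.1 * denominator lv) (ibase x.1)), ilog x.1, x.2)
               | x <- zip infos (iota 0 (size infos)) & N.eqb (N.modulo g (ibase x.1)) 0] in
  let pts := sort N.leb (undup (flatten [seq [:: x.1.1.1; x.1.1.2] | x <- cands])) in
  let best lo hi := foldr (fun x acc =>
    if N.leb x.1.1.1 lo && N.leb hi x.1.1.2 && N.ltb acc.1 x.1.2 then (x.1.2, x.2) else acc)
    (N0, size infos) cands in
  if pts is lo :: his then
    (lo, size infos) :: pairmap (fun lo hi => (hi, (best lo hi).2)) lo his
  else [::].

(** A plan opens with a segment without pattern that ends at its first breakpoint. Starting one
    below [floor] * [denominator] allows that breakpoint to be [floor] * [denominator] itself, since
    the scan stops at an empty segment. *)
Definition cells (S : system) (lv : level) (infos : seq info) : seq (N * N * seq (N * nat)) :=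
  [seq (g, N.pred (N.mul (floor lv) (denominator lv)), plan S lv infos g)
  | g <- undup (residues (modulus lv))].

(** Per unit of n there are on average D * (1 / lo - 1 / hi) numbers v with lo <= n * D / v < hi,
    and a share c / [modulus] of them has gcd g; [ilog] is the gain of each. The division rounds
    down. *)
Fixpoint scan_score (S : system) (lv : level) (infos : seq info) (g c lo : N)
    (segs : seq (N * nat)) : N :=
  if segs is (hi, i) :: segs' then
    if N.ltb lo hi then
      let rest := scan_score S lv infos g c hi segs' in
      if onth infos i is Some q then
        if applies S lv g q lo hi then
          N.add (N.div (ilog q * c * denominator lv * (hi - lo)) (modulus lv * lo * hi)) rest
        else rest
      else rest
    else N0
  else N0.

Definition level_score (S : system) (lv : level) : N :=
  let infos := map (analyse S) (patterns S lv) in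
  let cl := cells S lv infos in
  if N.leb 1 (floor lv) && N.leb 1 (modulus lv) && uniqN [seq x.1.1 | x <- cl] then
    let rs := residues (modulus lv) in
    foldr (fun x acc => N.add (scan_score S lv infos x.1.1
      (foldr (fun r k => if N.eqb r x.1.1 then N.succ k else k) N0 rs) x.1.2 x.2) acc)
      N0 cl
  else N0.

(** Used to see that v is credited at most once: only the cell of its gcd, and only the level of its
    n / v, can give a nonzero term. *)
Lemma uniq_sum (I : Type) (K : eqType) (s : seq I) (key : I -> K) (val : I -> nat) k0 :
  uniq (map key s) -> (forall x, val x != 0 -> key x = k0) ->
  \sum_(x <- s) val x = 0 \/ exists x, \sum_(x <- s) val x = val x.
Proof.
move=> us h; elim: s us => [|x s IH] /=; first by left; rewrite big_nil.
case/andP=> xs us; rewrite big_cons.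
have [v0|v0] := eqVneq (val x) 0.
  by rewrite v0 add0n; case: IH => // [->|[y ->]]; [left | right; exists y].
right; exists x; rewrite (_ : \sum_(y <- s) val y = 0) ?addn0 //.
have kx := h x v0; elim: s xs {us IH} => [|y s IH] /=; first by rewrite big_nil.
rewrite inE negb_or big_cons => /andP[xy xs]; rewrite IH // addn0.
by apply/eqP; apply: contraT => /h ky; rewrite kx ky eqxx in xy.
Qed.

Section Rate.
Variables (S : system) (isK : pred nat).
Hypothesis multsP : forall k : N, (k < mult_bound S)%num -> isK (N.to_nat k) = (k \in mults S).
Hypothesis divisor_gt0 : (0 < divisor S)%num.
Hypothesis divisor_lt : forall k, isK k -> N.to_nat (divisor S) < k.

Local Notation num_above := (num_above S isK).

Section Level.
Variable lv : level.
Let infos := map (analyse S) (patterns S lv).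
Let cl := cells S lv infos.
Let D := N.to_nat (denominator lv).
Let L := N.to_nat (modulus lv).

Fixpoint scan_active (g lo : N) (segs : seq (N * nat)) (n v : nat) : nat :=
  if segs is (hi, i) :: segs' then
    if N.ltb lo hi then
      let rest := scan_active g hi segs' n v in
      if onth infos i is Some q then
        if applies S lv g q lo hi then
          (N.to_nat lo * v <= n * D < N.to_nat hi * v) * N.to_nat (ilog q) + rest
        else rest
      else rest
    else 0
  else 0.

Definition residue (v : nat) : N := N.gcd (N.of_nat v) (modulus lv).

Definition level_active (n v : nat) : nat :=
  \sum_(x <- cl) (residue v == x.1.1) * scan_active x.1.1 x.1.2 x.2 n v.

(** The segments follow each other, so at most one of them contains v; the lower end [lo <= a] is
    carried along to prove it. *)
Lemma scan_activeP g lo segs n v :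
  scan_active g lo segs n v = 0 \/
  exists p a b, [/\ applies S lv g (analyse S p) a b,
    N.to_nat a * v <= n * D < N.to_nat b * v, (lo <= a)%num
    & scan_active g lo segs n v = N.to_nat (ilog (analyse S p))].
Proof.
elim: segs lo => [|[hi i] segs IH] lo /=; first by left.
case: N.ltb_spec0 => [lh|_]; last by left.
have later : scan_active g hi segs n v = 0 \/
  exists p a b, [/\ applies S lv g (analyse S p) a b,
    N.to_nat a * v <= n * D < N.to_nat b * v, (lo <= a)%num
    & scan_active g hi segs n v = N.to_nat (ilog (analyse S p))].
  case: (IH hi) => [|[p [a [b [h1 h2 h3 h4]]]]]; first by left.
  by right; exists p, a, b; split => //; lia.
rewrite /infos onth_map; case: (onth _ i) => [p|] //=.
case ap : (applies _ _ _ _ _ _) => //.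
case hin : (_ && _); last by rewrite mul0n add0n.
rewrite mul1n; right; exists p, lo, hi; split => //; last first.
  case: (IH hi) => [->|[q' [a [b [_ /andP[h3 _] h4 _]]]]]; first by rewrite addn0.
  case/andP: hin => _; rewrite ltnNge => /negP []; apply: leq_trans h3.
  by rewrite leq_mul2r; apply/orP; right; lia.
exact: N.le_refl.
Qed.

(** [base] divides g = gcd (v, [modulus]), so v = [base] * u, and [pattern_ratio] bounds the growth
    of the count when v is added; [fln1p_le] turns this into logarithms. *)
Lemma appliesP g p a b n v : applies S lv g (analyse S p) a b -> residue v = g ->
  N.to_nat a * v <= n * D < N.to_nat b * v ->
  n %/ v = N.to_nat (floor lv) /\
  (NR (ilog (analyse S p)) <= SR * (ln (INR (num_above n v.-1)) - ln (INR (num_above n v))))%R.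
Proof.
case/and5P => /= /and4P[p_ok p_lim /N.leb_spec0 p_dv /N.eqb_spec p_den].
move=> /N.eqb_spec p_g /N.leb_spec0 p_a /N.leb_spec0 p_b.
case/and3P => /N.leb_spec0 fa /N.leb_spec0 fb /N.leb_spec0 bb rv /andP[h1 h2].
have v0 : 0 < v by case: v h2 {h1 rv} => //; rewrite muln0.
have D0 : 0 < D.
  rewrite lt0n; apply/eqP => D0; move: h2; rewrite D0 muln0.
  have : N.to_nat b <= 0 by rewrite /D in D0; nia.
  by case: (N.to_nat b).
split.
  have ha : N.to_nat (floor lv) * D <= N.to_nat a by rewrite /D; lia.
  have hb : N.to_nat b <= (N.to_nat (floor lv)).+1 * D by rewrite /D; lia.
  have e1 : N.to_nat (floor lv) * v <= n.
    rewrite -(leq_pmul2r D0); apply: leq_trans h1.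
    by rewrite mulnAC leq_mul2r ha orbT.
  have e2 : n < (N.to_nat (floor lv)).+1 * v.
    rewrite -(ltn_pmul2r D0); apply: leq_trans h2 _.
    by rewrite mulnAC leq_mul2r hb orbT.
  apply/eqP; rewrite eqn_leq -ltnS ltn_divLR // e2 leq_divRL //.
have B0 : 0 < N.to_nat (base p) by case/and4P: p_ok => /N.ltb_spec0 ? *; lia.
have [u vE] : exists u, v = N.to_nat (base p) * u.
  have : (base p | N.of_nat v)%num.
    apply: N.divide_trans (N.gcd_divide_l _ (modulus lv)).
    rewrite -/(residue v) rv; apply/N.Lcm0.mod_divide; lia.
  by case=> q e; exists (N.to_nat q); lia.
have u0 : 0 < u by case: u vE v0 => // ->; rewrite muln0.
have k1 : N.to_nat (reach p) * u <= n.
  rewrite -(leq_pmul2r D0); apply: leq_trans h1; rewrite vE mulnA [_ * u * D]mulnAC leq_mul2r.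
  apply/orP; right; rewrite /D; lia.
have k2 : n < N.to_nat (limit S p) * u.
  rewrite -(ltn_pmul2r D0); apply: leq_trans h2 _; rewrite vE mulnA [_ * u * D]mulnAC leq_mul2r.
  apply/orP; right; rewrite /D; lia.
have k3 : n < N.to_nat (mult_bound S) * (N.to_nat (base p) * u).
  rewrite -vE -(ltn_pmul2r D0) mulnAC; apply: leq_trans h2 _; rewrite leq_mul2r.
  apply/orP; right; rewrite /D; lia.
have k4 : N.to_nat (divisor S) * (N.to_nat (base p) * u) <= n.
  by apply: leq_trans k1; rewrite mulnA leq_mul2r; apply/orP; right; lia.
have := pattern_ratio multsP divisor_gt0 divisor_lt p_ok u0 k1 p_lim k2 k3 k4.
rewrite -vE -/(num_above n v) -/(num_above n v.-1) => hr.
have na0 w : (0 < INR (num_above n w))%R.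
  exact/lt_0_INR/ltP/num_above_gt0.
have dn0 : (0 < NR (denom S p))%R by apply: NR_gt0.
have nm0 : (0 <= NR (numer S p))%R by apply: NR_pos.
apply: Rle_trans (fln1p_le _ p_den) _; apply: Rmult_le_compat_l; first exact: Rlt_le SR_gt0.
rewrite -ln_div //; apply: ln_le.
  have := Rdiv_le_0_compat _ _ nm0 dn0; lra.
apply: (Rmult_le_reg_r (INR (num_above n v) * NR (denom S p))); first exact: Rmult_lt_0_compat.
have := INR_leq hr; rewrite !INR_muln INR_addn => hR.
have -> : (INR (num_above n v.-1) / INR (num_above n v) * (INR (num_above n v) * NR (denom S p)) =
          INR (num_above n v.-1) * NR (denom S p))%R by field; have := na0 v; lra.
apply: Rle_trans hR; apply: Req_le; field; lra.
Qed.

Hypothesis lv_ok : uniqN [seq x.1.1 | x <- cl].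

Lemma level_activeP n v : level_active n v = 0 \/
  n %/ v = N.to_nat (floor lv) /\
  (INR (level_active n v) <= SR * (ln (INR (num_above n v.-1)) - ln (INR (num_above n v))))%R.
Proof.
rewrite /level_active.
have [||->|[x ->]] := @uniq_sum _ _ (cl) (fun x => x.1.1)
  (fun x => (residue v == x.1.1) * scan_active x.1.1 x.1.2 x.2 n v) (residue v).
- by rewrite -uniqNE; exact: lv_ok.
- by move=> x; case: (residue v =P x.1.1) => [->|].
- by left.
case: (residue v =P x.1.1) => [rx|_]; last by left.
rewrite mul1n; case: (scan_activeP x.1.1 x.1.2 x.2 n v) => [->|[p [a [b [ap hin _ ->]]]]]; first by left.
by right; apply: appliesP ap rx hin.
Qed.

Lemma residues_count g :
  foldr (fun r k => if N.eqb r g then N.succ k else k) N0 (residues (modulus lv)) =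
  N.of_nat (count (fun v => residue v == g) (iota 0 L)).
Proof.
rewrite /residues -/L.
rewrite (rangeE 0) -map_comp; elim: (iota 0 L) => //= v s ->; rewrite -/(residue v).
by case: eqP => [->|h]; [rewrite N.eqb_refl; lia | case: N.eqb_spec].
Qed.

Lemma residue_period g v : (residue (v + L) == g) = (residue v == g).
Proof.
congr (_ == _); rewrite /residue /L Nat2N.inj_add N2Nat.id N.gcd_comm [RHS]N.gcd_comm.
exact: N.gcd_add_diag_r.
Qed.

Lemma lower_rate_scan g lo segs : 0 < L -> 0 < N.to_nat (floor lv) ->
  lower_rate (fun n => \sum_(1 <= v < n.+1) (residue v == g) * scan_active g lo segs n v)
    (NR (scan_score S lv infos g (N.of_nat (count (fun v => residue v == g) (iota 0 L))) lo segs)).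
Proof.
move=> L0 F0; set c := count _ _.
elim: segs lo => [|[hi i] segs IH] lo /=; first exact: lower_rate0.
case: N.ltb_spec0 => [lh|_]; last exact: lower_rate0.
case: (onth infos i) => [q|]; last exact: IH.
case ap : (applies _ _ _ _ _ _); last exact: IH.
case/and5P: ap => _ _ _ _ /and3P[/N.leb_spec0 fa /N.leb_spec0 fb _].
have D0 : 0 < D by rewrite /D; nia.
have Dlo : D <= N.to_nat lo by rewrite /D; nia.
have [+ _] := @rate_window (fun v => residue v == g) L D (N.to_nat lo) (N.to_nat hi)
  L0 (residue_period g) Dlo D0 ltac:(lia).
rewrite -/c => - [C hC]; rewrite NR_add.
apply: (eq_lower_rate (f := fun n =>
  count (fun v => (residue v == g) && (N.to_nat lo * v <= n * D < N.to_nat hi * v)) (iota 1 n)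
   * N.to_nat (ilog q) + \sum_(1 <= v < n.+1) (residue v == g) * scan_active g hi segs n v)).
  move=> n; rewrite -sum1_count big_mkcond /index_iota subSS subn0 big_distrl /= -big_split /=.
  by apply: eq_bigr => v _; case: (residue v == g); rewrite /= ?mul0n ?mul1n //; case: (_ && _).
apply: lower_rateD (IH hi).
exists (C * NR (ilog q))%R => n; rewrite INR_muln.
have lo0 : (0 < NR lo)%R by apply: NR_gt0 => e; move: Dlo D0; rewrite e; lia.
have hi0 : (0 < NR hi)%R by apply: NR_gt0; lia.
have L1 : (0 < NR (modulus lv))%R by apply: NR_gt0 => e; move: L0; rewrite /L e.
have q0 := NR_pos (ilog q).
set s := NR (_ / _).
have hs : (s <= NR (ilog q) * (INR c * INR D * INR (N.to_nat hi - N.to_nat lo) /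
              (INR L * NR lo * NR hi)))%R.
  apply: Rle_trans (NR_div_le _ _) _.
    apply/N.neq_mul_0; split; [apply/N.neq_mul_0; split|] => e; move: L1 lo0 hi0;
    by rewrite e /=; lra.
  have e : NR (hi - lo)%num = INR (N.to_nat hi - N.to_nat lo) by rewrite N2Nat.inj_sub.
  by rewrite !NR_mul Nat2N.id e; apply: Req_le; rewrite /D /L; field; lra.
have := Rmult_le_compat_l _ _ _ q0 (hC n); have := Rmult_le_compat_r _ _ _ (pos_INR n) hs; lra.
Qed.

Lemma lower_rate_level : 0 < L -> 0 < N.to_nat (floor lv) ->
  lower_rate (fun n => \sum_(1 <= v < n.+1) level_active n v) (NR (level_score S lv)).
Proof.
move=> L0 F0; rewrite /level_score.
have -> : N.leb 1 (floor lv) by apply/N.leb_spec0; lia.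
have -> : N.leb 1 (modulus lv) by apply/N.leb_spec0; rewrite /L in L0; lia.
rewrite -/infos -/cl lv_ok.
apply: (eq_lower_rate (f := fun n =>
  \sum_(x <- cl) \sum_(1 <= v < n.+1) (residue v == x.1.1) * scan_active x.1.1 x.1.2 x.2 n v)).
  by move=> n; rewrite exchange_big.
elim: (cl) => [|x s IH] /=.
  by apply: eq_lower_rate (lower_rate0 (fun _ => 0)) => n; rewrite big_nil.
rewrite NR_add residues_count.
apply: eq_lower_rate (lower_rateD (lower_rate_scan x.1.1 x.1.2 x.2 L0 F0) IH) => n.
by rewrite big_cons.
Qed.

End Level.

Definition table_score (lvs : seq level) : N :=
  foldr (fun lv acc => N.add (level_score S lv) acc) N0 lvs.

Lemma level_score_ok lv : level_score S lv = 0%num \/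
  [/\ 0 < N.to_nat (modulus lv), 0 < N.to_nat (floor lv) &
    uniqN [seq x.1.1 | x <- cells S lv (map (analyse S) (patterns S lv))]].
Proof.
rewrite /level_score; case: ifP => [/andP[/andP[/N.leb_spec0 h1 /N.leb_spec0 h2] h3]|_]; last by left.
by right; split => //; lia.
Qed.

(** The logarithms of [num_above n v] telescope over v. A v without credit costs nothing, because
    the count cannot decrease when v is added. *)
Lemma table_rate lvs : uniqN (map floor lvs) ->
  exists C : R, forall n, (NR (table_score lvs) * INR n - C <= SR * ln (INR (num_above n 0)))%R.
Proof.
move=> ufl.
(* A level of score 0 may have failed its tests and receives no credit. *)
pose val lv n v := if level_score S lv == 0%num then 0 else level_active lv n v.
have [C hC] : lower_rate (fun n => \sum_(1 <= v < n.+1) \sum_(lv <- lvs) val lv n v)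
    (NR (table_score lvs)).
  elim: lvs {ufl} => [|lv lvs IH] /=.
    by apply: eq_lower_rate (lower_rate0 (fun _ => 0)) => n; rewrite big1 // => v _; rewrite big_nil.
  rewrite NR_add; have h : lower_rate (fun n => \sum_(1 <= v < n.+1) val lv n v) (NR (level_score S lv)).
    rewrite /val; case: eqP => [->|h0].
      by apply: eq_lower_rate (lower_rate0 (fun _ => 0)) => n; rewrite big1.
    by case: (level_score_ok lv) => // -[h1 h2 h3]; apply: lower_rate_level.
  apply: eq_lower_rate (lower_rateD h IH) => n.
  by rewrite -big_split /=; apply: eq_bigr => v _; rewrite big_cons.
exists C => n; apply: Rle_trans (hC n) _.
have na0 w : (1 <= INR (num_above n w))%R.
  by rewrite -[1%R]/(INR 1); apply/INR_leq/num_above_gt0.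
have step v : (INR (\sum_(lv <- lvs) val lv n v) <=
    SR * (ln (INR (num_above n v.-1)) - ln (INR (num_above n v))))%R.
  have mono : (ln (INR (num_above n v)) <= ln (INR (num_above n v.-1)))%R.
    apply: ln_le; first by have := na0 v; lra.
    apply: INR_leq; apply: subset_leq_card; apply/subsetP => F; rewrite !inE => /andP[FV ->].
    rewrite andbT; apply: subset_trans FV _; apply/subsetP => x; rewrite !inE => /andP[vx ->].
    by rewrite andbT; lia.
  have s0 := SR_gt0.
  have valP lv : val lv n v = 0 \/ n %/ v = N.to_nat (floor lv) /\
      (INR (val lv n v) <= SR * (ln (INR (num_above n v.-1)) - ln (INR (num_above n v))))%R.
    rewrite /val; case: eqP => [_|h0]; first by left.
    by case: (level_score_ok lv) => [/h0 //|[_ _ h3]]; apply: level_activeP.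
  have [||->|[lv ->]] := @uniq_sum level N lvs floor (fun lv => val lv n v) (N.of_nat (n %/ v)).
  - by rewrite -uniqNE.
  - by move=> lv; case: (valP lv) => [->|[-> _] _] //; rewrite N2Nat.id.
  - by rewrite /=; apply: Rmult_le_pos; lra.
  case: (valP lv) => [->|[_ //]].
  by rewrite /=; apply: Rmult_le_pos; lra.
have : forall m, (INR (\sum_(1 <= v < m.+1) \sum_(lv <- lvs) val lv n v) <=
    SR * (ln (INR (num_above n 0)) - ln (INR (num_above n m))))%R.
  elim=> [|m IH]; first by rewrite big_geq //= Rminus_diag Rmult_0_r; lra.
  by rewrite big_nat_recr // INR_addn; have := step m.+1; rewrite /=; lra.
move=> /(_ n) h; apply: Rle_trans h _.
have h1 : (0 <= ln (INR (num_above n n)))%R.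
  by rewrite -ln_1; apply: ln_le; [lra | apply: na0].
apply: Rmult_le_compat_l; [exact: Rlt_le SR_gt0 | lra].
Qed.
End Rate.

(** * Limits of n-th roots *)

Local Open Scope R_scope.

(** Majorizing the coefficients 1 / (2 k + 1), k >= 7, by 1 / 15 sums the tail of the series; right
    side minus left side has derivative 4 / 15 * x^16 / (1 - x^2)^2. *)
Lemma atanh7_upper z : 0 <= z < 1 ->
  ln ((1 + z) / (1 - z)) <= atanh7 z + 2 * z^15 / (15 * (1 - z^2)).
Proof.
move=> hz; rewrite ln_div; try lra.
set f := fun t => atanh7 t + 2 * t^15 / (15 * (1 - t^2)) - (ln (1 + t) - ln (1 - t)).
have f0 : f 0 = 0 by rewrite /f /atanh7 Rplus_0_r Rminus_0_r ln_1; lra.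
suff : f 0 <= f z by rewrite f0 /f; lra.
have [z0|z0] := Req_dec z 0; first by rewrite z0; apply: Rle_refl.
have [||c [e hc]] := MVT_cor2 f (fun x => 4 / 15 * x^16 / (1 - x^2)^2) 0 z.
- lra.
- move=> c hc; apply/is_derive_Reals; rewrite /f /atanh7; auto_derive.
    by repeat split; nra.
  by field; repeat split; nra.
suff : 0 <= f z - f 0 by lra.
rewrite e; apply: Rmult_le_pos; last lra.
apply: Rdiv_le_0_compat; last by apply: pow_lt; nra.
by apply: Rmult_le_pos; [lra | apply: pow_le; lra].
Qed.

Lemma ln_lt_atanh7 y z q : 0 < y -> 0 <= z < 1 -> y * (1 - z) <= 1 + z ->
  atanh7 z + 2 * z^15 / (15 * (1 - z^2)) < q -> ln y < q.
Proof.
move=> y0 hz yz; apply: Rle_lt_trans; apply: Rle_trans (atanh7_upper hz).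
apply: ln_le => //; apply: (Rmult_le_reg_r (1 - z)); first lra.
by rewrite /Rdiv Rmult_assoc Rinv_l ?Rmult_1_r; lra.
Qed.

Lemma nth_root_exp f n : nth_root_seq f n.+1 = exp (ln (INR (f n.+1)) / INR n.+1).
Proof. by rewrite /nth_root_seq /Rpower; congr exp; rewrite Rmult_comm. Qed.

Lemma exp_le x y : x <= y -> exp x <= exp y.
Proof. by case=> [/exp_increasing/Rlt_le|->]; [|exact: Rle_refl]. Qed.

Lemma is_lim_seq_exp_rate c C : is_lim_seq (fun n => exp (c + C / INR n.+1)) (exp c).
Proof.
apply: (is_lim_seq_continuous exp (fun n => c + C / INR n.+1) c).
  exact: derivable_continuous_pt (derivable_pt_exp c).
have -> : Finite c = Rbar_plus c 0 by rewrite /= Rplus_0_r.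
apply: is_lim_seq_plus' (is_lim_seq_const c) _.
have -> : Finite 0 = Rbar_mult C 0 by rewrite /= Rmult_0_r.
apply: is_lim_seq_scal_l.
have -> : Finite 0 = Rbar_inv p_infty by [].
apply: is_lim_seq_inv => //.
exact: (proj1 (is_lim_seq_incr_1 _ _) is_lim_seq_INR).
Qed.

Lemma limit_ge f (a c C : R) : (forall n, c * INR n - C <= ln (INR (f n))) ->
  is_lim_seq (nth_root_seq f) a -> exp c <= a.
Proof.
move=> h /is_lim_seq_incr_1 ha.
have hc := @is_lim_seq_exp_rate c (- C).
apply: (is_lim_seq_le _ _ (exp c) a _ hc ha) => n.
have n0 : 0 < INR n.+1 by apply: lt_0_INR; apply/ltP.
rewrite nth_root_exp; apply: exp_le; apply: (Rmult_le_reg_r (INR n.+1)) => //.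
have -> : (c + - C / INR n.+1) * INR n.+1 = c * INR n.+1 - C by field; lra.
by rewrite /Rdiv Rmult_assoc Rinv_l ?Rmult_1_r; [exact: h | lra].
Qed.

Lemma limit_le f (a c C : R) : (forall n, ln (INR (f n)) <= c * INR n + C) ->
  is_lim_seq (nth_root_seq f) a -> a <= exp c.
Proof.
move=> h /is_lim_seq_incr_1 ha.
have hc := @is_lim_seq_exp_rate c C.
apply: (is_lim_seq_le _ _ a (exp c) _ ha hc) => n.
have n0 : 0 < INR n.+1 by apply: lt_0_INR; apply/ltP.
rewrite nth_root_exp; apply: exp_le; apply: (Rmult_le_reg_r (INR n.+1)) => //.
have -> : (c + C / INR n.+1) * INR n.+1 = c * INR n.+1 + C by field; lra.
by rewrite /Rdiv Rmult_assoc Rinv_l ?Rmult_1_r; [exact: h | lra].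
Qed.

Lemma NR_IZR a : NR a = IZR (Z.of_N a).
Proof. by rewrite INR_IZR_INZ N_nat_Z. Qed.

Lemma SR_E : SR = 1000000000000000.
Proof. by rewrite NR_IZR. Qed.

Lemma NR_ratio q z : Z.of_N q = z -> NR q / SR = IZR z / 1000000000000000.
Proof. by move=> <-; rewrite SR_E NR_IZR. Qed.

Lemma table_limit S isK lvs f (a : R) (q : N) :
  (forall k : N, (k < mult_bound S)%num -> isK (N.to_nat k) = (k \in mults S)) ->
  (0 < divisor S)%num -> (forall k, isK k -> (N.to_nat (divisor S) < k)%nat) ->
  (forall n, (num_above S isK n 0 <= f n)%nat) ->
  uniqN (map floor lvs) && N.leb q (table_score S lvs) ->
  is_lim_seq (nth_root_seq f) a -> exp (NR q / SR) <= a.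
Proof.
move=> h1 h2 h3 h4 /andP[h5 /N.leb_spec0 h6] ha.
have [C hC] := table_rate h1 h2 h3 h5.
apply: (@limit_ge f a (NR q / SR) (C / SR) _ ha) => n.
have s0 := SR_gt0.
have na0 : 0 < INR (num_above S isK n 0).
  exact/lt_0_INR/ltP/num_above_gt0.
apply: Rle_trans (ln_le _ _ na0 (INR_leq (h4 n))).
apply: (Rmult_le_reg_l SR) => //; apply: Rle_trans (hC n).
have -> : SR * (NR q / SR * INR n - C / SR) = NR q * INR n - C by field; lra.
have : NR q <= NR (table_score S lvs) by apply: le_INR; lia.
have := pos_INR n; nra.
Qed.

Local Open Scope nat_scope.

Lemma ratio_SR x : x = (SR * (x / SR))%R.
Proof. by field; have := SR_gt0; lra. Qed.

(** * Fixed-point logarithms of counts *)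

Definition ln2_upper : N := 693147200000000%num.
Lemma ln2_upper_ge : (SR * ln 2 <= NR ln2_upper)%R.
Proof.
rewrite [X in (_ <= X)%R]ratio_SR; apply: Rmult_le_compat_l; first exact: Rlt_le SR_gt0.
rewrite (@NR_ratio ln2_upper 693147200000000%Z erefl).
by apply: Rlt_le; apply: (@ln_lt_atanh7 _ (1/3)); rewrite /atanh7; lra.
Qed.
Global Opaque ln2_upper.

(* [2^k] is the largest power of two below w: the lower bound writes w = 2^k (1 + a / 2^k),
   the upper one 2^(k+1) = w (1 + b / w). *)
Definition fln_lower (w : N) : N :=
  let k := N.log2 w in (k * fln1p 1 1 + fln1p (w - 2 ^ k) (2 ^ k))%num.
Definition fln_upper (w : N) : N :=
  let k := N.succ (N.log2 w) in (k * ln2_upper - fln1p (2 ^ k - w) w)%num.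

Lemma NR_pow2 k : NR (2 ^ k)%num = (2 ^ N.to_nat k)%R.
Proof.
rewrite N2Nat.inj_pow; elim: (N.to_nat k) => [|m IH]; first by rewrite /=; lra.
by rewrite Nat.pow_succ_r' mult_INR IH /=; lra.
Qed.

Lemma ln_pow2 m : (ln (2 ^ m) = INR m * ln 2)%R.
Proof. by rewrite ln_pow //; lra. Qed.

Lemma NR_sub a b : (b <= a)%num -> NR (a - b)%num = (NR a - NR b)%R.
Proof. by move=> h; rewrite N2Nat.inj_sub minus_INR //; lia. Qed.

Lemma fln_lower_le w : (w <> 0)%num -> (NR (fln_lower w) <= SR * ln (NR w))%R.
Proof.
move=> w0; rewrite /fln_lower; set k := N.log2 w.
have [h1 h2] := N.log2_spec w ltac:(lia); rewrite -/k in h1 h2.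
have p0 : (2 ^ k <> 0)%num by apply: N.pow_nonzero.
have P0 := NR_gt0 p0; have W0 := NR_gt0 w0.
rewrite NR_add NR_mul.
have l2 : (NR (fln1p 1 1) <= SR * ln 2)%R.
  by have := @fln1p_le 1 1 ltac:(lia); rewrite (_ : (1 + NR 1 / NR 1 = 2)%R) //=; lra.
have := Rmult_le_compat_l _ _ _ (NR_pos k) l2.
have := fln1p_le (w - 2 ^ k) p0; rewrite NR_sub //.
have -> : (1 + (NR w - NR (2 ^ k)) / NR (2 ^ k) = NR w / NR (2 ^ k))%R by field; lra.
rewrite ln_div // NR_pow2 ln_pow2; lra.
Qed.

Lemma fln_upper_ge w : (w <> 0)%num -> (SR * ln (NR w) <= NR (fln_upper w))%R.
Proof.
move=> w0; rewrite /fln_upper; set k := N.succ _.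
have [h1 h2] := N.log2_spec w ltac:(lia); rewrite -/k in h1 h2.
have p0 : (2 ^ k <> 0)%num by apply: N.pow_nonzero.
have P0 := NR_gt0 p0; have W0 := NR_gt0 w0.
have hs a b : (NR a - NR b <= NR (a - b)%num)%R.
  case: (N.le_gt_cases b a) => h; first by rewrite NR_sub //; lra.
  have : (NR a <= NR b)%R by apply: le_INR; lia.
  by have := NR_pos (a - b)%num; lra.
apply: Rle_trans (hs _ _); rewrite NR_mul.
have := Rmult_le_compat_l _ _ _ (NR_pos k) ln2_upper_ge.
have := fln1p_le (2 ^ k - w) w0; rewrite NR_sub; last lia.
have -> : (1 + (NR (2 ^ k) - NR w) / NR w = NR (2 ^ k) / NR w)%R by field; lra.
rewrite ln_div // NR_pow2 ln_pow2; lra.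
Qed.

Lemma NR_div_up a b : (b <> 0)%num -> (NR a / NR b <= NR (N.succ (a / b)))%R.
Proof.
move=> b0; have hb := NR_gt0 b0; apply: (Rmult_le_reg_r (NR b)) => //.
rewrite /Rdiv Rmult_assoc Rinv_l ?Rmult_1_r; last lra.
rewrite -NR_mul; apply: le_INR; have := N.mul_succ_div_gt a b b0; lia.
Qed.

(* The classes of a tier have bases coprime to [coarse] and consist of the multiples of the base
   by [sizes], an element m being high when n < ratio * m. A base b belongs to the tier when n / b
   is below [stop] and, as the finer classes take precedence, start * b <= n * inner^k for the
   exponent k of [inner] in b; on each interval between two [cuts] the contribution of b depends
   only on whether a certain power of [inner] divides b. *)
Record tier := Tier {
  coarse : N; ratio : N; inner : N; start : N; stop : N;
  sizes : seq N }.

(** Breakpoints of n / b: b * s enters the class at s and becomes low at [ratio] * s, and the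
    required power of [inner] changes at the rounded-up quotients of [start]. *)
Definition cuts (ti : tier) : seq N :=
  sort N.leb (undup (stop ti :: [seq c <- sizes ti ++ map (N.mul (ratio ti)) (sizes ti) ++
      [seq N.div (start ti + inner ti ^ N.of_nat j - 1) (inner ti ^ N.of_nat j) | j <- iota 0 10]
    | N.ltb 1 c && N.ltb c (stop ti)])).
Arguments cuts : simpl never.

Definition class_base (M d b : N) : bool := N.eqb (N.gcd b M) 1 && N.eqb (N.modulo b d) 0.

Definition class_size (M d : N) : N :=
  foldr (fun b k => if class_base M d b then N.succ k else k) N0
    (range 0 (N.to_nat (M * d))).

(** * Growth rates of the class contributions *)

Section Scan.
Variable ti : tier.
Let M := coarse ti.
Let step j : N := N.pow (inner ti) (N.of_nat j).
(** The least j with [start] <= [inner] ^ j * lo. The value 10 means that there is none below 10;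
    [windows_ok] excludes it. *)
Definition depth (lo : N) : nat := find (fun j => N.leb (start ti) (step j * lo)) (iota 0 10).

Fixpoint windows_ok (lo : N) (segs : seq N) : bool :=
  if segs is hi :: segs' then
    [&& N.ltb lo hi, depth lo <= depth 1 < 10,
      (if depth lo is i.+1 then N.leb (step i * hi) (start ti) else true),
      all (fun s => (N.leb s lo || N.leb hi s) &&
                    (N.leb (ratio ti * s) lo || N.leb hi (ratio ti * s))) (sizes ti)
    & windows_ok hi segs']
  else N.eqb lo (stop ti).

(** For s < [stop] <= 2 ^ 20 smoothness is divisibility of M ^ 20 by s, see [divides_pow]. *)
Definition tier_ok : bool :=
  [&& N.leb 1 M, N.leb 1 (inner ti), N.leb (stop ti) (2 ^ 20), uniqN (sizes ti), ~~ memN 0 (sizes ti),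
    all (fun s => memN s (sizes ti) == N.eqb (N.modulo (M ^ 20) s) 0)
      (range 1 (N.to_nat (N.pred (stop ti))))
  & windows_ok 1 (cuts ti)].

Definition class_sizes : seq N := [seq class_size M (step j) | j <- iota 0 (depth 1).+1].

Fixpoint scan (cell : N -> N -> N -> N -> N) (cs : seq N) (lo : N) (segs : seq N) : N :=
  if segs is hi :: segs' then
    N.add (cell (nth N0 cs (depth lo)) (step (depth lo)) lo hi) (scan cell cs hi segs')
  else N0.

Definition lower_log (lo : N) : N := fln_lower (lower_count (ratio ti) (sizes ti) lo).
Definition upper_log (lo : N) : N := fln_upper (upper_count (ratio ti) (sizes ti) lo).
(** A share c / (M * d) of the integers are class bases divisible by d, and 1 / lo - 1 / hi is the
    density of the b with lo <= n / b < hi. *)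
Definition lower_cell (c d lo hi : N) : N :=
  N.div (lower_log lo * (c * (hi - lo))) (M * d * lo * hi).
Definition upper_cell (c d lo hi : N) : N :=
  N.succ (N.div (upper_log lo * (c * (hi - lo)))
                (M * d * lo * hi)).

Definition lower_score : N := scan lower_cell class_sizes 1 (cuts ti).
Definition upper_score : N := scan upper_cell class_sizes 1 (cuts ti).

Fixpoint scan_value (val : N -> N) (lo : N) (segs : seq N) (n b : nat) : nat :=
  if segs is hi :: segs' then
    (class_base M (step (depth lo)) (N.of_nat b) && (N.to_nat lo * b <= n * 1 < N.to_nat hi * b))
      * N.to_nat (val lo) + scan_value val hi segs' n b
  else 0.

(** The hypotheses of [leq_part_window] on the window, with p = [inner], together with the absence
    of critical values inside it. *)
Definition window_spec (lo hi : N) (j : nat) : Prop :=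
  [/\ (start ti <= step j * lo)%num, (forall i, j = i.+1 -> (step i * hi <= start ti)%num) &
    all (fun s => (N.leb s lo || N.leb hi s) &&
                  (N.leb (ratio ti * s) lo || N.leb hi (ratio ti * s))) (sizes ti)].

Lemma scan_value_outside val lo segs n b : windows_ok lo segs -> 0 < b ->
  ~~ (N.to_nat lo <= n %/ b < N.to_nat (stop ti)) -> scan_value val lo segs n b = 0.
Proof.
move=> + b0; elim: segs lo => [//|hi segs IH] lo /= /and5P[/N.ltb_spec0 lh _ _ _ ok] out.
have hiT : (hi <= stop ti)%num.
  elim: segs hi {IH lh out} ok => [|h s IHs] g /=; first by move/N.eqb_spec => ->; apply: N.le_refl.
  by case/and5P => /N.ltb_spec0 gh _ _ _ /IHs; lia.
rewrite IH //; last by apply: contra out => /andP[h1 h2]; apply/andP; lia.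
rewrite muln1 -leq_divRL // -ltn_divLR //; case h : (_ && (_ && _)) => //.
by case/negP: out; case/and3P: h => _ h1 h2; rewrite h1; lia.
Qed.

Lemma scan_value_inside lo segs n b : windows_ok lo segs -> 0 < b ->
  N.to_nat lo <= n %/ b < N.to_nat (stop ti) ->
  exists a c j, [/\ window_spec a c j, N.to_nat a <= n %/ b < N.to_nat c &
    forall val, scan_value val lo segs n b =
      class_base M (step j) (N.of_nat b) * N.to_nat (val a)].
Proof.
move=> + b0; elim: segs lo => [|hi segs IH] lo /=.
  by move=> /N.eqb_spec -> h; exfalso; lia.
move=> /and5P[/N.ltb_spec0 lh /andP[j1 j2] si aS ok] /andP[h1 h2].
have j10 := leq_ltn_trans j1 j2.
rewrite muln1 -leq_divRL // -ltn_divLR // h1 /=.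
case: (ltnP (n %/ b) (N.to_nat hi)) => h3; last first.
  have [|a [c [j [h4 h5 h6]]]] := IH hi ok; first exact/andP.
  by exists a, c, j; split => // val; rewrite andbF mul0n add0n.
exists lo, hi, (depth lo); split; rewrite ?h1 ?h3 //.
  split => [|i e|//]; last by move: si; rewrite e => /N.leb_spec0.
  have hs : has (fun j => N.leb (start ti) (step j * lo)) (iota 0 10).
    by rewrite has_find size_iota.
  by have := nth_find 0 hs; rewrite nth_iota // add0n => /N.leb_spec0.
by move=> val; rewrite andbT scan_value_outside ?addn0 //; apply/negP => /andP[]; lia.
Qed.

Lemma class_sizeE d : class_size M d =
  N.of_nat (count (fun b => class_base M d (N.of_nat b)) (iota 0 (N.to_nat (M * d)))).
Proof.
rewrite /class_size (rangeE 0).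
by elim: (iota _ _) => //= v s ->; case: class_base; lia.
Qed.

Lemma class_base_period d b : (d <> 0)%num ->
  class_base M d (N.of_nat (b + N.to_nat (M * d))) = class_base M d (N.of_nat b).
Proof.
move=> d0; rewrite Nat2N.inj_add N2Nat.id /class_base; congr (_ && _); congr N.eqb.
  rewrite N.gcd_comm [RHS]N.gcd_comm [(M * d)%num]N.mul_comm; exact: N.gcd_add_mult_diag_r.
exact: N.Div0.mod_add.
Qed.

Hypothesis ok : tier_ok.

Let M_gt0 : (1 <= M)%num. Proof. by case/and5P: ok => /N.leb_spec0. Qed.
Let step_gt0 j : (step j <> 0)%num.
Proof. by apply: N.pow_nonzero; case/and5P: ok => _ /N.leb_spec0; lia. Qed.

Lemma rate_class d (lo hi : N) : (d <> 0)%num -> (1 <= lo)%num -> (lo < hi)%num ->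
  let f n := count (fun v => class_base M d (N.of_nat v) &&
                     (N.to_nat lo * v <= n * 1 < N.to_nat hi * v)) (iota 1 n) in
  let s := (NR (class_size M d * (hi - lo)) / NR (M * d * lo * hi))%R in
  lower_rate f s /\ upper_rate f s.
Proof.
move=> d0 lo1 lh f s.
have L0 : 0 < N.to_nat (M * d) by move: M_gt0; nia.
have := @rate_window (fun v => class_base M d (N.of_nat v)) (N.to_nat (M * d)) 1
  (N.to_nat lo) (N.to_nat hi) L0 (fun v => class_base_period v d0) ltac:(lia) isT ltac:(lia).
rewrite -/f (_ : (_ / _)%R = s) //; rewrite /s class_sizeE !NR_mul Nat2N.id N2Nat.inj_sub.
by rewrite -NR_mul Rmult_1_r.
Qed.

(** The flag [up] lets one induction serve both directions, provided that each cell is rounded in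
    the matching direction. *)
Lemma scan_rate val cell up :
  (forall j lo hi, (1 <= lo)%num -> (lo < hi)%num ->
    let s := (NR (val lo) * (NR (class_size M (step j) * (hi - lo)) / NR (M * step j * lo * hi)))%R in
    let v := NR (cell (class_size M (step j)) (step j) lo hi) in
    if up then (s <= v)%R else (v <= s)%R) ->
  let f n := \sum_(1 <= b < n.+1) scan_value val 1 (cuts ti) n b in
  (if up then upper_rate else lower_rate) f (NR (scan cell class_sizes 1 (cuts ti))).
Proof.
move=> h f.
suff gen segs lo : (1 <= lo)%num -> windows_ok lo segs ->     (if up then upper_rate else lower_rate)
      (fun n => \sum_(1 <= b < n.+1) scan_value val lo segs n b) (NR (scan cell class_sizes lo segs)).
  by apply: gen; [lia | case/and5P: ok => _ _ _ _ /and3P[]].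
elim: segs lo => [|hi segs IH] lo lo1 /=.
  move=> _; case: up {h}; exists 0%R => n; rewrite big1 //=; have := pos_INR n; lra.
case/and5P => /N.ltb_spec0 lh /andP[j10 _] _ _ wok; set j := depth lo.
have {}IH := IH hi ltac:(lia) wok; have {}h := h j lo hi lo1 lh.
rewrite NR_add (nth_map 0) ?size_iota // nth_iota // add0n.
have [[C hC] [C' hC']] := rate_class (@step_gt0 j) lo1 lh.
have v0 := NR_pos (val lo).
pose g n := count (fun v => class_base M (step j) (N.of_nat v) &&
                     (N.to_nat lo * v <= n * 1 < N.to_nat hi * v)) (iota 1 n).
have gE : (fun n => g n * N.to_nat (val lo) + \sum_(1 <= b < n.+1) scan_value val hi segs n b) =1
    (fun n => \sum_(1 <= b < n.+1) ((class_base M (step j) (N.of_nat b)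
      && (N.to_nat lo * b <= n * 1 < N.to_nat hi * b)) * N.to_nat (val lo) + scan_value val hi segs n b)).
  move=> n; rewrite /g -sum1_count big_mkcond /index_iota subSS subn0 big_distrl /= -big_split /=.
  by apply: eq_bigr => v _; case: (_ && _); rewrite /= ?mul0n ?mul1n.
case: up h IH => h IH.
  apply: eq_upper_rate gE _; apply: upper_rateD IH.
  exists (C' * NR (val lo))%R => n; rewrite INR_muln.
  have := Rmult_le_compat_r _ _ _ v0 (hC' n); have := Rmult_le_compat_r _ _ _ (pos_INR n) h.
  rewrite -/(g n); lra.
apply: eq_lower_rate gE _; apply: lower_rateD IH.
exists (C * NR (val lo))%R => n; rewrite INR_muln.
have := Rmult_le_compat_r _ _ _ v0 (hC n); have := Rmult_le_compat_r _ _ _ (pos_INR n) h.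
rewrite -/(g n); lra.
Qed.

Lemma lower_score_rate :
  lower_rate (fun n => \sum_(1 <= b < n.+1) scan_value lower_log 1 (cuts ti) n b) (NR lower_score).
Proof.
apply: (scan_rate (up := false)) => j lo hi lo1 lh /=.
have M0 := M_gt0; have s0 := @step_gt0 j.
apply: Rle_trans (NR_div_le _ _) _.
  by move=> /N.eq_mul_0 [/N.eq_mul_0 [/N.eq_mul_0 []|]|]; lia.
by rewrite (NR_mul (lower_log lo)) /Rdiv Rmult_assoc; apply: Rle_refl.
Qed.

Lemma upper_score_rate :
  upper_rate (fun n => \sum_(1 <= b < n.+1) scan_value upper_log 1 (cuts ti) n b) (NR upper_score).
Proof.
apply: (scan_rate (up := true)) => j lo hi lo1 lh /=.
have M0 := M_gt0; have s0 := @step_gt0 j.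
apply: Rle_trans (NR_div_up _ _); last first.
  by move=> /N.eq_mul_0 [/N.eq_mul_0 [/N.eq_mul_0 []|]|]; lia.
by rewrite (NR_mul (upper_log lo)) /Rdiv Rmult_assoc; apply: Rle_refl.
Qed.

Section Level.
Variables (n T5 T3 T2 i b : nat).
Hypotheses (i3 : i < 3) (coarseE : N.to_nat (coarse ti) = moduli i).
Hypotheses (ratioE : N.to_nat (ratio ti) = factor i)
           (stopE : N.to_nat (stop ti) = threshold T5 T3 T2 i).
Hypotheses (b_gt0 : 0 < b) (b_le_n : b <= n).
Let level := lev n T5 T3 T2.
Let active := (level b == i) && coprime (moduli i) b.
Hypothesis activeE : forall lo hi j, window_spec lo hi j ->
  N.to_nat lo <= n %/ b < N.to_nat hi -> n < threshold T5 T3 T2 i * b ->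
  active = class_base M (step j) (N.of_nat b).

Lemma sizesP (s : N) : 0 < N.to_nat s < N.to_nat (stop ti) ->
  (s \in sizes ti) = smooth (moduli i) (N.to_nat s).
Proof.
case/and5P: ok => /N.leb_spec0 M1 _ /N.leb_spec0 T20 _ /and3P[_ /allP sP _] /andP[s0 sT].
rewrite -coarseE -(@divides_pow (coarse ti) s 20) //; first last.
- by apply: N.lt_le_trans T20; lia.
- by rewrite -/M; lia.
rewrite -memNP; apply/eqP/sP/mem_range; lia.
Qed.

(** For n / b >= [stop] the base cannot have level i. Below [stop], b meets exactly one window, on
    which [activeE] turns having level i into a test of coprimality and divisibility. *)
Lemma level_scan :
  if active then exists a, [/\
    class_upper n T5 T3 T2 b = N.to_nat (upper_count (ratio ti) (sizes ti) a),
    class_lower n T5 T3 T2 b = N.to_nat (lower_count (ratio ti) (sizes ti) a) &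
    forall val, scan_value val 1 (cuts ti) n b = N.to_nat (val a)]
  else forall val, scan_value val 1 (cuts ti) n b = 0.
Proof.
have wok : windows_ok 1 (cuts ti) by case/and5P: ok => _ _ _ _ /and3P[].
have t1 : 1 <= n %/ b by rewrite divn_gt0.
case: (ltnP (n %/ b) (N.to_nat (stop ti))) => tT; last first.
  have -> : active = false.
    apply/negP => /andP[/eqP l c].
    have := @lev_lt n T5 T3 T2 b; rewrite -/level l rough_coprime ?moduli_gt0 // => /(_ i3).
    by rewrite -stopE -ltn_divLR // ltnNge tT.
  by move=> val; apply: scan_value_outside => //; rewrite ltnNge tT andbF.
have [|lo [hi [j [ws win val]]]] := scan_value_inside wok b_gt0 (n := n); first by rewrite tT andbT.
have nT : n < threshold T5 T3 T2 i * b by rewrite -stopE -ltn_divLR.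
have aE := activeE ws win nT; rewrite -aE in val.
case act : active val => val; last by move=> v; rewrite val.
case/andP: act => /eqP l cop; exists lo.
have mem s : 0 < N.to_nat s < threshold T5 T3 T2 (level b) ->
    (s \in sizes ti) = smooth (moduli (level b)) (N.to_nat s).
  by rewrite l -stopE; apply: sizesP.
have us : uniq (sizes ti) by rewrite -uniqNE; case/and5P: ok => _ _ _ ->.
have pos : 0%num \notin sizes ti by rewrite -memNP; case/and5P: ok => _ _ _ _ /andP[].
have wS s : s \in sizes ti -> (N.leb s lo || N.leb hi s) &&
    (N.leb (ratio ti * s) lo || N.leb hi (ratio ti * s)).
  by case: ws => _ _ /allP; apply.
have lb3 : level b < 3 by rewrite l.
have cb : coprime (moduli (level b)) b by rewrite l.
have qb : N.to_nat (ratio ti) = factor (level b) by rewrite l.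
split; last by move=> v; rewrite val mul1n.
  exact: (@block_upper n T5 T3 T2 b lo hi (ratio ti) (sizes ti)).
exact: (@block_lower n T5 T3 T2 b lo hi (ratio ti) (sizes ti)).
Qed.
End Level.

End Scan.

(** * Certificates *)

Local Open Scope N_scope.
(** A larger base B admits more multiples of v / B into W and can give a better proportion, but B
    has to divide v; hence several seeds per level. A seed that fails its tests adds nothing to the
    score. *)
Definition prime_table : seq level := [::
  Level 1 1 1
  [:: (1, 1, [::])];
  Level 2 1 1
  [:: (1, 2, [::])];
  Level 3 360 1
  [:: (1, 3, [::]); (2, 6, [:: 3])];
  Level 4 360 2
  [:: (1, 4, [::]); (2, 8, [:: 3]); (2, 9, [:: 3]); (3, 12, [:: 4]); (4, 18, [:: 6;9]);
  (6, 24, [:: 8;9]); (6, 27, [:: 8;9]); (8, 36, [:: 9;12]); (12, 54, [:: 16;18;27]);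
  (24, 108, [:: 27;32;36])];
  Level 5 360 72
  [:: (1, 5, [::]); (2, 10, [:: 3;5]); (3, 15, [:: 4;5]); (3, 16, [:: 4;5]);
  (4, 20, [:: 5;6;9]); (6, 30, [:: 8;9;10;15]); (6, 32, [:: 8;9;10;15]);
  (8, 40, [:: 9;10;12;15]); (8, 45, [:: 9;10;12;15]); (9, 45, [:: 10;12;15]);
  (9, 48, [:: 10;12;15;16]); (9, 50, [:: 10;12;15;16]); (12, 60, [:: 15;16;18;20;27]);
  (12, 64, [:: 15;16;18;20;27]); (18, 90, [:: 20;24;27;30;45]);
  (18, 96, [:: 20;24;27;30;32;45]); (18, 100, [:: 20;24;27;30;32;45]);
  (24, 120, [:: 27;30;32;36;40;45]); (24, 128, [:: 27;30;32;36;40;45]);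
  (24, 135, [:: 27;30;32;36;40;45]); (36, 180, [:: 40;45;48;54;60;81]);
  (36, 192, [:: 40;45;48;54;60;64;81]); (36, 200, [:: 40;45;48;54;60;64;81]);
  (72, 360, [:: 80;81;90;96;108;120;135]); (72, 384, [:: 80;81;90;96;108;120;128;135]);
  (72, 405, [:: 80;81;90;96;108;120;128;135])];
  Level 6 360 60
  [:: (1, 6, [::]); (2, 12, [:: 3;5]); (3, 18, [:: 4;5]); (3, 20, [:: 4;5]);
  (4, 24, [:: 5;6;9]); (4, 25, [:: 5;6;9]); (4, 27, [:: 5;6;9]); (5, 30, [:: 6;8;9]);
  (5, 32, [:: 6;8;9]); (6, 36, [:: 8;9;10;15]); (6, 40, [:: 8;9;10;15]);
  (8, 48, [:: 9;10;12;15]); (8, 50, [:: 9;10;12;15;25]); (8, 54, [:: 9;10;12;15;25]);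
  (9, 54, [:: 10;12;15;16]); (9, 60, [:: 10;12;15;16]); (10, 60, [:: 12;15;16;18;25]);
  (10, 64, [:: 12;15;16;18;25]); (12, 72, [:: 15;16;18;20;27]);
  (12, 75, [:: 15;16;18;20;25;27]); (12, 80, [:: 15;16;18;20;25;27]);
  (12, 81, [:: 15;16;18;20;25;27]); (15, 90, [:: 18;20;24;25;27]);
  (15, 96, [:: 18;20;24;25;27]); (15, 100, [:: 18;20;24;25;27]);
  (18, 108, [:: 20;24;27;30;32;45]); (18, 120, [:: 20;24;27;30;32;45]);
  (20, 120, [:: 24;25;30;32;36;45]); (20, 125, [:: 24;25;30;32;36;45]);
  (20, 128, [:: 24;25;30;32;36;45]); (20, 135, [:: 24;25;30;32;36;45]);
  (24, 144, [:: 27;30;32;36;40;45]); (24, 150, [:: 27;30;32;36;40;45;50;75]);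
  (24, 160, [:: 27;30;32;36;40;45;50;75]); (24, 162, [:: 27;30;32;36;40;45;50;75]);
  (30, 180, [:: 36;40;45;48;50;54;75]); (30, 192, [:: 36;40;45;48;50;54;75]);
  (30, 200, [:: 36;40;45;48;50;54;75]); (36, 216, [:: 40;45;48;54;60;64;81]);
  (36, 225, [:: 40;45;48;54;60;64;75;81]); (36, 240, [:: 40;45;48;54;60;64;75;81]);
  (36, 243, [:: 40;45;48;54;60;64;75;81]); (40, 240, [:: 45;48;50;60;64;72;75]);
  (40, 250, [:: 45;48;50;60;64;72;75;125]); (40, 256, [:: 45;48;50;60;64;72;75;125]);
  (40, 270, [:: 45;48;50;60;64;72;75;125]); (45, 270, [:: 50;54;60;72;75;80;81]);
  (45, 288, [:: 50;54;60;72;75;80;81]); (45, 300, [:: 50;54;60;72;75;80;81]);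
  (60, 360, [:: 72;75;80;90;96;100;108;135]); (60, 375, [:: 72;75;80;90;96;100;108;125;135]);
  (60, 384, [:: 72;75;80;90;96;100;108;125;135]);
  (60, 405, [:: 72;75;80;90;96;100;108;125;135]); (72, 432, [:: 80;81;90;96;108;120;128;135]);
  (72, 450, [:: 80;81;90;96;108;120;128;135;150;225]);
  (72, 486, [:: 80;81;90;96;108;120;128;135;150;225]);
  (90, 540, [:: 100;108;120;135;144;150;160;162;225]);
  (90, 600, [:: 100;108;120;135;144;150;160;162;225]);
  (120, 720, [:: 135;144;150;160;180;192;200;216;225]);
  (120, 750, [:: 135;144;150;160;180;192;200;216;225;250;375]);
  (120, 768, [:: 135;144;150;160;180;192;200;216;225;250;375]);
  (120, 810, [:: 135;144;150;160;180;192;200;216;225;250;375])];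
  Level 7 360 360
  [:: (1, 7, [::]); (2, 14, [:: 3;5;7]); (2, 15, [:: 3;5;7]); (3, 21, [:: 4;5;7]);
  (4, 28, [:: 5;6;7;9]); (4, 30, [:: 5;6;7;9]); (5, 35, [:: 6;7;8;9]); (5, 36, [:: 6;7;8;9]);
  (6, 42, [:: 7;8;9;10;15]); (6, 45, [:: 7;8;9;10;15]); (8, 56, [:: 9;10;12;14;15;21;25]);
  (8, 60, [:: 9;10;12;14;15;21;25]); (8, 63, [:: 9;10;12;14;15;21;25]);
  (9, 63, [:: 10;12;14;15;16;21]); (9, 64, [:: 10;12;14;15;16;21]);
  (9, 70, [:: 10;12;14;15;16;21]); (10, 70, [:: 12;14;15;16;18;21;25;35]);
  (10, 72, [:: 12;14;15;16;18;21;25;35]); (10, 75, [:: 12;14;15;16;18;21;25;35]);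
  (12, 84, [:: 14;15;16;18;20;21;25;27;35]); (12, 90, [:: 14;15;16;18;20;21;25;27;35]);
  (15, 105, [:: 18;20;21;24;25;27;35]); (15, 108, [:: 18;20;21;24;25;27;35]);
  (18, 126, [:: 20;21;24;27;28;30;32;45]); (18, 128, [:: 20;21;24;27;28;30;32;45]);
  (18, 135, [:: 20;21;24;27;28;30;32;45]); (18, 140, [:: 20;21;24;27;28;30;32;45]);
  (20, 140, [:: 24;25;28;30;32;35;36;42;45]); (20, 144, [:: 24;25;28;30;32;35;36;42;45]);
  (20, 150, [:: 24;25;28;30;32;35;36;42;45]);
  (24, 168, [:: 27;28;30;32;36;40;42;45;50;63;70;75]);
  (24, 180, [:: 27;28;30;32;36;40;42;45;50;63;70;75]);
  (24, 189, [:: 27;28;30;32;36;40;42;45;50;63;70;75]);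
  (30, 210, [:: 35;36;40;42;45;48;50;54;63;75]); (30, 216, [:: 35;36;40;42;45;48;50;54;63;75]);
  (30, 225, [:: 35;36;40;42;45;48;50;54;63;75]);
  (36, 256, [:: 40;42;45;48;54;56;60;63;64;75;81;105]);
  (36, 270, [:: 40;42;45;48;54;56;60;63;64;75;81;105]);
  (36, 280, [:: 40;42;45;48;54;56;60;63;64;75;81;105]);
  (40, 280, [:: 45;48;50;56;60;64;70;72;75;84;105;125]);
  (40, 288, [:: 45;48;50;56;60;64;70;72;75;84;105;125]);
  (40, 300, [:: 45;48;50;56;60;64;70;72;75;84;105;125]);
  (40, 315, [:: 45;48;50;56;60;64;70;72;75;84;105;125]);
  (45, 324, [:: 50;54;60;63;70;72;75;80;81;105]);
  (60, 420, [:: 70;72;75;80;84;90;96;100;105;108;125;126;135;175]);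
  (60, 432, [:: 70;72;75;80;84;90;96;100;105;108;125;126;135;175]);
  (60, 450, [:: 70;72;75;80;84;90;96;100;105;108;125;126;135;175]);
  (72, 512, [:: 80;81;84;90;96;108;112;120;126;128;135;150;189;210;225]);
  (72, 540, [:: 80;81;84;90;96;108;112;120;126;128;135;150;189;210;225]);
  (120, 840, [:: 135;140;144;150;160;168;180;192;200;210;216;225;250;252;315;350;375]);
  (120, 864, [:: 135;140;144;150;160;168;180;192;200;210;216;225;250;252;315;350;375]);
  (120, 900, [:: 135;140;144;150;160;168;180;192;200;210;216;225;250;252;315;350;375])];
  Level 8 360 180
  [:: (1, 8, [::]); (2, 16, [:: 3;5;7]); (3, 24, [:: 4;5;7]); (3, 25, [:: 4;5;7]);
  (4, 32, [:: 5;6;7;9]); (4, 35, [:: 5;6;7;9]); (5, 40, [:: 6;7;8;9]); (5, 42, [:: 6;7;8;9]);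
  (6, 48, [:: 7;8;9;10;15]); (6, 49, [:: 7;8;9;10;15]); (6, 50, [:: 7;8;9;10;15;25]);
  (8, 64, [:: 9;10;12;14;15;21;25]); (8, 70, [:: 9;10;12;14;15;21;25;35]);
  (9, 72, [:: 10;12;14;15;16;21]); (9, 75, [:: 10;12;14;15;16;21;25]);
  (9, 80, [:: 10;12;14;15;16;21;25]); (10, 80, [:: 12;14;15;16;18;21;25;35]);
  (10, 84, [:: 12;14;15;16;18;21;25;35]); (12, 96, [:: 14;15;16;18;20;21;25;27;35]);
  (12, 98, [:: 14;15;16;18;20;21;25;27;35;49]); (12, 100, [:: 14;15;16;18;20;21;25;27;35;49]);
  (12, 105, [:: 14;15;16;18;20;21;25;27;35;49]); (15, 120, [:: 18;20;21;24;25;27;35]);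
  (15, 125, [:: 18;20;21;24;25;27;35]); (15, 126, [:: 18;20;21;24;25;27;35]);
  (18, 144, [:: 20;21;24;27;28;30;32;45]); (18, 147, [:: 20;21;24;27;28;30;32;45]);
  (18, 150, [:: 20;21;24;27;28;30;32;45;50;75]); (20, 160, [:: 24;25;28;30;32;35;36;42;45]);
  (20, 168, [:: 24;25;28;30;32;35;36;42;45]); (20, 175, [:: 24;25;28;30;32;35;36;42;45]);
  (24, 192, [:: 27;28;30;32;36;40;42;45;50;63;70;75]);
  (24, 196, [:: 27;28;30;32;36;40;42;45;50;63;70;75;98]);
  (24, 200, [:: 27;28;30;32;36;40;42;45;50;63;70;75;98]);
  (24, 210, [:: 27;28;30;32;36;40;42;45;50;63;70;75;98;105]);
  (30, 240, [:: 35;36;40;42;45;48;50;54;63;75]); (30, 245, [:: 35;36;40;42;45;48;50;54;63;75]);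
  (30, 252, [:: 35;36;40;42;45;48;50;54;63;75;125]);
  (36, 300, [:: 40;42;45;48;54;56;60;63;64;75;81;100;105;147]);
  (40, 320, [:: 45;48;50;56;60;64;70;72;75;84;105;125]);
  (40, 336, [:: 45;48;50;56;60;64;70;72;75;84;105;125]);
  (40, 350, [:: 45;48;50;56;60;64;70;72;75;84;105;125;175]);
  (45, 360, [:: 50;54;60;63;70;72;75;80;81;105]);
  (45, 378, [:: 50;54;60;63;70;72;75;80;81;105;125]);
  (60, 480, [:: 70;72;75;80;84;90;96;100;105;108;125;126;135;175]);
  (60, 490, [:: 70;72;75;80;84;90;96;100;105;108;125;126;135;175;245]);
  (60, 504, [:: 70;72;75;80;84;90;96;100;105;108;125;126;135;175;245]);
  (60, 525, [:: 70;72;75;80;84;90;96;100;105;108;125;126;135;175;245]);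
  (72, 600, [:: 80;81;84;90;96;108;112;120;126;128;135;150;189;200;210;225;294]);
  (120, 1008, [:: 135;140;144;150;160;168;180;192;200;210;216;225;250;252;315;350;375;490])];
  Level 9 360 120
  [:: (1, 9, [::]); (2, 18, [:: 3;5;7]); (3, 27, [:: 4;5;7]); (3, 28, [:: 4;5;7]);
  (4, 36, [:: 5;6;7;9]); (5, 45, [:: 6;7;8;9]); (5, 48, [:: 6;7;8;9]); (5, 49, [:: 6;7;8;9]);
  (6, 54, [:: 7;8;9;10;15;25]); (6, 56, [:: 7;8;9;10;15;25]);
  (8, 72, [:: 9;10;12;14;15;21;25;35]); (8, 75, [:: 9;10;12;14;15;21;25;35]);
  (9, 81, [:: 10;12;14;15;16;21;25]); (9, 84, [:: 10;12;14;15;16;21;25]);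
  (10, 90, [:: 12;14;15;16;18;21;25;27;35]); (10, 96, [:: 12;14;15;16;18;21;25;27;35]);
  (10, 98, [:: 12;14;15;16;18;21;25;27;35;49]); (12, 108, [:: 14;15;16;18;20;21;25;27;35;49]);
  (12, 112, [:: 14;15;16;18;20;21;25;27;35;49]); (15, 135, [:: 18;20;21;24;25;27;35]);
  (15, 140, [:: 18;20;21;24;25;27;35]); (15, 144, [:: 18;20;21;24;25;27;35]);
  (15, 147, [:: 18;20;21;24;25;27;35]); (18, 162, [:: 20;21;24;27;28;30;32;45;50;75]);
  (18, 168, [:: 20;21;24;27;28;30;32;45;50;75]); (20, 180, [:: 24;25;28;30;32;35;36;42;45;54]);
  (20, 192, [:: 24;25;28;30;32;35;36;42;45;54]);
  (20, 196, [:: 24;25;28;30;32;35;36;42;45;54;98]);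
  (24, 216, [:: 27;28;30;32;36;40;42;45;50;63;70;75;98;105]);
  (24, 225, [:: 27;28;30;32;36;40;42;45;50;63;70;75;98;105]);
  (30, 270, [:: 35;36;40;42;45;48;50;54;63;75;81;125]);
  (30, 280, [:: 35;36;40;42;45;48;50;54;63;75;81;125]);
  (30, 288, [:: 35;36;40;42;45;48;50;54;63;75;81;125]);
  (30, 294, [:: 35;36;40;42;45;48;50;54;63;75;81;125;147]);
  (36, 336, [:: 40;42;45;48;54;56;60;63;64;75;81;100;105;147]);
  (40, 360, [:: 45;48;50;56;60;64;70;72;75;84;105;108;125;175]);
  (40, 375, [:: 45;48;50;56;60;64;70;72;75;84;105;108;125;175]);
  (40, 384, [:: 45;48;50;56;60;64;70;72;75;84;105;108;125;175]);
  (60, 540, [:: 70;72;75;80;84;90;96;100;105;108;125;126;135;162;175;245]);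
  (60, 560, [:: 70;72;75;80;84;90;96;100;105;108;125;126;135;162;175;245]);
  (60, 576, [:: 70;72;75;80;84;90;96;100;105;108;125;126;135;162;175;245]);
  (72, 675, [:: 80;81;84;90;96;108;112;120;126;128;135;150;189;200;210;225;294;315]);
  (120, 1080, [:: 135;140;144;150;160;168;180;192;200;210;216;225;250;252;315;324;350;375;490;525])];
  Level 10 360 360
  [:: (1, 10, [::]); (2, 20, [:: 3;5;7]); (2, 21, [:: 3;5;7]); (3, 30, [:: 4;5;7]);
  (3, 32, [:: 4;5;7]); (4, 40, [:: 5;6;7;9]); (4, 42, [:: 5;6;7;9]); (5, 50, [:: 6;7;8;9]);
  (5, 54, [:: 6;7;8;9]); (6, 60, [:: 7;8;9;10;15;25]); (6, 63, [:: 7;8;9;10;15;25]);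
  (6, 64, [:: 7;8;9;10;15;25]); (8, 80, [:: 9;10;12;14;15;21;25;35]);
  (8, 81, [:: 9;10;12;14;15;21;25;35]); (8, 84, [:: 9;10;12;14;15;21;25;35]);
  (9, 90, [:: 10;12;14;15;16;21;25;35]); (9, 96, [:: 10;12;14;15;16;21;25;35]);
  (10, 100, [:: 12;14;15;16;18;21;25;27;35;49]); (10, 105, [:: 12;14;15;16;18;21;25;27;35;49]);
  (10, 108, [:: 12;14;15;16;18;21;25;27;35;49]); (12, 120, [:: 14;15;16;18;20;21;25;27;35;49]);
  (12, 125, [:: 14;15;16;18;20;21;25;27;35;49]); (12, 126, [:: 14;15;16;18;20;21;25;27;35;49]);
  (12, 128, [:: 14;15;16;18;20;21;25;27;35;49]); (15, 150, [:: 18;20;21;24;25;27;35]);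
  (15, 162, [:: 18;20;21;24;25;27;35]); (18, 180, [:: 20;21;24;27;28;30;32;45;50;70;75]);
  (18, 189, [:: 20;21;24;27;28;30;32;45;50;70;75]);
  (18, 192, [:: 20;21;24;27;28;30;32;45;50;70;75]);
  (20, 200, [:: 24;25;28;30;32;35;36;42;45;54;98]);
  (20, 210, [:: 24;25;28;30;32;35;36;42;45;54;98]);
  (20, 216, [:: 24;25;28;30;32;35;36;42;45;54;98]);
  (24, 243, [:: 27;28;30;32;36;40;42;45;50;63;70;75;98;105]);
  (24, 252, [:: 27;28;30;32;36;40;42;45;50;63;70;75;98;105]);
  (24, 256, [:: 27;28;30;32;36;40;42;45;50;63;70;75;98;105]);
  (30, 300, [:: 35;36;40;42;45;48;50;54;63;75;81;125;147]);
  (36, 360, [:: 40;42;45;48;54;56;60;63;64;75;81;100;105;140;147]);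
  (40, 405, [:: 45;48;50;56;60;64;70;72;75;84;105;108;125;175;196]);
  (45, 450, [:: 50;54;60;63;70;72;75;80;81;105;125;175]);
  (60, 600, [:: 70;72;75;80;84;90;96;100;105;108;125;126;135;162;175;245;294])];
  Level 11 360 180
  [:: (1, 11, [::]); (2, 22, [:: 3;5;7;11]); (3, 33, [:: 4;5;7;11]); (3, 35, [:: 4;5;7;11]);
  (4, 44, [:: 5;6;7;9;11]); (4, 45, [:: 5;6;7;9;11]); (5, 55, [:: 6;7;8;9;11]);
  (5, 56, [:: 6;7;8;9;11]); (6, 66, [:: 7;8;9;10;11;15;25]); (6, 70, [:: 7;8;9;10;11;15;25]);
  (8, 88, [:: 9;10;11;12;14;15;21;25;35]); (8, 90, [:: 9;10;11;12;14;15;21;25;35]);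
  (9, 100, [:: 10;11;12;14;15;16;21;25;35]); (9, 105, [:: 10;11;12;14;15;16;21;25;35]);
  (10, 110, [:: 11;12;14;15;16;18;21;25;27;35;49]);
  (10, 112, [:: 11;12;14;15;16;18;21;25;27;35;49]);
  (12, 132, [:: 14;15;16;18;20;21;22;25;27;33;35;49;55]);
  (12, 135, [:: 14;15;16;18;20;21;22;25;27;33;35;49;55]);
  (12, 140, [:: 14;15;16;18;20;21;22;25;27;33;35;49;55]);
  (15, 168, [:: 18;20;21;24;25;27;33;35;55]);
  (18, 200, [:: 20;21;22;24;27;28;30;32;33;45;50;70;75]);
  (18, 210, [:: 20;21;22;24;27;28;30;32;33;45;50;70;75]);
  (20, 220, [:: 22;24;25;28;30;32;35;36;42;45;54;55;98]);
  (20, 225, [:: 22;24;25;28;30;32;35;36;42;45;54;55;98]);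
  (24, 264, [:: 27;28;30;32;33;36;40;42;44;45;50;63;70;75;98;105;110]);
  (24, 270, [:: 27;28;30;32;33;36;40;42;44;45;50;63;70;75;98;105;110]);
  (24, 280, [:: 27;28;30;32;33;36;40;42;44;45;50;63;70;75;98;105;110]);
  (30, 336, [:: 33;35;36;40;42;45;48;50;54;55;63;75;81;125;147]);
  (40, 450, [:: 44;45;48;50;55;56;60;64;70;72;75;84;105;108;125;175;196])];
  Level 12 360 360
  [:: (1, 12, [::]); (2, 24, [:: 3;5;7;11]); (2, 25, [:: 3;5;7;11]); (3, 36, [:: 4;5;7;11]);
  (4, 48, [:: 5;6;7;9;11]); (4, 49, [:: 5;6;7;9;11]); (4, 50, [:: 5;6;7;9;11]);
  (5, 60, [:: 6;7;8;9;11]); (6, 72, [:: 7;8;9;10;11;15;25]); (6, 75, [:: 7;8;9;10;11;15;25]);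
  (6, 77, [:: 7;8;9;10;11;15;25]); (8, 96, [:: 9;10;11;12;14;15;21;25;35]);
  (8, 98, [:: 9;10;11;12;14;15;21;25;35;49]); (8, 99, [:: 9;10;11;12;14;15;21;25;35;49]);
  (8, 100, [:: 9;10;11;12;14;15;21;25;35;49]); (9, 112, [:: 10;11;12;14;15;16;21;25;35]);
  (10, 121, [:: 11;12;14;15;16;18;21;25;27;35;49]);
  (12, 144, [:: 14;15;16;18;20;21;22;25;27;33;35;49;55]);
  (12, 147, [:: 14;15;16;18;20;21;22;25;27;33;35;49;55]);
  (12, 150, [:: 14;15;16;18;20;21;22;25;27;33;35;49;55]);
  (12, 154, [:: 14;15;16;18;20;21;22;25;27;33;35;49;55;77]);
  (15, 180, [:: 18;20;21;24;25;27;33;35;55]);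
  (24, 288, [:: 27;28;30;32;33;36;40;42;44;45;50;63;70;75;98;105;110]);
  (24, 300, [:: 27;28;30;32;33;36;40;42;44;45;50;63;70;75;98;105;110;147]);
  (30, 363, [:: 33;35;36;40;42;45;48;50;54;55;63;75;81;125;147])];
  Level 13 360 120
  [:: (1, 13, [::]); (2, 26, [:: 3;5;7;11;13]); (2, 27, [:: 3;5;7;11;13]);
  (3, 39, [:: 4;5;7;11;13]); (3, 40, [:: 4;5;7;11;13]); (4, 52, [:: 5;6;7;9;11;13]);
  (4, 54, [:: 5;6;7;9;11;13]); (4, 55, [:: 5;6;7;9;11;13]); (5, 66, [:: 6;7;8;9;11;13]);
  (6, 78, [:: 7;8;9;10;11;13;15;25]); (6, 80, [:: 7;8;9;10;11;13;15;25]);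
  (6, 81, [:: 7;8;9;10;11;13;15;25]); (8, 105, [:: 9;10;11;12;13;14;15;21;25;35;49]);
  (8, 108, [:: 9;10;11;12;13;14;15;21;25;35;49]);
  (8, 110, [:: 9;10;11;12;13;14;15;21;25;35;49]);
  (10, 135, [:: 11;12;13;14;15;16;18;21;25;27;35;49]);
  (12, 156, [:: 13;14;15;16;18;20;21;22;25;27;33;35;49;55;77]);
  (12, 160, [:: 13;14;15;16;18;20;21;22;25;27;33;35;49;55;77]);
  (12, 162, [:: 13;14;15;16;18;20;21;22;25;27;33;35;49;55;77]);
  (12, 165, [:: 13;14;15;16;18;20;21;22;25;27;33;35;49;55;77])];
  Level 14 360 24
  [:: (1, 14, [::]); (2, 28, [:: 3;5;7;11;13]); (3, 42, [:: 4;5;7;11;13]);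
  (3, 44, [:: 4;5;7;11;13]); (4, 56, [:: 5;6;7;9;11;13]); (6, 84, [:: 7;8;9;10;11;13;15;25]);
  (6, 88, [:: 7;8;9;10;11;13;15;25]); (8, 112, [:: 9;10;11;12;13;14;15;21;25;35;49]);
  (8, 117, [:: 9;10;11;12;13;14;15;21;25;35;49]);
  (12, 169, [:: 13;14;15;16;18;20;21;22;25;27;33;35;49;55;77]);
  (12, 176, [:: 13;14;15;16;18;20;21;22;25;27;33;35])];
  Level 15 360 24
  [:: (1, 15, [::]); (2, 30, [:: 3;5;7;11;13]); (3, 45, [:: 4;5;7;11;13]);
  (4, 60, [:: 5;6;7;9;11;13]); (4, 63, [:: 5;6;7;9;11;13]); (6, 90, [:: 7;8;9;10;11;13;15;25]);
  (6, 91, [:: 7;8;9;10;11;13;15;25]); (8, 121, [:: 9;10;11;12;13;14;15;21;25;35;49]);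
  (12, 180, [:: 13;14;15;16;18;20;21;22;25;27;33;35]);
  (12, 182, [:: 13;14;15;16;18;20;21;22;25;27;33]);
  (12, 189, [:: 13;14;15;16;18;20;21;22;27;33;50])];
  Level 16 24 12
  [:: (1, 16, [::]); (2, 32, [:: 3;5;7;11;13]); (2, 33, [:: 3;5;7;11;13]);
  (3, 48, [:: 4;5;7;11;13]); (3, 49, [:: 4;5;7;11;13]); (3, 50, [:: 4;5;7;11;13]);
  (4, 64, [:: 5;6;7;9;11;13]); (4, 65, [:: 5;6;7;9;11;13]); (4, 66, [:: 5;6;7;9;11;13]);
  (6, 96, [:: 7;8;9;10;11;13;15;25]); (6, 98, [:: 7;8;9;10;11;13;15;25]);
  (6, 99, [:: 7;8;9;10;11;13;15;25]); (6, 100, [:: 7;8;9;10;11;13;15;25]);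
  (12, 192, [:: 13;14;15;16;18;20;21;22;27;33;50]);
  (12, 200, [:: 14;15;16;18;20;21;22;26;27;33;39;50])];
  Level 17 24 6
  [:: (1, 17, [::]); (2, 34, [:: 3;5;7;11;13;17]); (2, 35, [:: 3;5;7;11;13;17]);
  (3, 51, [:: 4;5;7;11;13;17]); (3, 52, [:: 4;5;7;11;13;17]); (4, 68, [:: 5;6;7;9;11;13;17]);
  (4, 70, [:: 5;6;7;9;11;13;17]); (6, 102, [:: 7;8;9;10;11;13;15;17;25]);
  (6, 105, [:: 7;8;9;10;11;13;15;17;25])];
  Level 18 24 12
  [:: (1, 18, [::]); (2, 36, [:: 3;5;7;11;13;17]); (4, 72, [:: 5;6;7;9;11;13;17]);
  (6, 108, [:: 7;8;9;10;11;13;15;17;25]); (6, 110, [:: 7;8;9;10;11;13;15;17;25]);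
  (6, 112, [:: 7;8;9;10;11;13;15;17;25])];
  Level 19 24 2
  [:: (1, 19, [::]); (2, 38, [:: 3;5;7;11;13;17;19]); (2, 39, [:: 3;5;7;11;13;17;19]);
  (4, 78, [:: 5;6;7;9;11;13;17;19]); (6, 114, [:: 7;8;9;10;11;13;15;17;19;25])];
  Level 20 24 1
  [:: (1, 20, [::]); (2, 40, [:: 3;5;7;11;13;17;19]);
  (6, 120, [:: 8;9;10;14;15;21;22;26;33;34;38;39;51;57])];
  Level 21 24 1
  [:: (1, 21, [::]); (2, 42, [:: 3;5;7;11;13;17;19])];
  Level 22 24 2
  [:: (1, 22, [::]); (2, 44, [:: 3;5;7;11;13;17;19])]].

(** Levels begin at 2, since only v <= n / 2 take part. *)
Definition halving_table : seq level := [::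
  Level 2 96 1
  [:: (1, 2, [::])];
  Level 3 96 1
  [:: (2, 6, [::])];
  Level 4 96 2
  [:: (2, 8, [::]); (4, 18, [::]); (6, 24, [:: 8]); (12, 54, [:: 16]); (16, 72, [:: 18]);
  (48, 216, [:: 54;64])];
  Level 5 1728 432
  [:: (4, 20, [::]); (8, 40, [:: 10]); (12, 60, [:: 16;20]); (12, 64, [:: 16;20]);
  (16, 80, [:: 18;20]); (16, 90, [:: 20]); (24, 120, [:: 30;32;40]); (24, 128, [:: 30;32;40]);
  (32, 162, [:: 36;40]); (32, 180, [:: 36;40]); (36, 180, [:: 40;48]); (36, 192, [:: 40;48;64]);
  (36, 200, [:: 40;48;50;64]); (48, 240, [:: 54;60;64;80]); (48, 270, [:: 60;64;80]);
  (64, 360, [:: 72;80;90]); (72, 360, [:: 80;90;96]); (72, 384, [:: 80;90;96;128]);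
  (72, 400, [:: 80;90;96;100;128]); (96, 486, [:: 108;120;128;160]);
  (96, 512, [:: 108;120;128;160]); (96, 540, [:: 108;120;128;160]);
  (108, 540, [:: 120;144;160]); (108, 576, [:: 120;128;144;160]);
  (108, 600, [:: 120;128;144;150;160;200]); (144, 720, [:: 160;162;180;192]);
  (144, 810, [:: 160;180;192;200;256]); (192, 1080, [:: 216;240;256;270;320]);
  (216, 1080, [:: 240;270;288;320]); (216, 1152, [:: 240;256;270;288;320]);
  (288, 1458, [:: 320;324;360;384]); (288, 1536, [:: 320;324;360;384;512]);
  (288, 1600, [:: 300;320;324;360;384;400;500;512]);
  (288, 1620, [:: 300;320;324;360;384;400;500;512])];
  Level 6 1440 360
  [:: (4, 24, [::]); (8, 54, [::]); (12, 72, [:: 16;20]); (12, 80, [:: 16;20]);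
  (16, 96, [:: 20]); (16, 100, [:: 20]); (16, 108, [:: 20]); (20, 120, [:: 24;32]);
  (20, 128, [:: 24;32]); (24, 162, [:: 32;40]); (32, 192, [:: 36;40]); (32, 200, [:: 36;40;50]);
  (32, 216, [:: 36;40;50]); (36, 216, [:: 40;48;50;64]); (36, 216, [:: 40;48;64]);
  (36, 240, [:: 40;48;64]); (40, 270, [:: 48;64]); (48, 288, [:: 60;64;80]);
  (48, 300, [:: 60;64;80;100]); (48, 320, [:: 60;64;80;100]); (48, 324, [:: 60;64;80;100]);
  (60, 360, [:: 64;72;80;100]); (60, 384, [:: 64;72;80;100]); (60, 400, [:: 64;72;80;100]);
  (72, 486, [:: 80;96;100;128]); (72, 500, [:: 80;96;100;128]); (80, 486, [:: 96;100;108;128]);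
  (80, 500, [:: 96;100;108;128]); (80, 512, [:: 96;100;108;128]);
  (80, 540, [:: 96;100;108;128]); (96, 576, [:: 108;120;128;160]);
  (96, 600, [:: 100;108;120;128;160]); (96, 640, [:: 100;108;120;128;160]);
  (96, 648, [:: 100;108;120;128;160]); (120, 810, [:: 128;144;160;200]);
  (144, 864, [:: 160;180;192;200;256]); (144, 900, [:: 160;180;192;200;256]);
  (144, 960, [:: 160;180;192;200;256]); (144, 972, [:: 160;180;192;200;256]);
  (160, 972, [:: 180;192;200;216;256]); (160, 1024, [:: 180;192;200;216;250;256]);
  (160, 1080, [:: 180;192;200;216;250;256]); (180, 1080, [:: 192;200;216;240;256;320]);
  (180, 1152, [:: 192;200;216;240;256;320]); (288, 1728, [:: 300;320;324;360;384;400;500;512]);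
  (288, 1800, [:: 300;320;324;360;384;400;500;512]);
  (288, 1944, [:: 300;320;324;360;384;400;500;512])];
  Level 7 1440 720
  [:: (8, 56, [:: 14]); (8, 60, [:: 14]); (8, 60, [::]); (16, 112, [:: 20;28]);
  (16, 120, [:: 20;28]); (16, 126, [:: 20;28]); (24, 168, [:: 28;32;40]);
  (24, 180, [:: 28;32;40]); (24, 180, [:: 32;40;56]); (32, 224, [:: 36;40;56]);
  (32, 240, [:: 36;40;56]); (40, 280, [:: 48;56;64;70]); (40, 288, [:: 48;56;64;70]);
  (40, 300, [:: 48;56;64;70]); (48, 336, [:: 56;60;64;80;100]); (48, 360, [:: 56;60;64;80;100]);
  (48, 378, [:: 56;60;64;80;100]); (72, 504, [:: 80;84;96;100;112;128;140]);
  (72, 512, [:: 80;84;96;100;112;128;140]); (72, 540, [:: 80;84;96;100;112;128;140]);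
  (72, 560, [:: 80;96;100;112;128;140]); (80, 560, [:: 96;100;108;112;128;140]);
  (80, 576, [:: 96;100;108;112;128;140]); (80, 600, [:: 96;100;108;112;128;140]);
  (96, 672, [:: 108;112;120;128;140;160;200]); (96, 700, [:: 108;112;120;128;140;160;200]);
  (96, 720, [:: 108;112;120;128;140;160;200]);
  (144, 1024, [:: 160;168;180;192;200;224;250;256;280]);
  (144, 1080, [:: 160;168;180;192;200;224;250;256;280]);
  (144, 1120, [:: 160;168;180;192;200;224;256;280]);
  (144, 1134, [:: 160;168;180;192;200;224;256;280]); (160, 1120, [:: 180;192;200;216;224;280]);
  (240, 1800, [:: 256;280;288;300;320;324;336;400;448;500]);
  (288, 2016, [:: 320;324;336;360;384;400;420;448;500;512;560]);
  (288, 2048, [:: 320;324;336;360;384;400;420;448;500;512;560]);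
  (288, 2100, [:: 320;324;336;360;384;400;420;448;500;512;560;700])];
  Level 8 1440 720
  [:: (8, 64, [::]); (16, 128, [:: 20;28]); (16, 128, [:: 28]); (24, 192, [:: 32;40;56]);
  (24, 200, [:: 32;40;50;56]); (32, 270, [:: 40;56]); (32, 280, [:: 40;56;70]);
  (40, 324, [:: 48;56;64]); (40, 336, [:: 48;56;64]); (48, 384, [:: 56;60;64;80;100]);
  (48, 392, [:: 56;60;64;80;98;100]); (48, 400, [:: 56;60;64;80;98;100]);
  (48, 400, [:: 56;64;80;98;100]); (72, 576, [:: 80;96;100;112;128;140]);
  (72, 600, [:: 80;96;100;112;128;140]); (72, 630, [:: 80;96;100;112;128;140]);
  (72, 640, [:: 80;96;100;112;128;140]); (80, 648, [:: 96;100;108;112;128;140]);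
  (96, 810, [:: 112;120;128;140;160;196;200]); (96, 840, [:: 112;120;128;140;160;196;200]);
  (144, 1152, [:: 160;168;180;192;200;224;256;280]);
  (144, 1176, [:: 160;168;180;192;196;200;224;256;280]);
  (144, 1200, [:: 160;168;180;192;196;200;224;256;280]);
  (288, 2430, [:: 320;336;360;384;400;420;448;512;560;588;784])];
  Level 9 1440 360
  [:: (8, 72, [::]); (16, 144, [:: 28]); (24, 216, [:: 32;40;50;56]); (24, 224, [:: 32;40;56]);
  (32, 288, [:: 40;56;70]); (32, 300, [:: 40;56]); (40, 360, [:: 48;56;64]);
  (48, 432, [:: 56;64;80;100]); (48, 450, [:: 56;64;80;100]);
  (72, 648, [:: 80;96;100;112;128;140]); (72, 672, [:: 80;96;112;128;140]);
  (72, 700, [:: 80;96;112;128;140]); (96, 900, [:: 112;120;128;160;196;200])];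
  Level 10 1440 24
  [:: (8, 80, [::]); (16, 162, [:: 28]); (16, 168, [:: 28]); (24, 240, [:: 32;40;56]);
  (48, 486, [:: 56;64;80;100]); (48, 500, [:: 56;64;80;100]); (48, 504, [:: 56;64;80;100]);
  (48, 512, [:: 56;64;80;100]); (72, 720, [:: 80;96;112;128;140])];
  Level 11 288 12
  [:: (16, 176, [:: 28;44]); (16, 180, [:: 44]); (48, 528, [:: 56;64;80;88;100]);
  (48, 540, [:: 56;64;80;88;100]); (48, 560, [:: 64;80;88;100;112;140])];
  Level 12 288 8
  [:: (16, 192, [:: 44]); (16, 200, [:: 44;50]); (48, 576, [:: 64;80;88;100;112;140])]].
Close Scope N_scope.

(** 0.452946 in units of 10^-15; it exceeds ln 1.572939. *)
Lemma prime_table_ok : uniqN (map floor prime_table) &&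
  N.leb 452946000000000 (table_score prime_system prime_table).
Proof. by vm_compute. Qed.

(** 0.1381888 in the same units, more than half of ln 1.318345. *)
Lemma halving_table_ok : uniqN (map floor halving_table) &&
  N.leb 138188800000000 (table_score halving_system halving_table).
Proof. by vm_compute. Qed.

Local Open Scope R_scope.

Lemma primitive_count_limit (a : R) :
  is_lim_seq (nth_root_seq primitive_count) a -> 1.572939 < a.
Proof.
move=> ha; apply: Rlt_le_trans (table_limit prime_systemP _ _ upsets_le_primitive prime_table_ok ha) => //.
  rewrite -[1.572939]exp_ln; last lra.
  (* 0.22267882 lies just above (y - 1) / (y + 1) for y = 1.572939. *)
  apply: exp_increasing; apply: (@ln_lt_atanh7 _ 0.22267882); try lra.
  by rewrite (@NR_ratio 452946000000000%num 452946000000000%Z erefl) /atanh7; lra.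
by move=> k; apply: prime_gt1.
Qed.

(** The bound on the square is the stronger one: 1.148192 ^ 2 < 1.318345. *)
Lemma maximum_primitive_count_limit (b : R) :
  is_lim_seq (nth_root_seq maximum_primitive_count) b -> 1.148192 < b /\ 1.318345 < b ^ 2.
Proof.
move=> hb; have := table_limit halving_systemP _ _ upsets_le_maximum halving_table_ok hb.
move=> /(_ erefl) h.
have {}h : exp (NR 138188800000000 / SR) <= b.
  apply: h => k /orP[/eqP -> //|/andP[ok pk]].
  by have := prime_gt1 pk; case: k ok {pk} => [|[|[]]].
have h2 : 1.318345 < exp (NR 138188800000000 / SR) ^ 2.
  rewrite -Rsqr_pow2 /Rsqr -exp_plus -[1.318345]exp_ln; last lra.
  apply: exp_increasing; apply: (@ln_lt_atanh7 _ 0.1373157); try lra.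
  by rewrite (@NR_ratio 138188800000000%num 138188800000000%Z erefl) /atanh7; lra.
have b0 := exp_pos (NR 138188800000000 / SR).
have h3 : 1.318345 < b ^ 2 by move: h h2 b0; set x := exp _ => *; nra.
split => //; have bp : 0 < b by lra.
by apply: Rnot_le_lt => hb'; nra.
Qed.

(** * Rates for maximal primitive sets *)

Local Open Scope nat_scope.

Local Open Scope N_scope.
(** [sizes] are the numbers below [stop] whose primes divide [coarse], in sweep order, by odd part.
    The first tier has no finer classes, whence [inner] = [start] = 1. Since 250 = 2 * 5^3 and 2187
    = 3^7, the thresholds 250 / 5^i and 2187 / 3^i that occur are integers, as [windows_ok] needs;
    16384 = 2^14 is a power of two for the sake of [class_upper_tail]. *)
Definition tier30 := Tier 30 7 1 1 250
  [:: 1; 2; 4; 8; 16; 32; 64; 128; 3; 6; 12; 24; 48; 96; 192; 9; 18; 36; 72; 144; 27; 54; 108;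
    216; 81; 162; 243; 5; 10; 20; 40; 80; 160; 15; 30; 60; 120; 240; 45; 90; 180; 135; 25; 50;
    100; 200; 75; 150; 225; 125].
Definition tier6 := Tier 6 5 5 250 2187
  [:: 1; 2; 4; 8; 16; 32; 64; 128; 256; 512; 1024; 2048; 3; 6; 12; 24; 48; 96; 192; 384; 768;
    1536; 9; 18; 36; 72; 144; 288; 576; 1152; 27; 54; 108; 216; 432; 864; 1728; 81; 162; 324; 648;
    1296; 243; 486; 972; 1944; 729; 1458].
Definition tier2 := Tier 2 3 3 2187 16384
  [:: 1; 2; 4; 8; 16; 32; 64; 128; 256; 512; 1024; 2048; 4096; 8192].
Close Scope N_scope.

Lemma tiers_ok : [&& tier_ok tier30, tier_ok tier6 & tier_ok tier2].
Proof. by vm_compute. Qed.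

Definition rate_lower : N := 194829000000000%num.
Definition rate_upper : N := 214706000000000%num.

Lemma tiers_lower_score : N.leb rate_lower
  (lower_score tier30 + lower_score tier6 + lower_score tier2).
Proof. by vm_compute. Qed.

Lemma tiers_upper_score : N.leb
  (upper_score tier30 + upper_score tier6 + upper_score tier2) rate_upper.
Proof. by vm_compute. Qed.

Lemma rate_lowerE : (NR rate_lower / SR = 194829 / 1000000)%R.
Proof. by rewrite (@NR_ratio rate_lower 194829000000000%Z erefl); lra. Qed.

Lemma rate_upperE : (NR rate_upper / SR = 214706 / 1000000)%R.
Proof. by rewrite (@NR_ratio rate_upper 214706000000000%Z erefl); lra. Qed.

Global Opaque rate_lower rate_upper.

Lemma coprime_N (a b : N) : N.eqb (N.gcd a b) 1 = coprime (N.to_nat b) (N.to_nat a).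
Proof.
apply/N.eqb_spec/eqP => h; last first.
  have [[k ka] [l lb]] := (N.gcd_divide_l a b, N.gcd_divide_r a b).
  have : N.to_nat (N.gcd a b) %| gcdn (N.to_nat b) (N.to_nat a).
    rewrite dvdn_gcd; apply/andP; split; apply/dvdnP.
      by exists (N.to_nat l); rewrite [in LHS]lb N2Nat.inj_mul.
    by exists (N.to_nat k); rewrite [in LHS]ka N2Nat.inj_mul.
  by rewrite h dvdn1 => /eqP; lia.
have /dvdnP[k ka] := dvdn_gcdr (N.to_nat b) (N.to_nat a).
have /dvdnP[l lb] := dvdn_gcdl (N.to_nat b) (N.to_nat a).
set g := gcdn _ _ in ka lb *.
have : (N.of_nat g | N.gcd a b)%num.
  apply: N.gcd_greatest; first by exists (N.of_nat k); nia.
  by exists (N.of_nat l); nia.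
by rewrite h => -[m e]; have := N.eq_mul_1 m (N.of_nat g); lia.
Qed.

Lemma class_baseE (M d : N) (b : nat) : (d <> 0)%num ->
  class_base M d (N.of_nat b) = coprime (N.to_nat M) b && (N.to_nat d %| b).
Proof.
move=> d0; rewrite /class_base coprime_N Nat2N.id; congr (_ && _).
by rewrite -/(divides d (N.of_nat b)) dividesE ?Nat2N.id //; apply/eqP.
Qed.

Lemma N_leq (a b : N) : (a <= b)%num -> N.to_nat a <= N.to_nat b.
Proof. by lia. Qed.

(** [rel] is compatible with addition, so that <= and >= are treated at once. *)
Lemma ln_prod_bound (rel : R -> R -> Prop) (F g : nat -> nat) n : rel 0%R 0%R ->
  (forall a b c d, rel a b -> rel c d -> rel (a + c)%R (b + d)%R) ->
  (forall b, 0 < b <= n -> 0 < F b /\ rel (SR * ln (INR (F b)))%R (INR (g b))) ->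
  0 < \prod_(1 <= b < n.+1) F b /\
  rel (SR * ln (INR (\prod_(1 <= b < n.+1) F b)))%R (INR (\sum_(1 <= b < n.+1) g b)).
Proof.
move=> r0 rD; elim: n => [|n IH] h; first by rewrite !big_geq // ln_1 Rmult_0_r.
have [|p0 hp] := IH; first by move=> b hb; apply: h; lia.
have [f0 hf] := h n.+1 ltac:(lia).
rewrite !(big_nat_recr n.+1) //= muln_gt0 p0 f0; split => //.
rewrite INR_muln ln_mult; [|apply/lt_0_INR/ltP..] => //.
by rewrite INR_addn Rmult_plus_distr_l; apply: rD.
Qed.

Definition tiers_scan (val : tier -> N -> N) (n b : nat) : nat :=
  scan_value tier30 (val tier30) 1 (cuts tier30) n b +
  scan_value tier6 (val tier6) 1 (cuts tier6) n b +
  scan_value tier2 (val tier2) 1 (cuts tier2) n b.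

Lemma tiers_lower_rate :
  lower_rate (fun n => \sum_(1 <= b < n.+1) tiers_scan lower_log n b) (SR * (194829 / 1000000)).
Proof.
rewrite -rate_lowerE -ratio_SR.
have /and3P[ok30 ok6 ok2] := tiers_ok; have := tiers_lower_score.
have r := lower_rateD (lower_rateD (lower_score_rate ok30) (lower_score_rate ok6)) (lower_score_rate ok2).
move: r; rewrite /tiers_scan; move: (lower_score _) (lower_score _) (lower_score _) => s30 s6 s2.
move: (scan_value tier30 _ _ _) (scan_value tier6 _ _ _) (scan_value tier2 _ _ _) => f30 f6 f2.
move=> r /N.leb_spec0 le.
apply: lower_rate_le r => [n|].
  rewrite !big_split; exact: leqnn.
by rewrite -!NR_add; apply: le_INR; move: le; move: rate_lower => s; lia.
Qed.

Lemma tiers_upper_rate :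
  upper_rate (fun n => \sum_(1 <= b < n.+1) tiers_scan upper_log n b) (SR * (214706 / 1000000)).
Proof.
rewrite -rate_upperE -ratio_SR.
have /and3P[ok30 ok6 ok2] := tiers_ok; have := tiers_upper_score.
have r := upper_rateD (upper_rateD (upper_score_rate ok30) (upper_score_rate ok6)) (upper_score_rate ok2).
move: r; rewrite /tiers_scan; move: (upper_score _) (upper_score _) (upper_score _) => s30 s6 s2.
move: (scan_value tier30 _ _ _) (scan_value tier6 _ _ _) (scan_value tier2 _ _ _) => f30 f6 f2.
move=> r /N.leb_spec0 le.
apply: upper_rate_le r => [n|].
  rewrite !big_split; exact: leqnn.
by rewrite -!NR_add; apply: le_INR; move: le; move: rate_upper => s; lia.
Qed.

Section Bounds.
Variables n T5 T3 T2 : nat.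
Hypotheses (T5E : T5 = N.to_nat 250) (T3E : T3 = N.to_nat 2187).
Hypotheses (T2E : T2 = N.to_nat 16384) (T2_pow : T2 = expn 2 14).
Let level := lev n T5 T3 T2.
Let lower := class_lower n T5 T3 T2.
Let upper := class_upper n T5 T3 T2.

Let tier (i : nat) : tier := match i with 0 => tier30 | 1 => tier6 | _ => tier2 end.

Let tier_i_ok i : tier_ok (tier i).
Proof.
have /and3P[h30 h6 h2] := tiers_ok.
by case: i => [|[|i]]; [exact h30 | exact h6 | exact h2].
Qed.

(** [lev1] and [lev2] express the level by inequalities on the 5-part or the 3-part of b; on a
    window [leq_part_window] makes them divisibility by a power of [inner]. For [lev0] this power is
    1. *)
Lemma tier_active i b lo hi j : i < 3 -> 0 < b -> window_spec (tier i) lo hi j ->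
  N.to_nat lo <= n %/ b < N.to_nat hi -> n < threshold T5 T3 T2 i * b ->
  (level b == i) && coprime (moduli i) b =
  class_base (coarse (tier i)) (N.pow (inner (tier i)) (N.of_nat j)) (N.of_nat b).
Proof.
move=> i3 b0 [ws1 ws2 _] win nT.
have stepE i' : N.to_nat (N.pow (inner (tier i)) (N.of_nat i')) = expn (N.to_nat (inner (tier i))) i'.
  exact: to_nat_pow.
have w1 : N.to_nat (start (tier i)) <= expn (N.to_nat (inner (tier i))) j * N.to_nat lo.
  by rewrite -stepE; have := N_leq ws1; rewrite N2Nat.inj_mul.
have w2 i' : j = i'.+1 -> expn (N.to_nat (inner (tier i))) i' * N.to_nat hi <= N.to_nat (start (tier i)).
  by move=> e; rewrite -stepE; have := N_leq (ws2 i' e); rewrite N2Nat.inj_mul.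
rewrite class_baseE ?stepE; last first.
  by apply: N.pow_nonzero; case: i i3 {nT ws1 ws2 stepE w1 w2} => [|[|[|i]]].
case: i i3 nT {ws1 ws2 stepE} w1 w2 => [|[|[|i]]] // _ nT w1 w2.
- by rewrite /level lev0 // nT andbT /= exp1n dvd1n andbT.
- rewrite /level lev1 // nT andbT; congr (_ && _).
  by rewrite T5E; apply: leq_part_window w1 w2 win.
rewrite /level lev2 // ?nT ?andbT; last by rewrite T5E T3E; apply: N_leq; lia.
by congr (_ && _); rewrite T3E; apply: leq_part_window w1 w2 win.
Qed.

Lemma tier_scan i b : i < 3 -> 0 < b <= n ->
  if (level b == i) && coprime (moduli i) b then exists a, [/\
    upper b = N.to_nat (upper_count (ratio (tier i)) (sizes (tier i)) a),
    lower b = N.to_nat (lower_count (ratio (tier i)) (sizes (tier i)) a) &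
    forall val, scan_value (tier i) val 1 (cuts (tier i)) n b = N.to_nat (val a)]
  else forall val, scan_value (tier i) val 1 (cuts (tier i)) n b = 0.
Proof.
move=> i3 /andP[b0 bn]; apply: (level_scan (tier_i_ok i)) => //.
- by case: i i3 => [|[|[|i]]].
- by case: i i3 => [|[|[|i]]].
- by case: i i3 => [|[|[|i]]] //= _; rewrite ?T5E ?T3E ?T2E.
by move=> lo hi j; apply: tier_active.
Qed.

Lemma block_scan b : 0 < b <= n ->
  (exists i a, [/\
    upper b = N.to_nat (upper_count (ratio (tier i)) (sizes (tier i)) a),
    lower b = N.to_nat (lower_count (ratio (tier i)) (sizes (tier i)) a) &
    forall val, tiers_scan val n b = N.to_nat (val (tier i) a)]) \/
  [/\ upper b = 1, lower b = 1 & forall val, tiers_scan val n b = 0].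
Proof.
move=> hb; have b0 : 0 < b by case/andP: hb.
pose f i v := scan_value (tier i) v 1 (cuts (tier i)) n b.
have fE val : tiers_scan val n b = f 0 (val (tier 0)) + f 1 (val (tier 1)) + f 2 (val (tier 2)).
  by [].
have act i (i3 : i < 3) := tier_scan i3 hb : if (level b == i) && coprime (moduli i) b
  then exists a, [/\ upper b = N.to_nat (upper_count (ratio (tier i)) (sizes (tier i)) a),
    lower b = N.to_nat (lower_count (ratio (tier i)) (sizes (tier i)) a) &
    forall v, f i v = N.to_nat (v a)] else forall v, f i v = 0.
move: @f fE act => f fE act.
case c : ((level b < 3) && coprime (moduli (level b)) b); [left | right].
  have /andP[l3 cop] := c; have := act _ l3; rewrite eqxx cop => -[a [e1 e2 e3]].
  exists (level b), a; split => // val; rewrite fE -e3.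
  have out i v : i < 3 -> i != level b -> f i v = 0.
    by move=> i3 ne; have := act i i3; rewrite eq_sym (negPf ne); apply.
  case: (level b) l3 out => [|[|[|l]]] // _ out.
  - by rewrite (out 1) // (out 2) // !addn0.
  - by rewrite (out 0) // (out 2) // addn0.
  by rewrite (out 0) // (out 1).
have [e1 e2] := class_trivial b0 (negbT c); split => // val; rewrite fE.
have out i v : i < 3 -> f i v = 0.
  move=> i3; have := act i i3; case: ifP => [/andP[/eqP l cop]|_ //].
  by rewrite l i3 cop in c.
by rewrite !out.
Qed.

Lemma maximal_primitive_count_ge_ln :
  (INR (\sum_(1 <= b < n.+1) tiers_scan lower_log n b) <=
   SR * ln (INR (maximal_primitive_count n)))%R.
Proof.
have [|||F0 hF] := @ln_prod_bound (fun x y => y <= x)%R lower (tiers_scan lower_log n) n.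
- exact: Rle_refl.
- by move=> a b c d ab cd; apply: Rplus_le_compat.
- move=> b hb; have b0 := class_lower_gt0 n T5 T3 T2 b; split => //.
  case: (block_scan hb) => [[i [a [_ e2 e3]]]|[_ e2 e3]]; last first.
    by rewrite e2 e3 ln_1 Rmult_0_r; apply: Rle_refl.
  rewrite e3 e2; apply: fln_lower_le => w0.
  by rewrite -/(lower b) e2 w0 in b0.
apply: Rle_trans hF _; apply: Rmult_le_compat_l; first exact: Rlt_le SR_gt0.
apply: ln_le; first by apply/lt_0_INR/ltP.
apply/INR_leq/(leq_trans _ (maximal_primitive_count_ge n T5 T3 T2)).
by rewrite [leqRHS]big_ltn // class_lower_tail mul1n.
Qed.

(** The last term is the class 0: at most 15 * (n / 2 ^ 14 + 1) elements, all of whose subsets are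
    counted. *)
Lemma maximal_primitive_count_le_ln :
  (SR * ln (INR (maximal_primitive_count n)) <=
   INR (\sum_(1 <= b < n.+1) tiers_scan upper_log n b) +
   SR * (15 * (INR n / 16384 + 1) * ln 2))%R.
Proof.
have [|||F0 hF] := @ln_prod_bound Rle upper (tiers_scan upper_log n) n.
- exact: Rle_refl.
- by move=> a b c d; apply: Rplus_le_compat.
- move=> b hb; have b0 := class_upper_gt0 n T5 T3 T2 b; split => //.
  case: (block_scan hb) => [[i [a [e1 _ e3]]]|[e1 _ e3]]; last first.
    by rewrite e1 e3 ln_1 Rmult_0_r; apply: Rle_refl.
  rewrite e3 e1; apply: fln_upper_ge => w0.
  by rewrite -/(upper b) e1 w0 in b0.
have s0 := SR_gt0; have u0 := class_upper_gt0 n T5 T3 T2 0.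
have tail := class_upper_tail n T5 T3 14; rewrite -T2_pow in tail.
have le := maximal_primitive_count_le n T5 T3 T2; rewrite big_ltn // in le.
have m0 : 0 < maximal_primitive_count n.
  rewrite maximal_primitive_countE; apply: maximal_count_gt0; first exact: comparableC.
  exact: comparableI.
have lnle : (ln (INR (maximal_primitive_count n)) <=
    ln (INR (upper 0)) + ln (INR (\prod_(1 <= b < n.+1) upper b)))%R.
  rewrite -ln_mult; [|apply/lt_0_INR/ltP..] => //.
  by rewrite -INR_muln; apply: ln_le; [apply/lt_0_INR/ltP | apply: INR_leq].
have lntail : (ln (INR (upper 0)) <= 15 * (INR n / 16384 + 1) * ln 2)%R.
  apply: Rle_trans (ln_le _ _ _ (INR_leq tail)) _; first by apply/lt_0_INR/ltP.
  have -> k : INR (expn 2 k) = pow 2 k.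
    by elim: k => [|k IH]; rewrite ?expn0 // expnS INR_muln IH /=; lra.
  rewrite ln_pow2 INR_muln (S_INR (n %/ T2)); apply: Rmult_le_compat_r; first by have := ln_lt_2; lra.
  rewrite (_ : INR 15 = 15%R :> R); last by rewrite /=; lra.
  suff : (INR (n %/ T2) <= INR n / 16384)%R by lra.
  apply: (Rmult_le_reg_r 16384); first lra.
  have -> : (INR n / 16384 * 16384 = INR n)%R by field.
  have -> : (16384 = INR T2)%R by rewrite T2E NR_IZR.
  by rewrite -INR_muln; apply/INR_leq/leq_trunc_div.
have := Rmult_le_compat_l _ _ _ (Rlt_le _ _ s0) lnle.
have := Rmult_le_compat_l _ _ _ (Rlt_le _ _ s0) lntail.
lra.
Qed.

End Bounds.

Lemma maximal_primitive_count_limit (eta : R) :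
  is_lim_seq (nth_root_seq maximal_primitive_count) eta -> (1.2125 < eta /\ eta < 1.240904)%R.
Proof.
have T2E : expn 2 14 = N.to_nat 16384 := esym (to_nat_pow 2 14).
have s0 := SR_gt0; move=> he; split.
  have [C hC] := tiers_lower_rate.
  apply: Rlt_le_trans (@limit_ge _ eta (194829 / 1000000) (C / SR) _ he).
    rewrite -[1.2125%R]exp_ln; last lra.
    apply: exp_increasing; apply: (@ln_lt_atanh7 _ 0.0960453); try lra.
    by rewrite /atanh7; lra.
  move=> n; have h := @maximal_primitive_count_ge_ln n _ _ _ erefl erefl T2E erefl.
  apply: (Rmult_le_reg_l SR); first exact: s0.
  apply: (Rle_trans _ _ _ _ h); apply: (Rle_trans _ _ _ _ (hC n)).
  by apply: Req_le; field; lra.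
have [C hC] := tiers_upper_rate.
set c := (214706 / 1000000 + 15 / 16384 * ln 2)%R.
apply: Rle_lt_trans (@limit_le _ eta c (C / SR + 15 * ln 2) _ he) _.
  move=> n; have h := @maximal_primitive_count_le_ln n _ _ _ erefl erefl T2E erefl.
  rewrite /c.
  apply: (Rmult_le_reg_l SR); first exact: s0.
  apply: (Rle_trans _ _ _ h).
  have -> : (SR * ((214706 / 1000000 + 15 / 16384 * ln 2) * INR n + (C / SR + 15 * ln 2)) =
     SR * (214706 / 1000000) * INR n + C + SR * (15 * (INR n / 16384 + 1) * ln 2))%R by field; lra.
  exact: Rplus_le_compat_r.
rewrite -[1.240904%R]exp_ln; last lra.
apply: exp_increasing; rewrite /c.
have l2 : (ln 2 < 0.6931472)%R by apply: (@ln_lt_atanh7 _ (1/3)); rewrite /atanh7; lra.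
(* 0.107503 lies just below (y - 1) / (y + 1) for y = 1.240904, as here ln y is bounded from
   below. *)
have := @atanh7_le 0.107503 ltac:(lra).
have : (ln ((1 + 0.107503) / (1 - 0.107503)) <= ln 1.240904)%R by apply: ln_le; lra.
rewrite /atanh7; lra.
Qed.

Open Scope R_scope.
Unset Implicit Arguments.

Theorem theorem2p5 (alpha beta eta : R) :
  is_lim_seq (nth_root_seq primitive_count) alpha ->
  is_lim_seq (nth_root_seq maximum_primitive_count) beta ->
  is_lim_seq (nth_root_seq maximal_primitive_count) eta ->
  1.572939 < alpha /\
  (1.148192 < beta /\ 1.318345 < beta ^ 2) /\
  (1.212500 < eta /\ eta < 1.240904).
Proof.
move=> ha hb he; split; first exact: primitive_count_limit ha.
split; first exact: maximum_primitive_count_limit hb.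
have [h1 h2] := maximal_primitive_count_limit he; split; lra.
Qed.
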